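(* Let $z(x,y)>0$ be a smooth solution of the constant astigmatism equation $z_{yy}+(1/z)_{xx}+2=0$ on a simply connected open set $U$, let $\chi,\eta,\xi$ be its potentials (see context), and let $$A=\begin{pmatrix} a_{11} & a_{12} \\ a_{21} & a_{22} \end{pmatrix}$$ be a real matrix with $\det A=\pm1$. Define $\mathcal X_A(x,y,z)=(x_A',y_A',z_A')$ by $$x_A'=\frac{(a_{11}+a_{12}x)(a_{21}+a_{22}x)z+a_{12}a_{22}}{(a_{11}+a_{12}x)^2z+a_{12}^2},\qquad \pm y_A'=a_{12}^2\eta+a_{11}a_{12}\chi-a_{11}y(a_{11}+a_{12}x),$$ $$z_A'=\frac{\big((a_{11}+a_{12}x)^2z+a_{12}^2\big)^2}{z},$$ and $\mathcal Y_A(x,y,z)=(x_A^*,y_A^*,z_A^* )$ by $$\pm x_A^*=a_{12}^2\xi-a_{11}a_{12}\chi-a_{11}x(a_{11}+a_{12}y),\qquad y_A^*=\frac{(a_{11}+a_{12}y)(a_{21}+a_{22}y)+a_{12}a_{22}z}{(a_{11}+a_{12}y)^2+a_{12}^2z},$$ $$z_A^*=\frac{z}{\big((a_{11}+a_{12}y)^2+a_{12}^2z\big)^2},$$ where each sign $\pm$ may be chosen arbitrarily. Then: (i) $z_A'$ as a function of $(x_A',y_A')$ and $z_A^*$ as a function of $(x_A^*,y_A^* )$ are solutions of the constant astigmatism equation as well (on domains where $(x_A',y_A')$, resp. $(x_A^*,y_A^* )$, are local coordinates). (ii) Let $\mathbf r(x,y)$ be a surface of constant astigmatism corresponding to $z(x,y)$,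 with unit normal $\mathbf n$. The corresponding surfaces $\mathbf r_A'$ and $\mathbf r_A^*$ (see context), with $A$ running through all real matrices with $\det A=\pm1$, exhaust all constant astigmatism surfaces sharing one of the evolutes with the seed surface $\mathbf r$. That is, locally, near points where the sheet in question is a regular surface, every surface of constant astigmatism having $\mathbf r+\sigma\mathbf n$ as one of the two sheets of its evolute is one of the surfaces $\mathbf r'_A$, and every surface of constant astigmatism having $\mathbf r+\rho\mathbf n$ as one of the two sheets of its evolute is one of the surfaces $\mathbf r^*_A$ (as unparametrized surfaces, up to orientation).
   Context: Potentials: $\chi,\eta,\xi$ are functions, unique up to additive constants, with $$\chi_x=z_y+y,\quad \chi_y=\frac{z_x}{z^2}-x;\qquad \eta_x=xz_y,\quad \eta_y=x\frac{z_x}{z^2}+\frac1z-x^2;\qquad \xi_x=-yz_y+z-y^2,\quad \xi_y=-y\frac{z_x}{z^2}.$$ Surfaces: a surface in Euclidean 3-space is of constant astigmatism if its principal radii of curvature $\rho,\sigma$ satisfy $\sigma-\rho=\mathrm{const}\ne0$; the ambient scale is fixed so that the constant is $\pm1$. To a solution $z(x,y)$ there corresponds (uniquely up to rigid motions) a surface $\mathbf r(x,y)$ with unit normal $\mathbf n(x,y)$ whose first and second fundamental forms are $$\mathbf I=u^2\,dx^2+v^2\,dy^2,\qquad \mathbf{II}=\frac{u^2}{\rho}\,dx^2+\frac{v^2}{\sigma}\,dy^2,$$ with $u=\tfrac12(\ln z-2)\sqrt z$, $v=\frac{\ln z}{2\sqrt z}$, $\rho=\tfrac12\ln z-1$, $\sigma=\tfrac12\ln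 z$, and with $\mathbf n_x=-\mathbf r_x/\rho$, $\mathbf n_y=-\mathbf r_y/\sigma$ (where $z\ne1,e^2$). Its evolute (locus of the principal centres of curvature) has two sheets, $\mathbf r+\sigma\mathbf n$ and $\mathbf r+\rho\mathbf n$. The surfaces corresponding to $\mathcal X_A$ and $\mathcal Y_A$ are, with $p=a_{11}+a_{12}x$ and $q=a_{11}+a_{12}y$, $$\mathbf r_A'=\mathbf r+\sigma\mathbf n-\tfrac12\ln(z_A')\,\mathbf n_A',\qquad \mathbf n_A'=\frac{(p^2z-a_{12}^2)\,\mathbf n+2a_{12}p\,\mathbf n_x}{p^2z+a_{12}^2},$$ $$\mathbf r_A^*=\mathbf r+\rho\mathbf n-\big(\tfrac12\ln(z_A^* )-1\big)\,\mathbf n_A^*,\qquad \mathbf n_A^*=\frac{(q^2-a_{12}^2z)\,\mathbf n+2a_{12}q\,z\,\mathbf n_y}{q^2+a_{12}^2z}.$$ *)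

(* Defs.v *)
(* Stdlib reals and Coquelicot.  Functions of (x, y) are uncurried, f : R * R -> R,
   and Euclidean 3-space is R * R * R with Coquelicot's module operations. *)
From Stdlib Require Export Reals.
From Coquelicot Require Export Coquelicot.
Open Scope R_scope.

(** * Calculus on open subsets of the plane *)

Definition is_pdx (f : R * R -> R) (p : R * R) (l : R) : Prop :=
  is_derive (fun t : R => f (t, snd p)) (fst p) l.

Definition is_pdy (f : R * R -> R) (p : R * R) (l : R) : Prop :=
  is_derive (fun t : R => f (fst p, t)) (snd p) l.

(* [Derive] is total: these are meaningful only where the derivative exists. *)
Definition pdx (f : R * R -> R) (p : R * R) : R :=
  Derive (fun t : R => f (t, snd p)) (fst p).

Definition pdy (f : R * R -> R) (p : R * R) : R :=
  Derive (fun t : R => f (fst p, t)) (snd p).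

Fixpoint Cn_on (k : nat) (D : R * R -> Prop) (f : R * R -> R) : Prop :=
  (forall p, D p -> continuous f p) /\
  match k with
  | O => True
  | S m =>
      (forall p, D p ->
         ex_derive (fun t : R => f (t, snd p)) (fst p) /\
         ex_derive (fun t : R => f (fst p, t)) (snd p)) /\
      Cn_on m D (pdx f) /\ Cn_on m D (pdy f)
  end.

Definition smooth_on (D : R * R -> Prop) (f : R * R -> R) : Prop :=
  forall k, Cn_on k D f.

Definition smooth2_on (D : R * R -> Prop) (f : R * R -> R * R) : Prop :=
  smooth_on D (fun p => fst (f p)) /\ smooth_on D (fun p => snd (f p)).

Definition smooth3_on (D : R * R -> Prop) (f : R * R -> R * R * R) : Prop :=
  smooth_on D (fun p => fst (fst (f p))) /\
  smooth_on D (fun p => snd (fst (f p))) /\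
  smooth_on D (fun p => snd (f p)).

(* [phi] is a diffeomorphism from [V] onto [W] with inverse [psi]. *)
Definition diffeo (V W : R * R -> Prop) (phi psi : R * R -> R * R) : Prop :=
  smooth2_on V phi /\ smooth2_on W psi /\
  (forall p, V p -> W (phi p) /\ psi (phi p) = p) /\
  (forall q, W q -> V (psi q) /\ phi (psi q) = q).

(* Paths and homotopies are maps on all of R and R * R of which only the
   restriction to [0,1] and [0,1]^2 matters. *)
Definition path_connected (U : R * R -> Prop) : Prop :=
  forall p q, U p -> U q ->
  exists g : R -> R * R,
    (forall t, continuous g t) /\ g 0 = p /\ g 1 = q /\
    (forall t, 0 <= t <= 1 -> U (g t)).

Definition simply_connected (U : R * R -> Prop) : Prop :=
  path_connected U /\
  forall g : R -> R * R,
    (forall t, continuous g t) -> g 0 = g 1 ->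
    (forall t, 0 <= t <= 1 -> U (g t)) ->
    exists H : R * R -> R * R,
      (forall st, continuous H st) /\
      (forall t, 0 <= t <= 1 -> H (0, t) = g t /\ H (1, t) = g 0) /\
      (forall s, 0 <= s <= 1 -> H (s, 0) = g 0 /\ H (s, 1) = g 0) /\
      (forall s t, 0 <= s <= 1 -> 0 <= t <= 1 -> U (H (s, t))).

(** * The constant astigmatism equation, its potentials, and the maps X_A, Y_A *)

Definition ca_solution (D : R * R -> Prop) (z : R * R -> R) : Prop :=
  smooth_on D z /\
  (forall p, D p -> 0 < z p) /\
  (forall p, D p -> pdy (pdy z) p + pdx (pdx (fun q => 1 / z q)) p + 2 = 0).

Definition potentials (D : R * R -> Prop) (z chi eta xi : R * R -> R) : Prop :=
  forall x y, D (x, y) ->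
  let z0 := z (x, y) in
  let zx := pdx z (x, y) in
  let zy := pdy z (x, y) in
  is_pdx chi (x, y) (zy + y) /\
  is_pdy chi (x, y) (zx / z0 ^ 2 - x) /\
  is_pdx eta (x, y) (x * zy) /\
  is_pdy eta (x, y) (x * (zx / z0 ^ 2) + 1 / z0 - x ^ 2) /\
  is_pdx xi (x, y) (- y * zy + z0 - y ^ 2) /\
  is_pdy xi (x, y) (- y * (zx / z0 ^ 2)).

Record mat2 := Mat2 { a11 : R; a12 : R; a21 : R; a22 : R }.

Definition det2 (A : mat2) : R := a11 A * a22 A - a12 A * a21 A.

Definition is_sign (e : R) : Prop := e = 1 \/ e = -1.

Definition p_of (A : mat2) (x : R) : R := a11 A + a12 A * x.

Definition q_of (A : mat2) (y : R) : R := a11 A + a12 A * y.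

(* Components of X_A and Y_A along the graph of z; [e] is the free sign. *)
Definition X_x (A : mat2) (z : R * R -> R) (w : R * R) : R :=
  let x := fst w in
  (p_of A x * (a21 A + a22 A * x) * z w + a12 A * a22 A)
  / (p_of A x ^ 2 * z w + a12 A ^ 2).

Definition X_y (A : mat2) (e : R) (chi eta : R * R -> R) (w : R * R) : R :=
  let x := fst w in let y := snd w in
  e * (a12 A ^ 2 * eta w + a11 A * a12 A * chi w - a11 A * y * p_of A x).

Definition X_z (A : mat2) (z : R * R -> R) (w : R * R) : R :=
  (p_of A (fst w) ^ 2 * z w + a12 A ^ 2) ^ 2 / z w.

Definition Y_x (A : mat2) (e : R) (chi xi : R * R -> R) (w : R * R) : R :=
  let x := fst w in let y := snd w in
  e * (a12 A ^ 2 * xi w - a11 A * a12 A * chi w - a11 A * x * q_of A y).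

Definition Y_y (A : mat2) (z : R * R -> R) (w : R * R) : R :=
  let y := snd w in
  (q_of A y * (a21 A + a22 A * y) + a12 A * a22 A * z w)
  / (q_of A y ^ 2 + a12 A ^ 2 * z w).

Definition Y_z (A : mat2) (z : R * R -> R) (w : R * R) : R :=
  z w / (q_of A (snd w) ^ 2 + a12 A ^ 2 * z w) ^ 2.

(** * Parametrized surfaces in Euclidean 3-space *)

Definition dot (u v : R * R * R) : R :=
  fst (fst u) * fst (fst v) + snd (fst u) * snd (fst v) + snd u * snd v.

Definition vdx (f : R * R -> R * R * R) (p : R * R) : R * R * R :=
  (pdx (fun q => fst (fst (f q))) p,
   pdx (fun q => snd (fst (f q))) p,
   pdx (fun q => snd (f q)) p).

Definition vdy (f : R * R -> R * R * R) (p : R * R) : R * R * R :=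
  (pdy (fun q => fst (fst (f q))) p,
   pdy (fun q => snd (fst (f q))) p,
   pdy (fun q => snd (f q)) p).

(* The differential of [f] at [p] applied to the parameter vector [v]. *)
Definition dmap (f : R * R -> R * R * R) (p v : R * R) : R * R * R :=
  plus (scal (fst v) (vdx f p)) (scal (snd v) (vdy f p)).

Definition immersion_at (f : R * R -> R * R * R) (p : R * R) : Prop :=
  forall v : R * R, dmap f p v = zero -> v = (0, 0).

Definition unit_normal_on (D : R * R -> Prop) (r n : R * R -> R * R * R) : Prop :=
  forall p, D p ->
    dot (n p) (n p) = 1 /\ dot (n p) (vdx r p) = 0 /\ dot (n p) (vdy r p) = 0.

Definition first_form (r : R * R -> R * R * R) (p v : R * R) : R :=
  dot (dmap r p v) (dmap r p v).

Definition second_form (r n : R * R -> R * R * R) (p v : R * R) : R :=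
  - dot (dmap r p v) (dmap n p v).

(* Eigenvalue of the shape operator, the endomorphism S of the tangent plane
   with S (dr v) = - dn v. *)
Definition principal_curvature (r n : R * R -> R * R * R) (p : R * R) (k : R) : Prop :=
  exists v : R * R, v <> (0, 0) /\ opp (dmap n p v) = scal k (dmap r p v).

Definition principal_radius (r n : R * R -> R * R * R) (p : R * R) (s : R) : Prop :=
  s <> 0 /\ principal_curvature r n p (1 / s).

(* A regular surface with unit normal [n] and principal radii [rho], [sigma]
   whose difference is the constant 1 or the constant -1.  Being
   distinct, [rho] and [sigma] exhaust the principal radii at each point. *)
Definition ca_surface (D : R * R -> Prop) (r n : R * R -> R * R * R)
    (rho sigma : R * R -> R) : Prop :=
  open D /\ smooth3_on D r /\ smooth3_on D n /\
  (forall p, D p -> immersion_at r p) /\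
  unit_normal_on D r n /\
  (forall p, D p ->
     principal_radius r n p (rho p) /\ principal_radius r n p (sigma p)) /\
  (exists c, is_sign c /\ forall p, D p -> sigma p - rho p = c).

(* The locus of principal centres of curvature for the principal radius [s]. *)
Definition sheet (r n : R * R -> R * R * R) (s : R * R -> R) (p : R * R) : R * R * R :=
  plus (r p) (scal (s p) (n p)).

(* Near [p], resp. [q], the parametrized surfaces [f] and [g] are the same
   unparametrized and unoriented surface. *)
Definition same_surface_near (f : R * R -> R * R * R) (p : R * R)
    (g : R * R -> R * R * R) (q : R * R) : Prop :=
  exists (V W : R * R -> Prop) (phi psi : R * R -> R * R),
    open V /\ V p /\ open W /\ W q /\
    diffeo V W phi psi /\ phi p = q /\
    forall w, V w -> f w = g (phi w).

(** * Surfaces attached to a solution *)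

Definition rho_of (z : R * R -> R) (p : R * R) : R := 1 / 2 * ln (z p) - 1.

Definition sigma_of (z : R * R -> R) (p : R * R) : R := 1 / 2 * ln (z p).

Definition u_of (z : R * R -> R) (p : R * R) : R :=
  1 / 2 * (ln (z p) - 2) * sqrt (z p).

Definition v_of (z : R * R -> R) (p : R * R) : R := ln (z p) / (2 * sqrt (z p)).

(* Where z = 1 or z = e^2 one of the radii vanishes and [r] is singular, while
   [r] and [n] remain smooth; [D] may contain such points. *)
Definition corresponds (D : R * R -> Prop) (z : R * R -> R)
    (r n : R * R -> R * R * R) : Prop :=
  smooth3_on D r /\ smooth3_on D n /\ unit_normal_on D r n /\
  forall p, D p -> z p <> 1 -> z p <> exp 2 ->
    (forall dx dy,
       first_form r p (dx, dy) = u_of z p ^ 2 * dx ^ 2 + v_of z p ^ 2 * dy ^ 2) /\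
    (forall dx dy,
       second_form r n p (dx, dy) =
         u_of z p ^ 2 / rho_of z p * dx ^ 2 + v_of z p ^ 2 / sigma_of z p * dy ^ 2) /\
    vdx n p = opp (scal (1 / rho_of z p) (vdx r p)) /\
    vdy n p = opp (scal (1 / sigma_of z p) (vdy r p)).

Definition n_X (A : mat2) (z : R * R -> R) (n : R * R -> R * R * R)
    (w : R * R) : R * R * R :=
  let p := p_of A (fst w) in
  scal (1 / (p ^ 2 * z w + a12 A ^ 2))
    (plus (scal (p ^ 2 * z w - a12 A ^ 2) (n w)) (scal (2 * a12 A * p) (vdx n w))).

Definition r_X (A : mat2) (z : R * R -> R) (r n : R * R -> R * R * R)
    (w : R * R) : R * R * R :=
  minus (sheet r n (sigma_of z) w) (scal (1 / 2 * ln (X_z A z w)) (n_X A z n w)).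

Definition n_Y (A : mat2) (z : R * R -> R) (n : R * R -> R * R * R)
    (w : R * R) : R * R * R :=
  let q := q_of A (snd w) in
  scal (1 / (q ^ 2 + a12 A ^ 2 * z w))
    (plus (scal (q ^ 2 - a12 A ^ 2 * z w) (n w)) (scal (2 * a12 A * q * z w) (vdy n w))).

Definition r_Y (A : mat2) (z : R * R -> R) (r n : R * R -> R * R * R)
    (w : R * R) : R * R * R :=
  minus (sheet r n (rho_of z) w) (scal (1 / 2 * ln (Y_z A z w) - 1) (n_Y A z n w)).

(* Main.v *)
Require Import Defs.
From Stdlib Require Import Lra Psatz Classical FunctionalExtensionality.

(** By the symmetry (x, y, z, n) -> (y, x, 1/z, -n) it suffices to treat X_A.
    Put p = a11 + a12 x and D = p^2 z + a12^2.  The equation says that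
    z_y dx + (z_x / z^2) dy has exterior derivative 2 dx dy; the same form for
    z'_A pulls back under X_A to - e det A ((p^2 z - a12^2) (z_y dx + z_x / z^2 dy)
    + 4 a12 p dy) / D, whose differential is computed directly.

    The sheet F = r + sigma n is pseudospherical, with first fundamental form
    g = d sigma^2 + z dx^2 where z = exp (2 sigma).  Any other surface with this
    sheet is F - S N with N a unit tangent field of the sheet, grad S = N and
    Hess S = g - dS^2; so f = exp S solves the linear equation Hess f = f g, and
    |grad f| = f.  Its positive solutions are
    f = ((a11 + a12 x)^2 z + a12^2) / sqrt z, that is, S is half the logarithm
    of z'_A. *)

(** In the coordinate w = x + i / sqrt z the metric d sigma^2 + z dx^2 is the half-plane metric
    |dw|^2 / (Im w)^2, and (x'_A, z'_A) is the image of w under w -> (a21 + a22 w) / (a11 + a12 w),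
    followed by conjugation when det A = -1. The function f belonging to A is |a11 + a12 w|^2 / Im
    w, the reciprocal of the new height. The solutions of Hess f = f g form a three-dimensional
    space with an invariant quadratic form. The condition |grad f| = f selects its light cone, and
    the half with f > 0 consists of the squares of the pairs (a11, a12), taken up to sign. This is
    why the surface attached to A depends on the first row alone. Two obstacles shape the rest.
    Where z is 1 or e^2, [corresponds] gives no fundamental forms, so their consequences have to be
    carried there by density. And the symmetry does not respect the normalization of rho and sigma:
    it has to be combined with a parallel surface at unit distance, which costs a factor sqrt e in
    the first row of A. *)

Set Bullet Behavior "Strict Subproofs".

(** * Total derivatives *)

(** Partial derivatives alone obey no chain rule, so the calculus runs on Fréchet derivatives.
    Recording the two coefficients as numbers reduces each comparison of derivatives to [field] or
    [ring]. *)
Definition is_diff (f : R * R -> R) (p : R * R) (a b : R) : Prop :=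
  filterdiff f (locally p) (fun v : R * R => fst v * a + snd v * b).

Lemma is_diff_eq f p a b a' b' :
  is_diff f p a b -> a = a' -> b = b' -> is_diff f p a' b'.
Proof. now intros H <- <-. Qed.

Lemma is_diff_ext_loc f g p a b :
  locally p (fun q => f q = g q) -> is_diff f p a b -> is_diff g p a b.
Proof. intros E H. now apply (filterdiff_ext_locally f g). Qed.

Lemma is_diff_continuous f p a b : is_diff f p a b -> continuous f p.
Proof.
intros H. apply (filterdiff_continuous f p). now exists (fun v => fst v * a + snd v * b).
Qed.

Lemma is_diff_const c p : is_diff (fun _ => c) p 0 0.
Proof.
eapply filterdiff_ext_lin; [apply filterdiff_const|].
intros y; unfold zero; simpl; ring.
Qed.

Lemma is_diff_fst p : is_diff (fun q => fst q) p 1 0.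
Proof.
eapply filterdiff_ext_lin; [apply filterdiff_linear, is_linear_fst|].
intros y; simpl; ring.
Qed.

Lemma is_diff_snd p : is_diff (fun q => snd q) p 0 1.
Proof.
eapply filterdiff_ext_lin; [apply filterdiff_linear, is_linear_snd|].
intros y; simpl; ring.
Qed.

Lemma is_diff_plus f g p a b a' b' :
  is_diff f p a b -> is_diff g p a' b' ->
  is_diff (fun q => f q + g q) p (a + a') (b + b').
Proof.
intros H H'.
eapply filterdiff_ext_lin; [apply (filterdiff_plus_fct f g _ _ H H')|].
intros y; unfold plus; simpl; ring.
Qed.

Lemma is_diff_mult f g p a b a' b' :
  is_diff f p a b -> is_diff g p a' b' ->
  is_diff (fun q => f q * g q) p (a * g p + f p * a') (b * g p + f p * b').
Proof.
intros H H'.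
eapply filterdiff_ext_lin;
  [apply (@filterdiff_mult_fct R_AbsRing _ f g p _ _ Rmult_comm H H')|].
intros y; unfold plus, mult; simpl; ring.
Qed.

Lemma is_diff_comp1 (h : R -> R) f p l a b :
  is_derive h (f p) l -> is_diff f p a b ->
  is_diff (fun q => h (f q)) p (l * a) (l * b).
Proof.
intros Hh H.
eapply filterdiff_ext_lin; [apply (filterdiff_comp' f h p _ _ H Hh)|].
intros y; unfold scal; simpl; unfold mult; simpl; ring.
Qed.

Lemma is_diff_comp2 (h f g : R * R -> R) p ha hb fa fb ga gb :
  is_diff h (f p, g p) ha hb -> is_diff f p fa fb -> is_diff g p ga gb ->
  is_diff (fun q => h (f q, g q)) p (ha * fa + hb * ga) (ha * fb + hb * gb).
Proof.
intros Hh Hf Hg.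
eapply filterdiff_ext_lin.
- apply (filterdiff_comp'_2 f g (fun u v => h (u, v)) p _ _ (fun u v => u * ha + v * hb) Hf Hg).
  apply (filterdiff_ext h); [|exact Hh].
  now intros [u v].
- intros y; simpl; ring.
Qed.

Lemma is_diff_opp f p a b : is_diff f p a b -> is_diff (fun q => - f q) p (- a) (- b).
Proof.
intros H.
refine (is_diff_eq _ _ _ _ _ _ (is_diff_comp1 Ropp f p (-1) a b _ H) _ _); try ring.
auto_derive; auto; ring.
Qed.

Lemma is_diff_minus f g p a b a' b' :
  is_diff f p a b -> is_diff g p a' b' ->
  is_diff (fun q => f q - g q) p (a - a') (b - b').
Proof. intros H H'. apply is_diff_plus; [assumption|now apply is_diff_opp]. Qed.

Lemma is_diff_inv f p a b :
  f p <> 0 -> is_diff f p a b ->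
  is_diff (fun q => / f q) p (- a / f p ^ 2) (- b / f p ^ 2).
Proof.
intros H0 H.
refine (is_diff_eq _ _ _ _ _ _ (is_diff_comp1 Rinv f p (- / f p ^ 2) a b _ H) _ _);
  try (field; assumption).
auto_derive; auto; field; assumption.
Qed.

Lemma is_diff_div f g p a b a' b' :
  g p <> 0 -> is_diff f p a b -> is_diff g p a' b' ->
  is_diff (fun q => f q / g q) p ((a * g p - f p * a') / g p ^ 2) ((b * g p - f p * b') / g p ^ 2).
Proof.
intros H0 H H'.
refine (is_diff_eq _ _ _ _ _ _ (is_diff_mult _ _ _ _ _ _ _ H (is_diff_inv _ _ _ _ H0 H')) _ _);
  now field.
Qed.

Lemma is_diff_ln f p a b :
  0 < f p -> is_diff f p a b -> is_diff (fun q => ln (f q)) p (a / f p) (b / f p).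
Proof.
intros H0 H.
refine (is_diff_eq _ _ _ _ _ _ (is_diff_comp1 ln f p (/ f p) a b _ H) _ _);
  try (field; lra).
now apply is_derive_ln.
Qed.

Lemma is_diff_exp f p a b :
  is_diff f p a b -> is_diff (fun q => exp (f q)) p (exp (f p) * a) (exp (f p) * b).
Proof.
intros H. apply (is_diff_comp1 exp); [|assumption]. apply is_derive_exp.
Qed.

Lemma is_diff_sqrt f p a b :
  0 < f p -> is_diff f p a b ->
  is_diff (fun q => sqrt (f q)) p (a / (2 * sqrt (f p))) (b / (2 * sqrt (f p))).
Proof.
intros H0 H.
assert (sqrt (f p) <> 0) by (apply Rgt_not_eq, sqrt_lt_R0; lra).
refine (is_diff_eq _ _ _ _ _ _ (is_diff_comp1 sqrt f p (/ (2 * sqrt (f p))) a b _ H) _ _);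
  try (now field).
auto_derive; auto. now field.
Qed.

Lemma is_diff_pd f p a b : is_diff f p a b -> is_pdx f p a /\ is_pdy f p b.
Proof.
destruct p as [x y]. intros H.
assert (H' : differentiable_pt_lim (fun u v => f (u, v)) x y a b).
{ apply filterdiff_differentiable_pt_lim. apply (filterdiff_ext f); [now intros [u v]|exact H]. }
split; apply is_derive_Reals; simpl.
- replace a with (a * 1 + b * 0) by ring.
  apply (derivable_pt_lim_comp_2d (fun u v => f (u, v)) (fun t => t) (fun _ => y) x);
    [exact H'|apply derivable_pt_lim_id|apply derivable_pt_lim_const].
- replace b with (a * 0 + b * 1) by ring.
  apply (derivable_pt_lim_comp_2d (fun u v => f (u, v)) (fun _ => x) (fun t => t) y);
    [exact H'|apply derivable_pt_lim_const|apply derivable_pt_lim_id].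
Qed.

Lemma is_pdx_unique f p l : is_pdx f p l -> pdx f p = l.
Proof. apply is_derive_unique. Qed.

Lemma is_pdy_unique f p l : is_pdy f p l -> pdy f p = l.
Proof. apply is_derive_unique. Qed.

Lemma is_diff_pdE f p a b : is_diff f p a b -> pdx f p = a /\ pdy f p = b.
Proof.
intros H. apply is_diff_pd in H as [Ha Hb].
split; [now apply is_pdx_unique|now apply is_pdy_unique].
Qed.

Lemma is_diff_unique f p a b a' b' : is_diff f p a b -> is_diff f p a' b' -> a = a' /\ b = b'.
Proof.
intros H H'. apply is_diff_pdE in H as [<- <-]. now apply is_diff_pdE in H' as [<- <-].
Qed.

(** * Smooth functions *)

Lemma locally_in (D P : R * R -> Prop) p :
  open D -> D p -> (forall q, D q -> P q) -> locally p P.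
Proof. intros OD Hp H. now apply (locally_open D P). Qed.

Lemma locally_line (P : R * R -> Prop) p :
  locally p P ->
  locally (fst p) (fun t => P (t, snd p)) /\ locally (snd p) (fun t => P (fst p, t)).
Proof.
intros [d Hd]. destruct p as [x y]. split; exists d; intros t Ht; apply Hd; split; simpl;
  try exact Ht; apply ball_center.
Qed.

Lemma pd_ext_loc f g p :
  locally p (fun q => f q = g q) -> pdx f p = pdx g p /\ pdy f p = pdy g p.
Proof.
intros H. apply locally_line in H as [H1 H2].
split; now apply Derive_ext_loc.
Qed.

Lemma Cn_on_cont k D f p : Cn_on k D f -> D p -> continuous f p.
Proof. destruct k; intros [H _]; apply H. Qed.

Lemma Cn_on_ext k D f g :
  open D -> (forall p, D p -> f p = g p) -> Cn_on k D f -> Cn_on k D g.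
Proof.
intros OD. revert f g. induction k as [|k IH]; intros f g E [Hc H].
- split; [|exact I]. intros p Hp. apply (continuous_ext_loc _ f); [|now apply Hc].
  apply (locally_in D); auto.
- assert (L : forall p, D p -> locally p (fun q => f q = g q))
    by (intros; now apply (locally_in D)).
  destruct H as (H1 & H2 & H3). split; [|split; [|split]].
  + intros p Hp. apply (continuous_ext_loc _ f); [|now apply Hc].
    apply (locally_in D); auto.
  + intros p Hp. destruct (locally_line _ _ (L p Hp)) as [L1 L2], (H1 p Hp) as [E1 E2].
    split; [exact (ex_derive_ext_loc _ _ _ L1 E1)|exact (ex_derive_ext_loc _ _ _ L2 E2)].
  + apply (IH (pdx f)); [|assumption]. intros p Hp. now apply pd_ext_loc, L.
  + apply (IH (pdy f)); [|assumption]. intros p Hp. now apply pd_ext_loc, L.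
Qed.

Lemma Cn_on_mono k (D D' : R * R -> Prop) f :
  (forall p, D' p -> D p) -> Cn_on k D f -> Cn_on k D' f.
Proof.
intros S. revert f. induction k as [|k IH]; intros f [Hc H].
- split; [|exact I]. auto.
- destruct H as (H1 & H2 & H3). split; [auto|repeat split]; auto; now apply H1, S.
Qed.

Lemma Cn_on_le k D f : Cn_on (S k) D f -> Cn_on k D f.
Proof.
revert f. induction k as [|k IH]; intros f [Hc (H1 & H2 & H3)].
- now split.
- split; [assumption|split; [assumption|split; now apply IH]].
Qed.

(** A function with continuous partial derivatives is differentiable. The criterion applied asks for
    the x-derivative near the point, its continuity there, and the y-derivative at the point
    itself. *)
Lemma Cn_on_is_diff k D f p :
  open D -> Cn_on (S k) D f -> D p -> is_diff f p (pdx f p) (pdy f p).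
Proof.
intros OD [_ (H1 & H2 & _)] Hp. destruct p as [x y].
assert (F := is_derive_filterdiff (fun u v => f (u, v)) x y (fun u v => pdx f (u, v)) (pdy f (x, y))).
eapply filterdiff_ext_lin.
- eapply (filterdiff_ext (fun u => f (fst u, snd u))); [now intros [u v]|apply F].
  + apply (locally_in D); auto. intros q Hq. apply Derive_correct. now apply (H1 q).
  + apply Derive_correct. now apply (H1 (x, y)).
  + apply (continuous_ext (pdx f)); [now intros [u v]|]. now apply (Cn_on_cont k D).
- intros v. reflexivity.
Qed.

(** The induction step behind the closure properties below: exhibit a gradient, then show that its
    two expressions are smooth to one order less. *)
Lemma Cn_on_intro k D f fx fy :
  open D -> (forall p, D p -> is_diff f p (fx p) (fy p)) ->
  Cn_on k D fx -> Cn_on k D fy -> Cn_on (S k) D f.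
Proof.
intros OD H Hx Hy. split; [|split; [|split]].
- intros p Hp. now apply (is_diff_continuous f p (fx p) (fy p)), H.
- intros p Hp. destruct (is_diff_pd _ _ _ _ (H p Hp)) as [A B].
  split; eexists; [exact A|exact B].
- apply (Cn_on_ext k D fx); auto. intros p Hp. symmetry. now apply (is_diff_pdE f p _ (fy p)), H.
- apply (Cn_on_ext k D fy); auto. intros p Hp. symmetry. now apply (is_diff_pdE f p (fx p)), H.
Qed.

Lemma smooth_on_is_diff D f p :
  open D -> smooth_on D f -> D p -> is_diff f p (pdx f p) (pdy f p).
Proof. intros OD H. now apply (Cn_on_is_diff 0 D). Qed.

Lemma smooth_on_pdx D f : smooth_on D f -> smooth_on D (pdx f).
Proof. intros H k. now destruct (H (S k)) as [_ (_ & H1 & _)]. Qed.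

Lemma smooth_on_pdy D f : smooth_on D f -> smooth_on D (pdy f).
Proof. intros H k. now destruct (H (S k)) as [_ (_ & _ & H1)]. Qed.

Lemma smooth_on_cont D f p : smooth_on D f -> D p -> continuous f p.
Proof. intros H. exact (Cn_on_cont 0 D f p (H 0%nat)). Qed.

Lemma smooth_on_ext D f g :
  open D -> (forall p, D p -> f p = g p) -> smooth_on D f -> smooth_on D g.
Proof. intros OD E H k. now apply (Cn_on_ext k D f). Qed.

Lemma smooth_on_mono (D D' : R * R -> Prop) f :
  (forall p, D' p -> D p) -> smooth_on D f -> smooth_on D' f.
Proof. intros E H k. now apply (Cn_on_mono k D). Qed.

Lemma Cn_on_const k D c : open D -> Cn_on k D (fun _ => c).
Proof.
intros OD. revert c. induction k as [|k IH]; intros c.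
- split; [|exact I]. intros p _. apply continuous_const.
- apply (Cn_on_intro k D _ (fun _ => 0) (fun _ => 0)); auto.
  intros p _. apply is_diff_const.
Qed.

Lemma smooth_on_const D c : open D -> smooth_on D (fun _ => c).
Proof. intros OD k. now apply Cn_on_const. Qed.

Lemma smooth_on_fst D : open D -> smooth_on D (fun p => fst p).
Proof.
intros OD [|k].
- split; [|exact I]. intros p _. apply (is_diff_continuous _ _ 1 0), is_diff_fst.
- apply (Cn_on_intro k D _ (fun _ => 1) (fun _ => 0)); try apply Cn_on_const; auto.
  intros p _. apply is_diff_fst.
Qed.

Lemma smooth_on_snd D : open D -> smooth_on D (fun p => snd p).
Proof.
intros OD [|k].
- split; [|exact I]. intros p _. apply (is_diff_continuous _ _ 0 1), is_diff_snd.
- apply (Cn_on_intro k D _ (fun _ => 0) (fun _ => 1)); try apply Cn_on_const; auto.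
  intros p _. apply is_diff_snd.
Qed.

Lemma Cn_on_plus k D f g :
  open D -> Cn_on k D f -> Cn_on k D g -> Cn_on k D (fun p => f p + g p).
Proof.
intros OD. revert f g. induction k as [|k IH]; intros f g Hf Hg.
- split; [|exact I]. intros p Hp. apply (continuous_plus f g); [now apply Hf|now apply Hg].
- apply (Cn_on_intro k D _ (fun p => pdx f p + pdx g p) (fun p => pdy f p + pdy g p)); auto.
  + intros p Hp. apply is_diff_plus; now apply (Cn_on_is_diff k D).
  + apply IH; [apply Hf|apply Hg].
  + apply IH; [apply Hf|apply Hg].
Qed.

Lemma smooth_on_plus D f g :
  open D -> smooth_on D f -> smooth_on D g -> smooth_on D (fun p => f p + g p).
Proof. intros OD Hf Hg k. now apply Cn_on_plus. Qed.

Lemma Cn_on_mult k D f g :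
  open D -> Cn_on k D f -> Cn_on k D g -> Cn_on k D (fun p => f p * g p).
Proof.
intros OD. revert f g. induction k as [|k IH]; intros f g Hf Hg.
- split; [|exact I]. intros p Hp. apply (continuous_mult f g); [now apply Hf|now apply Hg].
- assert (Lf := Cn_on_le _ _ _ Hf). assert (Lg := Cn_on_le _ _ _ Hg).
  apply (Cn_on_intro k D _ (fun p => pdx f p * g p + f p * pdx g p)
                           (fun p => pdy f p * g p + f p * pdy g p)); auto.
  + intros p Hp. apply is_diff_mult; now apply (Cn_on_is_diff k D).
  + apply Cn_on_plus; auto; apply IH; auto; [apply Hf|apply Hg].
  + apply Cn_on_plus; auto; apply IH; auto; [apply Hf|apply Hg].
Qed.

Lemma smooth_on_mult D f g :
  open D -> smooth_on D f -> smooth_on D g -> smooth_on D (fun p => f p * g p).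
Proof. intros OD Hf Hg k. now apply Cn_on_mult. Qed.

Lemma smooth_on_opp D f : open D -> smooth_on D f -> smooth_on D (fun p => - f p).
Proof.
intros OD H. apply (smooth_on_ext D (fun p => (-1) * f p)); auto.
- intros; ring.
- apply smooth_on_mult; auto. now apply smooth_on_const.
Qed.

Lemma smooth_on_minus D f g :
  open D -> smooth_on D f -> smooth_on D g -> smooth_on D (fun p => f p - g p).
Proof. intros OD Hf Hg. apply smooth_on_plus; auto. now apply smooth_on_opp. Qed.

Lemma Cn_on_opp k D f : open D -> Cn_on k D f -> Cn_on k D (fun p => - f p).
Proof.
intros OD H. apply (Cn_on_ext k D (fun p => (-1) * f p)); auto.
- intros; ring.
- apply Cn_on_mult; auto. now apply Cn_on_const.
Qed.

Lemma smooth_on_inv D f :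
  open D -> (forall p, D p -> f p <> 0) -> smooth_on D f -> smooth_on D (fun p => / f p).
Proof.
intros OD N Hf k. induction k as [|k IH].
- split; [|exact I]. intros p Hp. apply (continuous_comp f Rinv); [now apply (smooth_on_cont D)|].
  now apply continuous_Rinv, N.
(* The gradient is written with [/ f] as a factor, so that the induction hypothesis covers it. *)
- apply (Cn_on_intro k D _ (fun p => - pdx f p * (/ f p * / f p)) (fun p => - pdy f p * (/ f p * / f p))); auto.
  + intros p Hp.
    refine (is_diff_eq _ _ _ _ _ _ (is_diff_inv f p _ _ (N p Hp) (smooth_on_is_diff D f p OD Hf Hp)) _ _);
      field; auto.
  + apply Cn_on_mult; [auto| |now apply Cn_on_mult]. apply Cn_on_opp; auto. now apply smooth_on_pdx.
  + apply Cn_on_mult; [auto| |now apply Cn_on_mult]. apply Cn_on_opp; auto. now apply smooth_on_pdy.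
Qed.

Lemma smooth_on_div D f g :
  open D -> (forall p, D p -> g p <> 0) -> smooth_on D f -> smooth_on D g ->
  smooth_on D (fun p => f p / g p).
Proof. intros OD N Hf Hg. apply smooth_on_mult; auto. now apply smooth_on_inv. Qed.

Lemma smooth_on_pow D f n : open D -> smooth_on D f -> smooth_on D (fun p => f p ^ n).
Proof.
intros OD H. induction n as [|n IH]; simpl; [now apply smooth_on_const|now apply smooth_on_mult].
Qed.

Lemma smooth_on_ln D f :
  open D -> (forall p, D p -> 0 < f p) -> smooth_on D f -> smooth_on D (fun p => ln (f p)).
Proof.
intros OD N Hf [|k].
- split; [|exact I]. intros p Hp. apply (continuous_comp f ln).
  + now apply (smooth_on_cont D).
  + now apply continuous_ln, N.
- assert (N' : forall p, D p -> f p <> 0) by (intros p Hp; specialize (N p Hp); lra).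
  apply (Cn_on_intro k D _ (fun p => pdx f p / f p) (fun p => pdy f p / f p)); auto.
  + intros p Hp. apply is_diff_ln; auto. now apply (smooth_on_is_diff D).
  + apply smooth_on_div; auto. now apply smooth_on_pdx.
  + apply smooth_on_div; auto. now apply smooth_on_pdy.
Qed.

Lemma smooth_on_comp (D E : R * R -> Prop) f (g : R * R -> R * R) :
  open D -> open E -> (forall p, D p -> E (g p)) ->
  smooth_on E f -> smooth2_on D g -> smooth_on D (fun p => f (g p)).
Proof.
(* The induction varies [f], because the gradient of the composite contains the partial derivatives
   of [f] composed with the same [g]. *)
intros OD OE DE Hf [H1 H2] k. revert f Hf. induction k as [|k IH]; intros f Hf.
- split; [|exact I]. intros p Hp.
  apply (continuous_ext (fun q => f (fst (g q), snd (g q)))); [intros q; now destruct (g q)|].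
  apply (continuous_comp_2 (fun q => fst (g q)) (fun q => snd (g q)) (fun u v => f (u, v)));
    [now apply (smooth_on_cont D)|now apply (smooth_on_cont D)|].
  apply (continuous_ext f); [now intros [u v]|].
  rewrite <- surjective_pairing. apply (smooth_on_cont E); auto.
- apply (Cn_on_intro k D _
    (fun p => pdx f (g p) * pdx (fun q => fst (g q)) p + pdy f (g p) * pdx (fun q => snd (g q)) p)
    (fun p => pdx f (g p) * pdy (fun q => fst (g q)) p + pdy f (g p) * pdy (fun q => snd (g q)) p)); auto.
  + intros p Hp.
    apply (is_diff_ext_loc (fun q => f (fst (g q), snd (g q)))).
    { apply filter_forall. intros q. now destruct (g q). }
    apply is_diff_comp2; try now apply (smooth_on_is_diff D).
    rewrite <- surjective_pairing. apply (smooth_on_is_diff E); auto.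
  + apply Cn_on_plus; auto; apply Cn_on_mult; auto;
      try (apply IH; now (apply smooth_on_pdx || apply smooth_on_pdy)); now apply smooth_on_pdx.
  + apply Cn_on_plus; auto; apply Cn_on_mult; auto;
      try (apply IH; now (apply smooth_on_pdx || apply smooth_on_pdy)); now apply smooth_on_pdy.
Qed.

Lemma is_diff_comp_map (E : R * R -> Prop) f (g : R * R -> R * R) p ga gb ha hb :
  open E -> E (g p) -> smooth_on E f ->
  is_diff (fun q => fst (g q)) p ga gb -> is_diff (fun q => snd (g q)) p ha hb ->
  is_diff (fun q => f (g q)) p
    (pdx f (g p) * ga + pdy f (g p) * ha) (pdx f (g p) * gb + pdy f (g p) * hb).
Proof.
intros OE Hp Hf Hg Hh.
apply (is_diff_ext_loc (fun q => f (fst (g q), snd (g q)))).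
{ apply filter_forall. intros q. now destruct (g q). }
apply is_diff_comp2; auto.
rewrite <- surjective_pairing. apply (smooth_on_is_diff E); auto.
Qed.

Lemma smooth_on_Schwarz D f p :
  open D -> smooth_on D f -> D p -> pdx (pdy f) p = pdy (pdx f) p.
Proof.
intros OD Hf Hp. destruct p as [x y].
assert (Hx := smooth_on_pdx _ _ Hf). assert (Hy := smooth_on_pdy _ _ Hf).
apply (Schwarz (fun u v => f (u, v)) x y).
- apply locally_2d_locally. apply (locally_in D); auto.
  intros [u v] Hq. simpl.
  destruct (Hf 1%nat) as [_ [E _]]. destruct (Hx 1%nat) as [_ [Ex _]].
  destruct (Hy 1%nat) as [_ [Ey _]].
  repeat split; [apply (E (u, v) Hq)|apply (E (u, v) Hq)|apply (Ey (u, v) Hq)|apply (Ex (u, v) Hq)].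
- apply continuity_2d_pt_filterlim.
  apply (continuous_ext (pdx (pdy f))); [now intros [u v]|].
  apply (smooth_on_cont D); auto. now apply smooth_on_pdx.
- apply continuity_2d_pt_filterlim.
  apply (continuous_ext (pdy (pdx f))); [now intros [u v]|].
  apply (smooth_on_cont D); auto. now apply smooth_on_pdy.
Qed.

(** * Vector-valued maps *)

Local Notation vec := (R * R * R)%type.

Lemma vec_eq (u v : vec) :
  fst (fst u) = fst (fst v) -> snd (fst u) = snd (fst v) -> snd u = snd v -> u = v.
Proof. destruct u as [[? ?] ?], v as [[? ?] ?]; simpl. now intros -> -> ->. Qed.

Ltac vec_ring :=
  repeat match goal with u : (R * R * R)%type |- _ => destruct u as [[? ?] ?] end;
  try apply vec_eq;
  repeat (unfold dot, minus, plus, scal, opp, zero, mult; simpl); ring.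

Lemma dot_sym u v : dot u v = dot v u.
Proof. vec_ring. Qed.

Lemma dot_plus_l u v w : dot (plus u v) w = dot u w + dot v w.
Proof. vec_ring. Qed.

Lemma dot_plus_r u v w : dot u (plus v w) = dot u v + dot u w.
Proof. vec_ring. Qed.

Lemma dot_scal_l (a : R) u v : dot (scal a u) v = a * dot u v.
Proof. vec_ring. Qed.

Lemma dot_scal_r (a : R) u v : dot u (scal a v) = a * dot u v.
Proof. vec_ring. Qed.

Lemma dot_opp_l u v : dot (opp u) v = - dot u v.
Proof. vec_ring. Qed.

Lemma dot_opp_r u v : dot u (opp v) = - dot u v.
Proof. vec_ring. Qed.

Lemma dot_minus_l u v w : dot (minus u v) w = dot u w - dot v w.
Proof. vec_ring. Qed.

Lemma dot_minus_r u v w : dot u (minus v w) = dot u v - dot u w.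
Proof. vec_ring. Qed.

Lemma dot_zero_l u : dot zero u = 0.
Proof. vec_ring. Qed.

Lemma dot_zero_r u : dot u zero = 0.
Proof. vec_ring. Qed.

Hint Rewrite dot_plus_l dot_plus_r dot_scal_l dot_scal_r dot_opp_l dot_opp_r
  dot_minus_l dot_minus_r dot_zero_l dot_zero_r : dot.

Lemma dot_self_eq0 (u : vec) : dot u u = 0 -> u = zero.
Proof.
destruct u as [[a b] c]. unfold dot; simpl. intros H.
assert (a = 0) by (apply Rsqr_0_uniq; unfold Rsqr; nra).
assert (b = 0) by (apply Rsqr_0_uniq; unfold Rsqr; nra).
assert (c = 0) by (apply Rsqr_0_uniq; unfold Rsqr; nra).
now subst.
Qed.

Definition det3 (u v w : vec) : R :=
  fst (fst u) * (snd (fst v) * snd w - snd v * snd (fst w))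
  - snd (fst u) * (fst (fst v) * snd w - snd v * fst (fst w))
  + snd u * (fst (fst v) * snd (fst w) - snd (fst v) * fst (fst w)).

Lemma det3_gram u v w :
  det3 u v w ^ 2 =
    dot u u * (dot v v * dot w w - dot v w ^ 2)
    - dot u v * (dot u v * dot w w - dot v w * dot u w)
    + dot u w * (dot u v * dot v w - dot v v * dot u w).
Proof. unfold det3. vec_ring. Qed.

(** Cramer's rule: the determinant times a component of [q] is a combination of the three scalar
    products, with cofactors as coefficients. *)
Lemma det3_orth (u v w q : vec) :
  det3 u v w <> 0 -> dot q u = 0 -> dot q v = 0 -> dot q w = 0 -> q = zero.
Proof.
destruct u as [[u1 u2] u3], v as [[v1 v2] v3], w as [[w1 w2] w3], q as [[q1 q2] q3].
unfold det3, dot; simpl. intros N U V W.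
apply vec_eq; unfold zero; simpl; (eapply Rmult_eq_reg_l; [|exact N]); unfold zero; simpl; rewrite Rmult_0_r.
- transitivity ((q1 * u1 + q2 * u2 + q3 * u3) * (v2 * w3 - v3 * w2)
    + (q1 * v1 + q2 * v2 + q3 * v3) * (w2 * u3 - w3 * u2)
    + (q1 * w1 + q2 * w2 + q3 * w3) * (u2 * v3 - u3 * v2)); [ring|rewrite U, V, W; ring].
- transitivity ((q1 * u1 + q2 * u2 + q3 * u3) * (v3 * w1 - v1 * w3)
    + (q1 * v1 + q2 * v2 + q3 * v3) * (w3 * u1 - w1 * u3)
    + (q1 * w1 + q2 * w2 + q3 * w3) * (u3 * v1 - u1 * v3)); [ring|rewrite U, V, W; ring].
- transitivity ((q1 * u1 + q2 * u2 + q3 * u3) * (v1 * w2 - v2 * w1)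
    + (q1 * v1 + q2 * v2 + q3 * v3) * (w1 * u2 - w2 * u1)
    + (q1 * w1 + q2 * w2 + q3 * w3) * (u1 * v2 - u2 * v1)); [ring|rewrite U, V, W; ring].
Qed.

(** Supplies principal directions: dr + s dn has rank at most one at a principal radius s, and a
    kernel vector is a principal direction. *)
Lemma rank_one_kernel (P Q E : vec) (a b : R) :
  P = scal a E -> Q = scal b E ->
  exists v : R * R, v <> (0, 0) /\ plus (scal (fst v) P) (scal (snd v) Q) = zero.
Proof.
intros -> ->.
destruct (Req_dec a 0) as [Ha|Ha].
- rewrite Ha. exists (1, 0). split; [intros H; injection H; lra|]. simpl. vec_ring.
- exists (b, - a). split; [intros H; injection H; lra|]. simpl. vec_ring.
Qed.

Definition is_diff3 (f : R * R -> vec) (p : R * R) (a b : vec) : Prop :=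
  is_diff (fun q => fst (fst (f q))) p (fst (fst a)) (fst (fst b)) /\
  is_diff (fun q => snd (fst (f q))) p (snd (fst a)) (snd (fst b)) /\
  is_diff (fun q => snd (f q)) p (snd a) (snd b).

Lemma is_diff3_ext_loc f g p a b :
  locally p (fun q => f q = g q) -> is_diff3 f p a b -> is_diff3 g p a b.
Proof.
intros E (H1 & H2 & H3).
split; [apply (is_diff_ext_loc (fun q => fst (fst (f q))))|split;
  [apply (is_diff_ext_loc (fun q => snd (fst (f q))))|apply (is_diff_ext_loc (fun q => snd (f q)))]];
  auto;
  revert E; apply filter_imp; intros q Hq; simpl; now rewrite Hq.
Qed.

Lemma is_diff3_eq f p a b a' b' : is_diff3 f p a b -> a = a' -> b = b' -> is_diff3 f p a' b'.
Proof. now intros H <- <-. Qed.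

Lemma smooth3_on_is_diff3 D f p :
  open D -> smooth3_on D f -> D p -> is_diff3 f p (vdx f p) (vdy f p).
Proof. intros OD (H1 & H2 & H3) Hp. (split; [|split]); now apply (smooth_on_is_diff D). Qed.

Lemma is_diff3_vd f p a b : is_diff3 f p a b -> vdx f p = a /\ vdy f p = b.
Proof.
intros (H1 & H2 & H3). apply is_diff_pdE in H1 as [? ?], H2 as [? ?], H3 as [? ?].
split; apply vec_eq; assumption.
Qed.

Lemma is_diff3_plus f g p a b a' b' :
  is_diff3 f p a b -> is_diff3 g p a' b' ->
  is_diff3 (fun q => plus (f q) (g q)) p (plus a a') (plus b b').
Proof. intros (H1 & H2 & H3) (H1' & H2' & H3'). (split; [|split]); now apply is_diff_plus. Qed.

Lemma is_diff3_minus f g p a b a' b' :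
  is_diff3 f p a b -> is_diff3 g p a' b' ->
  is_diff3 (fun q => minus (f q) (g q)) p (minus a a') (minus b b').
Proof. intros (H1 & H2 & H3) (H1' & H2' & H3'). (split; [|split]); now apply is_diff_minus. Qed.

Lemma is_diff3_scal (s : R * R -> R) f p sx sy a b :
  is_diff s p sx sy -> is_diff3 f p a b ->
  is_diff3 (fun q => scal (s q) (f q)) p
    (plus (scal sx (f p)) (scal (s p) a)) (plus (scal sy (f p)) (scal (s p) b)).
Proof.
intros Hs (H1 & H2 & H3).
split; [exact (is_diff_mult _ _ _ _ _ _ _ Hs H1)|split];
  [exact (is_diff_mult _ _ _ _ _ _ _ Hs H2)|exact (is_diff_mult _ _ _ _ _ _ _ Hs H3)].
Qed.

Lemma is_diff_dot f g p a b a' b' :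
  is_diff3 f p a b -> is_diff3 g p a' b' ->
  is_diff (fun q => dot (f q) (g q)) p
    (dot a (g p) + dot (f p) a') (dot b (g p) + dot (f p) b').
Proof.
intros (H1 & H2 & H3) (H1' & H2' & H3').
eapply is_diff_eq;
  [exact (is_diff_plus _ _ _ _ _ _ _
    (is_diff_plus _ _ _ _ _ _ _ (is_diff_mult _ _ _ _ _ _ _ H1 H1') (is_diff_mult _ _ _ _ _ _ _ H2 H2'))
    (is_diff_mult _ _ _ _ _ _ _ H3 H3'))| |]; unfold dot; ring.
Qed.

Lemma smooth3_on_ext D f g :
  open D -> (forall p, D p -> f p = g p) -> smooth3_on D f -> smooth3_on D g.
Proof.
intros OD E (H1 & H2 & H3).
split; [apply (smooth_on_ext D (fun p => fst (fst (f p))))|split;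
  [apply (smooth_on_ext D (fun p => snd (fst (f p))))|apply (smooth_on_ext D (fun p => snd (f p)))]];
  auto; intros p Hp; now rewrite E.
Qed.

Lemma smooth3_on_mono (D D' : R * R -> Prop) f :
  (forall p, D' p -> D p) -> smooth3_on D f -> smooth3_on D' f.
Proof. intros E (H1 & H2 & H3). (split; [|split]); now apply (smooth_on_mono D). Qed.

Lemma smooth3_on_plus D f g :
  open D -> smooth3_on D f -> smooth3_on D g -> smooth3_on D (fun p => plus (f p) (g p)).
Proof. intros OD (H1 & H2 & H3) (H1' & H2' & H3'). (split; [|split]); now apply smooth_on_plus. Qed.

Lemma smooth3_on_opp D f :
  open D -> smooth3_on D f -> smooth3_on D (fun p => opp (f p)).
Proof. intros OD (H1 & H2 & H3). (split; [|split]); now apply smooth_on_opp. Qed.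

Lemma smooth3_on_minus D f g :
  open D -> smooth3_on D f -> smooth3_on D g -> smooth3_on D (fun p => minus (f p) (g p)).
Proof. intros OD (H1 & H2 & H3) (H1' & H2' & H3'). (split; [|split]); now apply smooth_on_minus. Qed.

Lemma smooth3_on_scal D s f :
  open D -> smooth_on D s -> smooth3_on D f -> smooth3_on D (fun p => scal (s p) (f p)).
Proof.
intros OD Hs (H1 & H2 & H3).
split; [exact (smooth_on_mult _ _ _ OD Hs H1)|split];
  [exact (smooth_on_mult _ _ _ OD Hs H2)|exact (smooth_on_mult _ _ _ OD Hs H3)].
Qed.

Lemma smooth_on_dot D f g :
  open D -> smooth3_on D f -> smooth3_on D g -> smooth_on D (fun p => dot (f p) (g p)).
Proof.
intros OD (H1 & H2 & H3) (H1' & H2' & H3').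
repeat apply smooth_on_plus; try apply smooth_on_mult; auto.
Qed.

Lemma smooth3_on_vdx D f : smooth3_on D f -> smooth3_on D (vdx f).
Proof. intros (H1 & H2 & H3). (split; [|split]); now apply smooth_on_pdx. Qed.

Lemma smooth3_on_vdy D f : smooth3_on D f -> smooth3_on D (vdy f).
Proof. intros (H1 & H2 & H3). (split; [|split]); now apply smooth_on_pdy. Qed.

Lemma smooth3_on_Schwarz D f p :
  open D -> smooth3_on D f -> D p -> vdx (vdy f) p = vdy (vdx f) p.
Proof. intros OD (H1 & H2 & H3) Hp. apply vec_eq; now apply (smooth_on_Schwarz D). Qed.

Lemma smooth3_on_comp (D E : R * R -> Prop) f (g : R * R -> R * R) :
  open D -> open E -> (forall p, D p -> E (g p)) ->
  smooth3_on E f -> smooth2_on D g -> smooth3_on D (fun p => f (g p)).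
Proof.
intros OD OE DE (H1 & H2 & H3) Hg.
split; [|split].
- now apply (smooth_on_comp D E (fun q => fst (fst (f q)))).
- now apply (smooth_on_comp D E (fun q => snd (fst (f q)))).
- now apply (smooth_on_comp D E (fun q => snd (f q))).
Qed.

Lemma is_diff3_comp_map (E : R * R -> Prop) f (g : R * R -> R * R) p ga gb ha hb :
  open E -> E (g p) -> smooth3_on E f ->
  is_diff (fun q => fst (g q)) p ga gb -> is_diff (fun q => snd (g q)) p ha hb ->
  is_diff3 (fun q => f (g q)) p (dmap f (g p) (ga, ha)) (dmap f (g p) (gb, hb)).
Proof.
intros OE Hp (H1 & H2 & H3) Hg Hh.
split; [|split].
- refine (is_diff_eq _ _ _ _ _ _ (is_diff_comp_map E _ g p _ _ _ _ OE Hp H1 Hg Hh) _ _);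
    apply (f_equal2 Rplus); apply Rmult_comm.
- refine (is_diff_eq _ _ _ _ _ _ (is_diff_comp_map E _ g p _ _ _ _ OE Hp H2 Hg Hh) _ _);
    apply (f_equal2 Rplus); apply Rmult_comm.
- refine (is_diff_eq _ _ _ _ _ _ (is_diff_comp_map E _ g p _ _ _ _ OE Hp H3 Hg Hh) _ _);
    apply (f_equal2 Rplus); apply Rmult_comm.
Qed.

Lemma dmap_ext_loc f g p v :
  locally p (fun q => f q = g q) -> dmap f p v = dmap g p v.
Proof.
intros L. unfold dmap.
assert (vdx f p = vdx g p /\ vdy f p = vdy g p) as [-> ->]; [|reflexivity].
split; apply vec_eq; simpl; apply pd_ext_loc;
  revert L; apply filter_imp; intros q Hq; simpl; now rewrite Hq.
Qed.

Lemma immersion_at_ext_loc f g p :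
  locally p (fun q => f q = g q) -> immersion_at f p -> immersion_at g p.
Proof. intros L H v Hv. apply H. rewrite <- Hv. now apply dmap_ext_loc. Qed.

(** * The transformation X_A *)

Lemma is_pdx_inv_pdx D z p :
  open D -> smooth_on D z -> (forall q, D q -> 0 < z q) -> D p ->
  pdx (fun q => 1 / z q) p = - (pdx z p / z p ^ 2).
Proof.
intros OD Sz Pz Hp. assert (0 < z p) by auto.
apply (is_diff_pdE _ p _ (- (pdy z p / z p ^ 2))).
apply (is_diff_eq _ _ ((0 * z p - 1 * pdx z p) / z p ^ 2) ((0 * z p - 1 * pdy z p) / z p ^ 2));
  try (field; lra).
apply (is_diff_div (fun _ => 1) z); [lra|apply is_diff_const|now apply (smooth_on_is_diff D)].
Qed.

Lemma pdx_pdx_inv D z p :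
  open D -> smooth_on D z -> (forall q, D q -> 0 < z q) -> D p ->
  pdx (pdx (fun q => 1 / z q)) p = - pdx (fun q => pdx z q / z q ^ 2) p.
Proof.
intros OD Sz Pz Hp. symmetry.
assert (S : smooth_on D (fun q => pdx z q / z q ^ 2)).
{ apply smooth_on_div; auto; [|now apply smooth_on_pdx|now apply smooth_on_pow].
  intros q Hq. specialize (Pz q Hq). apply pow_nonzero. lra. }
destruct (is_diff_pdE _ _ _ _ (is_diff_opp _ _ _ _ (smooth_on_is_diff D _ p OD S Hp))) as [<- _].
apply pd_ext_loc, (locally_in D); auto.
intros q Hq. symmetry. now apply (is_pdx_inv_pdx D).
Qed.

(** The form in which the equation enters computations: z_yy is eliminated and the remaining
    derivatives of z up to order two are treated as independent variables. *)
Lemma ca_solution_yy D z p :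
  open D -> ca_solution D z -> D p ->
  pdy (pdy z) p = pdx (pdx z) p / z p ^ 2 - 2 * pdx z p ^ 2 / z p ^ 3 - 2.
Proof.
intros OD (Sz & Pz & Ez) Hp. assert (H := Ez p Hp). assert (0 < z p) by auto.
rewrite (pdx_pdx_inv D) in H; auto.
assert (E : is_diff (fun q => pdx z q / z q ^ 2) p
   ((pdx (pdx z) p * z p - 2 * pdx z p ^ 2) / z p ^ 3)
   ((pdy (pdx z) p * z p - 2 * pdx z p * pdy z p) / z p ^ 3)).
{ assert (Dz := smooth_on_is_diff D z p OD Sz Hp).
  assert (Dx := smooth_on_is_diff D _ p OD (smooth_on_pdx _ _ Sz) Hp).
  refine (is_diff_eq _ _ _ _ _ _ (is_diff_div _ (fun q => z q * (z q * 1)) p _ _ _ _ _ Dx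
    (is_diff_mult _ _ _ _ _ _ _ Dz (is_diff_mult _ _ _ _ _ _ _ Dz (is_diff_const 1 p)))) _ _);
    try (field; lra).
  apply (pow_nonzero _ 2); lra. }
apply is_diff_pdE in E as [E _]. rewrite E in H.
apply (Rplus_eq_reg_r (- ((pdx (pdx z) p * z p - 2 * pdx z p ^ 2) / z p ^ 3) + 2)).
transitivity 0; [lra|field; lra].
Qed.

(** Equals z |a11 + a12 (x + i / sqrt z)|^2, the squared denominator of the Möbius map up to the
    factor z. *)
Definition X_den (A : mat2) (z : R * R -> R) (w : R * R) : R :=
  p_of A (fst w) ^ 2 * z w + a12 A ^ 2.

Lemma pow2_pos (r : R) : r <> 0 -> 0 < r ^ 2.
Proof. intros H. rewrite <- Rsqr_pow2. now apply Rsqr_pos_lt. Qed.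

(** Both summands could vanish only for a12 = a11 = 0, which a nonzero determinant excludes. *)
Lemma X_den_pos A z w : det2 A <> 0 -> 0 < z w -> 0 < X_den A z w.
Proof.
unfold det2, X_den, p_of. intros N Hz.
destruct (Req_dec (a12 A) 0) as [E|E].
- rewrite E in *. assert (a11 A <> 0) by (intros E'; apply N; rewrite E'; ring).
  replace (a11 A + 0 * fst w) with (a11 A) by ring.
  apply Rplus_lt_le_0_compat; [|apply pow2_ge_0].
  apply Rmult_lt_0_compat; [now apply pow2_pos|assumption].
- apply Rplus_le_lt_0_compat; [|now apply pow2_pos].
  apply Rmult_le_pos; [apply pow2_ge_0|lra].
Qed.

Lemma is_sign_neq0 d : is_sign d -> d <> 0.
Proof. intros [-> | ->]; lra. Qed.

Lemma is_diff_p_of A w : is_diff (fun q => p_of A (fst q)) w (a12 A) 0.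
Proof.
refine (is_diff_eq _ _ _ _ _ _ (is_diff_plus _ _ _ _ _ _ _ (is_diff_const (a11 A) w)
  (is_diff_mult _ _ _ _ _ _ _ (is_diff_const (a12 A) w) (is_diff_fst w))) _ _); ring.
Qed.

Lemma is_diff_sqr f p a b : is_diff f p a b -> is_diff (fun q => f q ^ 2) p (2 * f p * a) (2 * f p * b).
Proof.
intros H.
refine (is_diff_eq _ _ _ _ _ _ (is_diff_mult _ _ _ _ _ _ _ H
  (is_diff_mult _ _ _ _ _ _ _ H (is_diff_const 1 p))) _ _); ring.
Qed.

Lemma is_diff_X_den A z w zx zy :
  is_diff z w zx zy ->
  is_diff (X_den A z) w
    (2 * a12 A * p_of A (fst w) * z w + p_of A (fst w) ^ 2 * zx) (p_of A (fst w) ^ 2 * zy).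
Proof.
intros H.
refine (is_diff_eq _ _ _ _ _ _ (is_diff_plus _ _ _ _ _ _ _
  (is_diff_mult _ _ _ _ _ _ _ (is_diff_sqr _ _ _ _ (is_diff_p_of A w)) H)
  (is_diff_const (a12 A ^ 2) w)) _ _); ring.
Qed.

Lemma is_diff_X_z A z w zx zy :
  0 < z w -> is_diff z w zx zy ->
  is_diff (X_z A z) w
    (X_den A z w * (4 * a12 A * p_of A (fst w)
       + (p_of A (fst w) ^ 2 * z w - a12 A ^ 2) * zx / z w ^ 2))
    (X_den A z w * (p_of A (fst w) ^ 2 * z w - a12 A ^ 2) * zy / z w ^ 2).
Proof.
intros Hz H.
refine (is_diff_eq _ _ _ _ _ _ (is_diff_div _ _ _ _ _ _ _ _
  (is_diff_sqr _ _ _ _ (is_diff_X_den A z w zx zy H)) H) _ _);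
  [lra| |]; unfold X_den; field; lra.
Qed.

(** As for any Möbius map, the second row survives in the derivative only through the
    determinant. *)
Lemma is_diff_X_x A z w zx zy :
  det2 A <> 0 -> 0 < z w -> is_diff z w zx zy ->
  let p := p_of A (fst w) in
  is_diff (X_x A z) w
    (det2 A * (z w * (p ^ 2 * z w - a12 A ^ 2) - a12 A * p * zx) / X_den A z w ^ 2)
    (- det2 A * a12 A * p * zy / X_den A z w ^ 2).
Proof.
intros N Hz H p. assert (HD := X_den_pos A z w N Hz).
assert (Hs : is_diff (fun q => a21 A + a22 A * fst q) w (a22 A) 0).
{ refine (is_diff_eq _ _ _ _ _ _ (is_diff_plus _ _ _ _ _ _ _ (is_diff_const (a21 A) w)
  (is_diff_mult _ _ _ _ _ _ _ (is_diff_const (a22 A) w) (is_diff_fst w))) _ _); ring. }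
refine (is_diff_eq _ _ _ _ _ _ (is_diff_div _ _ _ _ _ _ _ _
  (is_diff_plus _ _ _ _ _ _ _
    (is_diff_mult _ _ _ _ _ _ _ (is_diff_mult _ _ _ _ _ _ _ (is_diff_p_of A w) Hs) H)
    (is_diff_const (a12 A * a22 A) w))
  (is_diff_X_den A z w zx zy H)) _ _); [lra| |];
  unfold p, X_den, p_of, det2 in *; field; lra.
Qed.

(** The potentials are given by their partial derivatives only, hence one-variable calculus. The
    term - a11 y p cancels the summand y of chi_x, and in the y-direction it completes the square
    p^2. *)
Lemma pd_X_y D z chi eta xi A e w :
  potentials D z chi eta xi -> D w -> z w <> 0 ->
  let p := p_of A (fst w) in
  pdx (X_y A e chi eta) w = e * a12 A * p * pdy z w /\
  pdy (X_y A e chi eta) w = e * (a12 A * p * pdx z w / z w ^ 2 + a12 A ^ 2 / z w - p ^ 2).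
Proof.
intros pot Hw Hz. destruct w as [x y].
destruct (pot x y Hw) as (cx & cy & ex & ey & _ & _). simpl. unfold is_pdx, is_pdy in *. simpl in *.
split; apply is_derive_unique; unfold X_y, p_of; simpl.
- set (c := fun t => chi (t, y)) in *. set (h := fun t => eta (t, y)) in *.
  apply (is_derive_ext (fun t => e * (a12 A * (a12 A * 1) * h t + a11 A * a12 A * c t
    - a11 A * y * (a11 A + a12 A * t)))); [reflexivity|].
  auto_derive; [repeat split; eexists; eassumption|].
  assert (Dh : Derive (fun t : R => h t) x = _) by exact (is_derive_unique _ _ _ ex).
  assert (Dc : Derive (fun t : R => c t) x = _) by exact (is_derive_unique _ _ _ cx).
  rewrite Dh, Dc. ring.
- set (c := fun t => chi (x, t)) in *. set (h := fun t => eta (x, t)) in *.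
  apply (is_derive_ext (fun t => e * (a12 A * (a12 A * 1) * h t + a11 A * a12 A * c t
    - a11 A * t * (a11 A + a12 A * x)))); [reflexivity|].
  auto_derive; [repeat split; eexists; eassumption|].
  assert (Dh : Derive (fun t : R => h t) y = _) by exact (is_derive_unique _ _ _ ey).
  assert (Dc : Derive (fun t : R => c t) y = _) by exact (is_derive_unique _ _ _ cy).
  rewrite Dh, Dc.
  field. assumption.
Qed.

(** Differentiating [psi (phi q) = q] gives inverse Jacobian matrices, so their determinants
    multiply to 1. *)
Lemma diffeo_jacobian V W phi psi p :
  open V -> open W -> diffeo V W phi psi -> V p ->
  pdx (fun q => fst (phi q)) p * pdy (fun q => snd (phi q)) p
  - pdy (fun q => fst (phi q)) p * pdx (fun q => snd (phi q)) p <> 0.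
Proof.
intros OV OW ((S1 & S2) & (T1 & T2) & HV & HW) Hp.
destruct (HV p Hp) as [Wp _].
assert (D1 := smooth_on_is_diff V _ p OV S1 Hp).
assert (D2 := smooth_on_is_diff V _ p OV S2 Hp).
assert (C1 := is_diff_comp_map W _ phi p _ _ _ _ OW Wp T1 D1 D2).
assert (C2 := is_diff_comp_map W _ phi p _ _ _ _ OW Wp T2 D1 D2).
assert (E1 : is_diff (fun q => fst (psi (phi q))) p 1 0).
{ apply (is_diff_ext_loc (fun q => fst q)); [|apply is_diff_fst].
  apply (locally_in V); auto. intros q Hq. now destruct (HV q Hq) as [_ ->]. }
assert (E2 : is_diff (fun q => snd (psi (phi q))) p 0 1).
{ apply (is_diff_ext_loc (fun q => snd q)); [|apply is_diff_snd].
  apply (locally_in V); auto. intros q Hq. now destruct (HV q Hq) as [_ ->]. }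
destruct (is_diff_unique _ _ _ _ _ _ C1 E1) as [F1 F2].
destruct (is_diff_unique _ _ _ _ _ _ C2 E2) as [F3 F4].
set (a := pdx (fun q => fst (phi q)) p) in *. set (b := pdy (fun q => fst (phi q)) p) in *.
set (c := pdx (fun q => snd (phi q)) p) in *. set (d := pdy (fun q => snd (phi q)) p) in *.
set (a' := pdx (fun q => fst (psi q)) (phi p)) in *.
set (b' := pdy (fun q => fst (psi q)) (phi p)) in *.
set (c' := pdx (fun q => snd (psi q)) (phi p)) in *.
set (d' := pdy (fun q => snd (psi q)) (phi p)) in *.
intros J.
assert (K : (a' * d' - b' * c') * (a * d - b * c) = 1).
{ transitivity ((a' * a + b' * c) * (c' * b + d' * d) - (a' * b + b' * d) * (c' * a + d' * c));
    [ring|]. rewrite F1, F2, F3, F4. ring. }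
rewrite J in K. lra.
Qed.

(* Pull back the one-form P dx' + Q dy' by phi and take exterior derivatives. *)
Lemma pullback_curl V W (phi : R * R -> R * R) P Q al be p :
  open V -> open W -> smooth2_on V phi -> (forall q, V q -> W (phi q)) ->
  smooth_on W P -> smooth_on W Q -> V p ->
  (forall q, V q ->
     P (phi q) * pdx (fun q => fst (phi q)) q + Q (phi q) * pdx (fun q => snd (phi q)) q = al q /\
     P (phi q) * pdy (fun q => fst (phi q)) q + Q (phi q) * pdy (fun q => snd (phi q)) q = be q) ->
  pdx be p - pdy al p =
    (pdx Q (phi p) - pdy P (phi p)) *
    (pdx (fun q => fst (phi q)) p * pdy (fun q => snd (phi q)) p
     - pdy (fun q => fst (phi q)) p * pdx (fun q => snd (phi q)) p).
Proof.
intros OV OW (S1 & S2) HV SP SQ Hp E.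
assert (D1 := smooth_on_is_diff V _ p OV S1 Hp).
assert (D2 := smooth_on_is_diff V _ p OV S2 Hp).
assert (DP := is_diff_comp_map W _ phi p _ _ _ _ OW (HV p Hp) SP D1 D2).
assert (DQ := is_diff_comp_map W _ phi p _ _ _ _ OW (HV p Hp) SQ D1 D2).
assert (D11 := smooth_on_is_diff V _ p OV (smooth_on_pdx _ _ S1) Hp).
assert (D12 := smooth_on_is_diff V _ p OV (smooth_on_pdy _ _ S1) Hp).
assert (D21 := smooth_on_is_diff V _ p OV (smooth_on_pdx _ _ S2) Hp).
assert (D22 := smooth_on_is_diff V _ p OV (smooth_on_pdy _ _ S2) Hp).
rewrite (smooth_on_Schwarz V _ p OV S1 Hp) in D12.
rewrite (smooth_on_Schwarz V _ p OV S2 Hp) in D22.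
assert (Da := is_diff_plus _ _ _ _ _ _ _ (is_diff_mult _ _ _ _ _ _ _ DP D11)
                (is_diff_mult _ _ _ _ _ _ _ DQ D21)).
assert (Db := is_diff_plus _ _ _ _ _ _ _ (is_diff_mult _ _ _ _ _ _ _ DP D12)
                (is_diff_mult _ _ _ _ _ _ _ DQ D22)).
apply (is_diff_ext_loc _ al) in Da; [|apply (locally_in V); auto; intros q Hq; now apply E].
apply (is_diff_ext_loc _ be) in Db; [|apply (locally_in V); auto; intros q Hq; now apply E].
destruct (is_diff_pdE _ _ _ _ Da) as [_ ->]. destruct (is_diff_pdE _ _ _ _ Db) as [-> _].
ring.
Qed.

Lemma smooth_on_p_of D A : open D -> smooth_on D (fun w => p_of A (fst w)).
Proof.
intros OD. apply smooth_on_plus; auto; [now apply smooth_on_const|].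
apply smooth_on_mult; auto; [now apply smooth_on_const|now apply smooth_on_fst].
Qed.

Lemma smooth_on_X_den D A z : open D -> smooth_on D z -> smooth_on D (X_den A z).
Proof.
intros OD Sz. apply smooth_on_plus; auto; [|now apply smooth_on_const].
apply smooth_on_mult; auto. now apply smooth_on_pow, smooth_on_p_of.
Qed.

Lemma smooth_on_X_z D A z :
  open D -> smooth_on D z -> (forall p, D p -> 0 < z p) -> smooth_on D (X_z A z).
Proof.
intros OD Sz Pz. apply smooth_on_div; auto.
- intros p Hp. specialize (Pz p Hp). lra.
- now apply smooth_on_pow, smooth_on_X_den.
Qed.

Lemma X_z_pos A z w : det2 A <> 0 -> 0 < z w -> 0 < X_z A z w.
Proof.
intros N Hz. assert (H := X_den_pos A z w N Hz).
apply Rdiv_lt_0_compat; auto. now apply pow_lt.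
Qed.

(** * The constant astigmatism equation under X_A *)

Section XSolution.

Variables (U : R * R -> Prop) (z chi eta xi : R * R -> R).
Variables (A : mat2) (e : R) (V W : R * R -> Prop) (psi : R * R -> R * R).
Hypothesis OU : open U.
Hypothesis Zsol : ca_solution U z.
Hypothesis pot : potentials U z chi eta xi.
Hypothesis sA : is_sign (det2 A).
Hypothesis se : is_sign e.
Hypothesis OV : open V.
Hypothesis OW : open W.
Hypothesis VU : forall p, V p -> U p.

Let Phi (p : R * R) := (X_x A z p, X_y A e chi eta p).
Let Z (w : R * R) := X_z A z (psi w).

Hypothesis Dif : diffeo V W Phi psi.

Let num (w : R * R) := p_of A (fst w) ^ 2 * z w - a12 A ^ 2.
(** [al] dx + [be] dy is the pull-back of Z_y dx' + (Z_x / Z^2) dy', as [X_pullback] shows. *)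
Let al (w : R * R) := - (e * det2 A * (num w * pdy z w)) / X_den A z w.
Let be (w : R * R) :=
  - (e * det2 A * (num w * (pdx z w / z w ^ 2) + 4 * a12 A * p_of A (fst w))) / X_den A z w.

Let N : det2 A <> 0 := is_sign_neq0 _ sA.
Let Sz : smooth_on U z := proj1 Zsol.
Let Pz : forall p, U p -> 0 < z p := proj1 (proj2 Zsol).

Lemma X_image_smooth : smooth_on W Z.
Proof.
destruct Dif as (_ & Sp & _ & HW).
apply (smooth_on_comp W V (X_z A z)); auto; [intros q Hq; now apply HW|].
apply (smooth_on_mono U); auto. now apply smooth_on_X_z.
Qed.

Lemma X_image_pos q : W q -> 0 < Z q.
Proof.
destruct Dif as (_ & _ & _ & HW). intros Hq. apply X_z_pos; auto. now apply Pz, VU, HW.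
Qed.

Lemma X_jacobian p :
  V p ->
  let P := p_of A (fst p) in let D := X_den A z p in
  pdx (fun q => fst (Phi q)) p
    = det2 A * (z p * (P ^ 2 * z p - a12 A ^ 2) - a12 A * P * pdx z p) / D ^ 2 /\
  pdy (fun q => fst (Phi q)) p = - det2 A * a12 A * P * pdy z p / D ^ 2 /\
  pdx (fun q => snd (Phi q)) p = e * a12 A * P * pdy z p /\
  pdy (fun q => snd (Phi q)) p = e * (a12 A * P * pdx z p / z p ^ 2 + a12 A ^ 2 / z p - P ^ 2).
Proof.
intros Hp P D. assert (Up := VU p Hp). assert (zp := Pz p Up).
destruct (is_diff_pdE _ _ _ _ (is_diff_X_x A z p _ _ N zp (smooth_on_is_diff U z p OU Sz Up)))
  as [E1 E2].
destruct (pd_X_y U z chi eta xi A e p pot Up) as [E3 E4]; [lra|].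
split; [exact E1|split; [exact E2|split; [exact E3|exact E4]]].
Qed.

(* The conjugate differential of Z is, up to sign, that of z multiplied by the
   conformal factor of X_A. *)
Lemma X_pullback p :
  V p ->
  pdy Z (Phi p) * pdx (fun q => fst (Phi q)) p
    + pdx Z (Phi p) / Z (Phi p) ^ 2 * pdx (fun q => snd (Phi q)) p = al p /\
  pdy Z (Phi p) * pdy (fun q => fst (Phi q)) p
    + pdx Z (Phi p) / Z (Phi p) ^ 2 * pdy (fun q => snd (Phi q)) p = be p.
Proof.
intros Hp. assert (Up := VU p Hp). assert (zp := Pz p Up).
assert (HD := X_den_pos A z p N zp).
assert (NJ := diffeo_jacobian V W Phi psi p OV OW Dif Hp).
assert (SZ := X_image_smooth).
destruct Dif as ((S1 & S2) & _ & HV & _). destruct (HV p Hp) as [Wp Ep].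
assert (C := is_diff_comp_map W Z Phi p _ _ _ _ OW Wp SZ
   (smooth_on_is_diff V _ p OV S1 Hp) (smooth_on_is_diff V _ p OV S2 Hp)).
apply (is_diff_ext_loc _ (X_z A z)) in C.
2: { apply (locally_in V); auto. intros q Hq. unfold Z. now destruct (HV q Hq) as [_ ->]. }
destruct (is_diff_unique _ _ _ _ _ _ C
  (is_diff_X_z A z p _ _ zp (smooth_on_is_diff U z p OU Sz Up))) as [F1 F2].
assert (EZ : Z (Phi p) = X_den A z p ^ 2 / z p) by (unfold Z; now rewrite Ep).
rewrite EZ. clear EZ C. destruct (X_jacobian p Hp) as (J1 & J2 & J3 & J4).
unfold al, be, num. clear al be num.
set (j1 := pdx (fun q => fst (Phi q)) p) in *. set (j2 := pdy (fun q => fst (Phi q)) p) in *.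
set (j3 := pdx (fun q => snd (Phi q)) p) in *. set (j4 := pdy (fun q => snd (Phi q)) p) in *.
set (P := p_of A (fst p)) in *.
set (Zx := pdx Z (Phi p)) in *. set (Zy := pdy Z (Phi p)) in *.
set (zx := pdx z p) in *. set (zy := pdy z p) in *.
set (hx := X_den A z p * (4 * a12 A * P + (P ^ 2 * z p - a12 A ^ 2) * zx / z p ^ 2)) in *.
set (hy := X_den A z p * (P ^ 2 * z p - a12 A ^ 2) * zy / z p ^ 2) in *.
assert (ED : X_den A z p = P ^ 2 * z p + a12 A ^ 2) by reflexivity.
assert (sA' := sA).
set (D := X_den A z p) in *. set (d := det2 A) in *. set (a := a12 A) in *. set (z0 := z p) in *.
assert (Eh : hx = D * (4 * a * P + (P ^ 2 * z0 - a ^ 2) * zx / z0 ^ 2)) by reflexivity.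
assert (Eh' : hy = D * (P ^ 2 * z0 - a ^ 2) * zy / z0 ^ 2) by reflexivity.
clearbody Zx Zy P zx zy D j1 j2 j3 j4 d a hx hy z0.
(* The chain rule is a linear system for the gradient of Z; it is solved by Cramer's rule. *)
assert (Gx : Zx = (hx * j4 - hy * j3) / (j1 * j4 - j2 * j3))
  by (rewrite <- F1, <- F2; field; exact NJ).
assert (Gy : Zy = (hy * j1 - hx * j2) / (j1 * j4 - j2 * j3))
  by (rewrite <- F1, <- F2; field; exact NJ).
rewrite Gx, Gy. clear Gx Gy F1 F2.
split.
(* The intermediate expression keeps [hx] and [hy] symbolic: the identity is linear in them once the
   Jacobian is cleared. *)
- transitivity (- (e * d) * (z0 ^ 2 / D ^ 2) * hy).
  + apply (Rmult_eq_reg_r (j1 * j4 - j2 * j3)); [|exact NJ].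
    transitivity ((hy * j1 - hx * j2) * j1 + (hx * j4 - hy * j3) / (D ^ 2 / z0) ^ 2 * j3);
      [field; repeat split; try exact NJ; lra|].
    rewrite J1, J2, J3, J4. clear Eh Eh' NJ J1 J2 J3 J4. rewrite ED in *.
    (* The identity rests on e^2 = 1 and (det A)^2 = 1, hence the case distinction on both signs. *)
    destruct sA' as [-> | ->], se as [-> | ->]; field; split; lra.
  + rewrite Eh', ED in *. field; split; lra.
- transitivity (- (e * d) / D ^ 2 * hx).
  + apply (Rmult_eq_reg_r (j1 * j4 - j2 * j3)); [|exact NJ].
    transitivity ((hy * j1 - hx * j2) * j2 + (hx * j4 - hy * j3) / (D ^ 2 / z0) ^ 2 * j4);
      [field; repeat split; try exact NJ; lra|].
    rewrite J1, J2, J3, J4. clear Eh Eh' NJ J1 J2 J3 J4. rewrite ED in *.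
    destruct sA' as [-> | ->], se as [-> | ->]; field; split; lra.
  + rewrite Eh, ED in *. field; split; lra.
Qed.

Lemma X_curl p :
  V p ->
  pdx be p - pdy al p =
    2 * (pdx (fun q => fst (Phi q)) p * pdy (fun q => snd (Phi q)) p
         - pdy (fun q => fst (Phi q)) p * pdx (fun q => snd (Phi q)) p).
Proof.
intros Vp. assert (Up := VU p Vp). assert (zp := Pz p Up). assert (HD := X_den_pos A z p N zp).
destruct (X_jacobian p Vp) as (-> & -> & -> & ->).
assert (Dz := smooth_on_is_diff U z p OU Sz Up).
assert (Dx := smooth_on_is_diff U _ p OU (smooth_on_pdx _ _ Sz) Up).
assert (Dy := smooth_on_is_diff U _ p OU (smooth_on_pdy _ _ Sz) Up).
(* The equation for z enters here. *)
rewrite (ca_solution_yy U z p OU Zsol Up) in Dy.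
assert (DD := is_diff_X_den A z p _ _ Dz).
assert (Dn := is_diff_minus _ _ _ _ _ _ _
   (is_diff_mult _ _ _ _ _ _ _ (is_diff_sqr _ _ _ _ (is_diff_p_of A p)) Dz)
   (is_diff_const (a12 A ^ 2) p)).
assert (Dal := is_diff_div _ _ _ _ _ _ _ (Rgt_not_eq _ _ HD)
  (is_diff_opp _ _ _ _ (is_diff_mult _ _ _ _ _ _ _ (is_diff_const (e * det2 A) p)
    (is_diff_mult _ _ _ _ _ _ _ Dn Dy))) DD).
assert (z2 : z p ^ 2 <> 0) by (apply pow_nonzero; lra).
assert (Dbe := is_diff_div _ _ _ _ _ _ _ (Rgt_not_eq _ _ HD)
  (is_diff_opp _ _ _ _ (is_diff_mult _ _ _ _ _ _ _ (is_diff_const (e * det2 A) p)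
    (is_diff_plus _ _ _ _ _ _ _
    (is_diff_mult _ _ _ _ _ _ _ Dn (is_diff_div _ _ _ _ _ _ _ z2 Dx (is_diff_sqr _ _ _ _ Dz)))
    (is_diff_mult _ _ _ _ _ _ _ (is_diff_const (4 * a12 A) p) (is_diff_p_of A p))))) DD).
apply is_diff_pdE in Dal as [_ Dal]. apply is_diff_pdE in Dbe as [Dbe _].
refine (eq_trans (f_equal2 Rminus Dbe Dal) _). clear Dal Dbe. unfold X_den in *.
set (P := p_of A (fst p)) in *.
set (zxx := pdx (pdx z) p). set (zx := pdx z p). set (zy := pdy z p).
set (zxy := pdx (pdy z) p). set (zyx := pdy (pdx z) p).
set (a := a12 A) in *. set (d := det2 A). set (z0 := z p) in *.
clearbody P zxx zx zy zxy zyx a d z0. field. split; lra.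
Qed.

(** The exterior derivative of the pulled-back form is known twice: as the curl for Z times the
    Jacobian, and as 2 times the Jacobian. Cancelling the Jacobian leaves the equation for Z. *)
Lemma X_solution : ca_solution W Z.
Proof.
assert (SZ := X_image_smooth). assert (PZ := X_image_pos).
split; [exact SZ|]. split; [exact PZ|].
intros q0 Hq0. rewrite (pdx_pdx_inv W); auto.
assert (SQ : smooth_on W (fun q => pdx Z q / Z q ^ 2)).
{ apply smooth_on_div; auto; [|now apply smooth_on_pdx|now apply smooth_on_pow].
  intros q Hq. specialize (PZ q Hq). apply pow_nonzero. lra. }
assert (HW := Dif). destruct HW as (SPhi & _ & HV & HW).
destruct (HW q0 Hq0) as [Vp Ep].
assert (C := pullback_curl V W Phi (pdy Z) (fun q => pdx Z q / Z q ^ 2) al be (psi q0) OV OW SPhi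
  (fun q Hq => proj1 (HV q Hq)) (smooth_on_pdy _ _ SZ) SQ Vp X_pullback).
assert (NJ := diffeo_jacobian V W Phi psi (psi q0) OV OW Dif Vp).
rewrite Ep in C. rewrite (X_curl _ Vp) in C.
apply Rmult_eq_reg_r in C; [|exact NJ]. lra.
Qed.

End XSolution.

(** * The Gauss map of a surface of constant astigmatism *)

(** For a constant z the equation would read 2 = 0. *)
Lemma ca_solution_not_locally_const U z p c :
  open U -> ca_solution U z -> U p -> ~ locally p (fun q => z q = c).
Proof.
intros OU Zsol Up L. assert (H := ca_solution_yy U z p OU Zsol Up).
assert (K : forall f k q, locally q (fun q' : R * R => f q' = k) -> pdx f q = 0 /\ pdy f q = 0).
{ intros f k q Lq. destruct (pd_ext_loc f (fun _ => k) q Lq) as [-> ->].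
  apply is_diff_pdE, is_diff_const. }
apply locally_locally in L.
assert (Lx : locally p (fun q => pdx z q = 0)) by (revert L; apply filter_imp; intros q Lq; now apply (K z c)).
assert (Ly : locally p (fun q => pdy z q = 0)) by (revert L; apply filter_imp; intros q Lq; now apply (K z c)).
destruct (K _ _ _ Lx) as [E1 _]. destruct (K _ _ _ Ly) as [_ E2].
rewrite E1, E2, (locally_singleton _ _ Lx) in H. lra.
Qed.

Lemma ca_solution_dense U z p P :
  open U -> ca_solution U z -> U p -> locally p P ->
  exists q, P q /\ U q /\ z q <> 1 /\ z q <> exp 2.
Proof.
intros OU Zsol Up LP. apply NNPP. intros F.
assert (LU : locally p U) by now apply OU.
assert (E : locally p (fun q => z q = 1 \/ z q = exp 2)).
{ generalize (filter_and _ _ LP LU). apply filter_imp. intros q [Pq Uq].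
  apply NNPP. intros H. apply F. exists q. tauto. }
assert (X2 : 1 < exp 2) by (rewrite <- exp_0; apply exp_increasing; lra).
assert (Cz := smooth_on_cont U z p (proj1 Zsol) Up).
(* The radius is the gap between the two exceptional values, so z cannot jump from one to the other
   and would be locally constant. *)
assert (Lc : locally p (fun q => Rabs (z q - z p) < exp 2 - 1)).
{ apply (Cz (fun t => Rabs (t - z p) < exp 2 - 1)).
  exists (mkposreal (exp 2 - 1) ltac:(lra)). intros t Ht. exact Ht. }
apply (ca_solution_not_locally_const U z p (z p) OU Zsol Up).
assert (E0 := locally_singleton _ _ E).
generalize (filter_and _ _ E Lc). apply filter_imp. intros q [[Eq|Eq] Hq];
  apply Rabs_def2 in Hq; destruct E0 as [E0|E0]; rewrite Eq, E0 in *; lra.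
Qed.

Lemma continuous_eq0_dense (f : R * R -> R) p :
  continuous f p -> (forall P, locally p P -> exists q, P q /\ f q = 0) -> f p = 0.
Proof.
intros C H. apply NNPP. intros N.
assert (L : locally p (fun q => Rabs (f q - f p) < Rabs (f p))).
{ apply (C (fun t => Rabs (t - f p) < Rabs (f p))).
  exists (mkposreal _ (Rabs_pos_lt _ N)). intros t Ht. exact Ht. }
destruct (H _ L) as (q & Hq & Eq). rewrite Eq in Hq.
replace (0 - f p) with (- f p) in Hq by ring. rewrite Rabs_Ropp in Hq. lra.
Qed.

(* What the fundamental forms say about n alone, together with Rodrigues'
   formula solved for the derivatives of r: unlike [corresponds] this also makes
   sense where z = 1 or z = e^2. *)
Definition gauss_frame (U : R * R -> Prop) (z : R * R -> R) (r n : R * R -> vec) : Prop :=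
  smooth3_on U r /\ smooth3_on U n /\
  forall p, U p ->
    dot (n p) (n p) = 1 /\
    dot (vdx n p) (vdx n p) = z p /\
    dot (vdx n p) (vdy n p) = 0 /\
    z p * dot (vdy n p) (vdy n p) = 1 /\
    vdx r p = opp (scal (rho_of z p) (vdx n p)) /\
    vdy r p = opp (scal (sigma_of z p) (vdy n p)).

Lemma first_form_coeffs r p (a b : R) :
  (forall dx dy, first_form r p (dx, dy) = a * dx ^ 2 + b * dy ^ 2) ->
  dot (vdx r p) (vdx r p) = a /\ dot (vdx r p) (vdy r p) = 0 /\ dot (vdy r p) (vdy r p) = b.
Proof.
intros H.
assert (E : forall dx dy, first_form r p (dx, dy) =
  dx ^ 2 * dot (vdx r p) (vdx r p) + 2 * dx * dy * dot (vdx r p) (vdy r p)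
  + dy ^ 2 * dot (vdy r p) (vdy r p)).
{ intros dx dy. unfold first_form, dmap. simpl fst. simpl snd.
  autorewrite with dot. rewrite (dot_sym (vdy r p) (vdx r p)). ring. }
assert (H1 := H 1 0). assert (H2 := H 0 1). assert (H3 := H 1 1).
rewrite E in H1, H2, H3. repeat split; lra.
Qed.

Lemma smooth_on_sigma_of D z :
  open D -> smooth_on D z -> (forall p, D p -> 0 < z p) -> smooth_on D (sigma_of z).
Proof.
intros OD Sz Pz. apply smooth_on_mult; auto; [now apply smooth_on_const|now apply smooth_on_ln].
Qed.

Lemma smooth_on_rho_of D z :
  open D -> smooth_on D z -> (forall p, D p -> 0 < z p) -> smooth_on D (rho_of z).
Proof.
intros OD Sz Pz. apply smooth_on_minus; auto; [now apply smooth_on_sigma_of|now apply smooth_on_const].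
Qed.

Lemma smooth_on_eq_dense U z (f g : R * R -> R) :
  open U -> ca_solution U z -> smooth_on U f -> smooth_on U g ->
  (forall q, U q -> z q <> 1 -> z q <> exp 2 -> f q = g q) ->
  forall p, U p -> f p = g p.
Proof.
intros OU Zsol Sf Sg E p Up.
apply Rminus_diag_uniq.
apply (continuous_eq0_dense (fun q => f q - g q)).
- apply (smooth_on_cont U); auto. now apply smooth_on_minus.
- intros P LP. destruct (ca_solution_dense U z p P OU Zsol Up LP) as (q & Pq & Uq & N1 & N2).
  exists q. split; [exact Pq|]. now rewrite E, Rminus_diag.
Qed.

Lemma smooth3_on_eq_dense U z (f g : R * R -> vec) :
  open U -> ca_solution U z -> smooth3_on U f -> smooth3_on U g ->
  (forall q, U q -> z q <> 1 -> z q <> exp 2 -> f q = g q) ->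
  forall p, U p -> f p = g p.
Proof.
intros OU Zsol (F1 & F2 & F3) (G1 & G2 & G3) E p Up.
apply vec_eq.
- apply (smooth_on_eq_dense U z (fun q => fst (fst (f q))) (fun q => fst (fst (g q)))); auto.
  intros q Uq N1 N2. now rewrite E.
- apply (smooth_on_eq_dense U z (fun q => snd (fst (f q))) (fun q => snd (fst (g q)))); auto.
  intros q Uq N1 N2. now rewrite E.
- apply (smooth_on_eq_dense U z (fun q => snd (f q)) (fun q => snd (g q))); auto.
  intros q Uq N1 N2. now rewrite E.
Qed.

(** Since u = rho sqrt z and v = sigma / sqrt z, the radii cancel in the third fundamental form,
    which becomes z dx^2 + dy^2 / z. The excluded values of z are the zeros of sigma and rho. *)
Lemma corresponds_pointwise U z r n q :
  corresponds U z r n -> U q -> 0 < z q -> z q <> 1 -> z q <> exp 2 ->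
  dot (vdx n q) (vdx n q) = z q /\
  dot (vdx n q) (vdy n q) = 0 /\
  z q * dot (vdy n q) (vdy n q) = 1 /\
  vdx r q = opp (scal (rho_of z q) (vdx n q)) /\
  vdy r q = opp (scal (sigma_of z q) (vdy n q)).
Proof.
intros (_ & _ & _ & H) Uq Pz N1 N2.
destruct (H q Uq N1 N2) as (I1 & _ & Ex & Ey).
destruct (first_form_coeffs r q _ _ I1) as (Fx & Fxy & Fy).
assert (Ns : sigma_of z q <> 0).
{ unfold sigma_of. intros E. apply N1. apply ln_inv; [lra|lra|]. rewrite ln_1. lra. }
assert (Nr : rho_of z q <> 0).
{ unfold rho_of. intros E. apply N2. apply ln_inv; [lra|apply exp_pos|]. rewrite ln_exp. lra. }
assert (Ss := sqrt_sqrt (z q) (Rlt_le _ _ Pz)).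
assert (Sp := sqrt_lt_R0 (z q) Pz).
assert (Eu : u_of z q = rho_of z q * sqrt (z q)) by (unfold u_of, rho_of; field).
assert (Ev : v_of z q = sigma_of z q / sqrt (z q)) by (unfold v_of, sigma_of; field; lra).
rewrite Ex, Ey. autorewrite with dot. rewrite Fx, Fxy, Fy, Eu, Ev.
set (s := sqrt (z q)) in *. set (a := rho_of z q) in *. set (b := sigma_of z q) in *.
repeat split.
- rewrite <- Ss. now field.
- ring.
- rewrite <- Ss. field. split; lra.
- generalize (vdx r q). intros x. apply vec_eq; unfold opp, scal; simpl;
    unfold opp, scal; simpl; unfold mult; simpl; now field.
- generalize (vdy r q). intros x. apply vec_eq; unfold opp, scal; simpl;
    unfold opp, scal; simpl; unfold mult; simpl; now field.
Qed.

(** Each identity is between smooth functions on [U] and holds off z = 1 and z = e^2, hence on a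
    dense set, hence everywhere. *)
Lemma corresponds_gauss_frame U z r n :
  open U -> ca_solution U z -> corresponds U z r n -> gauss_frame U z r n.
Proof.
intros OU Zsol Cor. assert (Cor' := Cor). destruct Cor' as (Sr & Sn & Nn & _).
assert (Zsol' := Zsol). destruct Zsol' as (Sz & Pz & _).
assert (Pw := fun q Uq => corresponds_pointwise U z r n q Cor Uq (Pz q Uq)).
assert (Snx := smooth3_on_vdx _ _ Sn). assert (Sny := smooth3_on_vdy _ _ Sn).
split; [exact Sr|split; [exact Sn|]]. intros p Up.
split; [now apply Nn|split; [|split; [|split; [|split]]]].
- apply (smooth_on_eq_dense U z (fun q => dot (vdx n q) (vdx n q)) z); auto.
  + now apply smooth_on_dot.
  + intros q Uq N1 N2. now apply Pw.
- apply (smooth_on_eq_dense U z (fun q => dot (vdx n q) (vdy n q)) (fun _ => 0)); auto.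
  + now apply smooth_on_dot.
  + now apply smooth_on_const.
  + intros q Uq N1 N2. now apply Pw.
- apply (smooth_on_eq_dense U z (fun q => z q * dot (vdy n q) (vdy n q)) (fun _ => 1)); auto.
  + apply smooth_on_mult; auto. now apply smooth_on_dot.
  + now apply smooth_on_const.
  + intros q Uq N1 N2. now apply Pw.
- apply (smooth3_on_eq_dense U z (vdx r) (fun q => opp (scal (rho_of z q) (vdx n q)))); auto.
  + now apply smooth3_on_vdx.
  + apply smooth3_on_opp, smooth3_on_scal; auto. now apply smooth_on_rho_of.
  + intros q Uq N1 N2. now apply Pw.
- apply (smooth3_on_eq_dense U z (vdy r) (fun q => opp (scal (sigma_of z q) (vdy n q)))); auto.
  + now apply smooth3_on_vdy.
  + apply smooth3_on_opp, smooth3_on_scal; auto. now apply smooth_on_sigma_of.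
  + intros q Uq N1 N2. now apply Pw.
Qed.

(** * The orthogonal frame n, n_x, n_y and the sheet r + sigma n *)

Section Frame.

Variables (U : R * R -> Prop) (z : R * R -> R) (r n : R * R -> vec).
Hypothesis OU : open U.
Hypothesis Zsol : ca_solution U z.
Hypothesis GF : gauss_frame U z r n.

Let Sz : smooth_on U z := proj1 Zsol.
Let Pz : forall p, U p -> 0 < z p := proj1 (proj2 Zsol).
Let Sr : smooth3_on U r := proj1 GF.
Let Sn : smooth3_on U n := proj1 (proj2 GF).

Lemma frame_dots p :
  U p ->
  dot (n p) (n p) = 1 /\ dot (n p) (vdx n p) = 0 /\ dot (n p) (vdy n p) = 0 /\
  dot (vdx n p) (vdx n p) = z p /\ dot (vdx n p) (vdy n p) = 0 /\
  z p * dot (vdy n p) (vdy n p) = 1.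
Proof.
intros Up. destruct (proj2 (proj2 GF) p Up) as (N1 & Nx & Nxy & Ny & _).
assert (Dn := smooth3_on_is_diff3 U n p OU Sn Up).
assert (D1 := is_diff_dot _ _ _ _ _ _ _ Dn Dn).
apply (is_diff_ext_loc _ (fun _ => 1)) in D1.
2: { apply (locally_in U); auto. intros q Uq. now apply (proj2 (proj2 GF) q Uq). }
destruct (is_diff_unique _ _ _ _ _ _ D1 (is_diff_const 1 p)) as [E1 E2].
rewrite (dot_sym (vdx n p) (n p)) in E1. rewrite (dot_sym (vdy n p) (n p)) in E2.
repeat split; auto; lra.
Qed.

(** Obtained by differentiating n . n_x = 0 and n_x . n_x = z. The components of n_xx and n_xy along
    n_y stay undetermined. *)
Lemma frame_second p :
  U p ->
  is_diff3 (vdx n) p (vdx (vdx n) p) (vdy (vdx n) p) /\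
  dot (n p) (vdx (vdx n) p) = - z p /\ dot (n p) (vdy (vdx n) p) = 0 /\
  dot (vdx n p) (vdx (vdx n) p) = pdx z p / 2 /\ dot (vdx n p) (vdy (vdx n) p) = pdy z p / 2.
Proof.
intros Up. destruct (frame_dots p Up) as (N1 & Nx & Ny & Nxx & Nxy & Nyy).
assert (Dn := smooth3_on_is_diff3 U n p OU Sn Up).
assert (Dx := smooth3_on_is_diff3 U _ p OU (smooth3_on_vdx _ _ Sn) Up).
assert (Dz := smooth_on_is_diff U z p OU Sz Up).
assert (D1 := is_diff_dot _ _ _ _ _ _ _ Dn Dx).
apply (is_diff_ext_loc _ (fun _ => 0)) in D1.
2: { apply (locally_in U); auto. intros q Uq. now apply frame_dots. }
destruct (is_diff_unique _ _ _ _ _ _ D1 (is_diff_const 0 p)) as [E1 E2].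
assert (D2 := is_diff_dot _ _ _ _ _ _ _ Dx Dx).
apply (is_diff_ext_loc _ z) in D2.
2: { apply (locally_in U); auto. intros q Uq. now apply frame_dots. }
destruct (is_diff_unique _ _ _ _ _ _ D2 Dz) as [E3 E4].
rewrite (dot_sym (vdy n p) (vdx n p)) in E2.
rewrite (dot_sym (vdx (vdx n) p) (vdx n p)) in E3.
rewrite (dot_sym (vdy (vdx n) p) (vdx n p)) in E4.
split; [exact Dx|]. repeat split; lra.
Qed.

(** The frame is an orthogonal basis with Gram determinant 1, and |n_y|^2 = 1 / z accounts for the
    factor z. *)
Lemma frame_expand p (q : vec) :
  U p -> dot q (n p) = 0 -> dot q (vdx n p) = 0 ->
  q = scal (z p * dot q (vdy n p)) (vdy n p).
Proof.
intros Up H1 H2. destruct (frame_dots p Up) as (N1 & Nx & Ny & Nxx & Nxy & Nyy).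
assert (zp := Pz p Up).
assert (E : minus q (scal (z p * dot q (vdy n p)) (vdy n p)) = zero).
{ apply (det3_orth (n p) (vdx n p) (vdy n p)).
  - intros D. assert (G := det3_gram (n p) (vdx n p) (vdy n p)).
    rewrite D, N1, Nx, Ny, Nxx, Nxy in G.
    replace (1 * (z p * dot (vdy n p) (vdy n p) - 0 ^ 2)
      - 0 * (0 * dot (vdy n p) (vdy n p) - 0 * 0) + 0 * (0 * 0 - z p * 0))
      with (z p * dot (vdy n p) (vdy n p)) in G by ring.
    rewrite Nyy in G. lra.
  - autorewrite with dot. rewrite H1, (dot_sym (vdy n p)), Ny. ring.
  - autorewrite with dot. rewrite H2, (dot_sym (vdy n p)), Nxy. ring.
  - autorewrite with dot.
    transitivity (dot q (vdy n p) * (1 - z p * dot (vdy n p) (vdy n p))); [ring|rewrite Nyy; ring]. }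
revert E. generalize (z p * dot q (vdy n p)) as k. generalize (vdy n p) as y. intros y k E.
transitivity (plus (minus q (scal k y)) (scal k y)).
- vec_ring.
- rewrite E. vec_ring.
Qed.

Lemma is_diff_sigma_of p :
  U p -> is_diff (sigma_of z) p (pdx z p / (2 * z p)) (pdy z p / (2 * z p)).
Proof.
intros Up. assert (zp := Pz p Up).
refine (is_diff_eq _ _ _ _ _ _ (is_diff_mult _ _ _ _ _ _ _ (is_diff_const (1 / 2) p)
  (is_diff_ln _ _ _ _ zp (smooth_on_is_diff U z p OU Sz Up))) _ _); field; lra.
Qed.

(** Because sigma - rho = 1, n_x survives with coefficient 1 and n_y cancels. So where z_y is
    nonzero the sheet has tangent plane spanned by n and n_x and normal direction n_y; where z_y = 0
    it is not immersed. *)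
Lemma sheet_diff p :
  U p ->
  is_diff3 (sheet r n (sigma_of z)) p
    (plus (vdx n p) (scal (pdx z p / (2 * z p)) (n p)))
    (scal (pdy z p / (2 * z p)) (n p)).
Proof.
intros Up. destruct (proj2 (proj2 GF) p Up) as (_ & _ & _ & _ & Ex & Ey).
eapply is_diff3_eq.
- apply is_diff3_plus; [apply (smooth3_on_is_diff3 U); auto|].
  apply is_diff3_scal; [now apply is_diff_sigma_of|apply (smooth3_on_is_diff3 U); auto].
- rewrite Ex. unfold rho_of, sigma_of. generalize (vdx n p) (n p). intros a b. vec_ring.
- rewrite Ey. generalize (vdy n p) (n p). intros a b. vec_ring.
Qed.

End Frame.

(** * Surfaces sharing the sheet r + sigma n *)

(** A kernel vector of dr + s dn is a principal direction. Immersion also yields s <> 0, since for s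
    = 0 the vector would be annihilated by dr. *)
Lemma principal_radius_of_kernel r n p (s : R) rx ry nx ny (v : R * R) :
  is_diff3 r p rx ry -> is_diff3 n p nx ny -> immersion_at r p -> v <> (0, 0) ->
  plus (scal (fst v) (plus rx (scal s nx))) (scal (snd v) (plus ry (scal s ny))) = zero ->
  principal_radius r n p s.
Proof.
intros Dr Dn Im Hv E.
apply is_diff3_vd in Dr as [Er1 Er2]. apply is_diff3_vd in Dn as [En1 En2].
assert (E' : dmap r p v = opp (scal s (dmap n p v))).
{ unfold dmap. rewrite Er1, Er2, En1, En2. destruct v as [v1 v2]. simpl fst in *. simpl snd in *.
  transitivity (minus (plus (scal v1 (plus rx (scal s nx))) (scal v2 (plus ry (scal s ny))))
    (scal s (plus (scal v1 nx) (scal v2 ny)))).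
  - clear. vec_ring.
  - rewrite E. clear. vec_ring. }
assert (Ns : s <> 0).
{ intros Es. apply Hv, Im. rewrite E', Es. generalize (dmap n p v). intros y. vec_ring. }
split; [exact Ns|]. exists v. split; [exact Hv|].
rewrite E'. generalize (dmap n p v). intros y.
destruct y as [[y1 y2] y3]. apply vec_eq; repeat (unfold opp, scal, mult; simpl); now field.
Qed.

Ltac dots :=
  autorewrite with dot; repeat match goal with H : dot _ _ = _ |- _ => rewrite H end.

Section XSurface.

Variables (U : R * R -> Prop) (z : R * R -> R) (r n : R * R -> vec) (A : mat2).
Hypothesis OU : open U.
Hypothesis Zsol : ca_solution U z.
Hypothesis GF : gauss_frame U z r n.
Hypothesis NA : det2 A <> 0.

Let Sz : smooth_on U z := proj1 Zsol.
Let Pz : forall p, U p -> 0 < z p := proj1 (proj2 Zsol).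
Let Sr : smooth3_on U r := proj1 GF.
Let Sn : smooth3_on U n := proj1 (proj2 GF).

(** Cosine of the angle from n to n'_A in the tangent plane of the sheet; the tangent of half that
    angle is a12 / (p sqrt z). *)
Definition X_cos (A : mat2) (z : R * R -> R) (w : R * R) : R :=
  (p_of A (fst w) ^ 2 * z w - a12 A ^ 2) / X_den A z w.

(* The other component is taken along n_x, of norm sqrt z. *)
Definition X_sin (A : mat2) (z : R * R -> R) (w : R * R) : R :=
  2 * a12 A * p_of A (fst w) / X_den A z w.

Lemma n_XE w : n_X A z n w = plus (scal (X_cos A z w) (n w)) (scal (X_sin A z w) (vdx n w)).
Proof.
unfold n_X, X_cos, X_sin, X_den, Rdiv. generalize (vdx n w) (n w). intros a b. vec_ring.
Qed.

Lemma is_diff_X_cos p :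
  U p ->
  is_diff (X_cos A z) p
    (2 * a12 A ^ 2 * (2 * a12 A * p_of A (fst p) * z p + p_of A (fst p) ^ 2 * pdx z p) / X_den A z p ^ 2)
    (2 * a12 A ^ 2 * (p_of A (fst p) ^ 2 * pdy z p) / X_den A z p ^ 2).
Proof.
intros Up. assert (HD := X_den_pos A z p NA (Pz p Up)).
assert (Dz := smooth_on_is_diff U z p OU Sz Up).
refine (is_diff_eq _ _ _ _ _ _ (is_diff_div _ _ _ _ _ _ _ (Rgt_not_eq _ _ HD)
  (is_diff_minus _ _ _ _ _ _ _
   (is_diff_mult _ _ _ _ _ _ _ (is_diff_sqr _ _ _ _ (is_diff_p_of A p)) Dz)
   (is_diff_const (a12 A ^ 2) p)) (is_diff_X_den A z p _ _ Dz)) _ _);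
  unfold X_den in *; field; lra.
Qed.

Lemma is_diff_X_sin p :
  U p ->
  is_diff (X_sin A z) p
    ((2 * a12 A ^ 2 * X_den A z p - 2 * a12 A * p_of A (fst p) *
      (2 * a12 A * p_of A (fst p) * z p + p_of A (fst p) ^ 2 * pdx z p)) / X_den A z p ^ 2)
    (- (2 * a12 A * p_of A (fst p) * (p_of A (fst p) ^ 2 * pdy z p)) / X_den A z p ^ 2).
Proof.
intros Up. assert (HD := X_den_pos A z p NA (Pz p Up)).
assert (Dz := smooth_on_is_diff U z p OU Sz Up).
refine (is_diff_eq _ _ _ _ _ _ (is_diff_div _ _ _ _ _ _ _ (Rgt_not_eq _ _ HD)
  (is_diff_mult _ _ _ _ _ _ _ (is_diff_const (2 * a12 A) p) (is_diff_p_of A p))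
  (is_diff_X_den A z p _ _ Dz)) _ _); field; lra.
Qed.

Lemma is_diff_sigma_X p :
  U p ->
  is_diff (sigma_of (X_z A z)) p
    ((2 * a12 A * p_of A (fst p) * z p + p_of A (fst p) ^ 2 * pdx z p) / X_den A z p
      - pdx z p / (2 * z p))
    (p_of A (fst p) ^ 2 * pdy z p / X_den A z p - pdy z p / (2 * z p)).
Proof.
intros Up. assert (zp := Pz p Up). assert (HD := X_den_pos A z p NA zp).
assert (Dz := smooth_on_is_diff U z p OU Sz Up).
refine (is_diff_eq _ _ _ _ _ _ (is_diff_mult _ _ _ _ _ _ _ (is_diff_const (1 / 2) p)
  (is_diff_ln _ _ _ _ (X_z_pos A z p NA zp) (is_diff_X_z A z p _ _ zp Dz))) _ _);
  unfold X_z; change (p_of A (fst p) ^ 2 * z p + a12 A ^ 2) with (X_den A z p);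
  unfold X_den in *; field; split; lra.
Qed.

Lemma sheet_X w : sheet (r_X A z r n) (n_X A z n) (sigma_of (X_z A z)) w = sheet r n (sigma_of z) w.
Proof.
unfold sheet at 1, r_X. fold (sigma_of (X_z A z) w).
generalize (sheet r n (sigma_of z) w) (n_X A z n w). intros a b. vec_ring.
Qed.

(* For each of the two radii s, the map dr + s dn has rank at most one: its image is
   spanned by the tangent vector t of the sheet orthogonal to n_X, resp. by its normal n_y. *)
Lemma X_frame p :
  U p ->
  exists rx ry nx ny t tx ty kx ky,
    is_diff3 (r_X A z r n) p rx ry /\ is_diff3 (n_X A z n) p nx ny /\
    dot (n_X A z n p) (n_X A z n p) = 1 /\
    dot (n_X A z n p) rx = 0 /\ dot (n_X A z n p) ry = 0 /\
    plus rx (scal (sigma_of (X_z A z) p) nx) = scal tx t /\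
    plus ry (scal (sigma_of (X_z A z) p) ny) = scal ty t /\
    plus rx (scal (rho_of (X_z A z) p) nx) = scal kx (vdy n p) /\
    plus ry (scal (rho_of (X_z A z) p) ny) = scal ky (vdy n p).
Proof.
intros Up. assert (zp := Pz p Up). assert (HD := X_den_pos A z p NA zp).
destruct (frame_dots U z r n OU GF p Up) as (N1 & Nx & Ny & Nxx & Nxy & Nyy).
destruct (frame_second U z r n OU Zsol GF p Up) as (Dx & M1 & M2 & M3 & M4).
assert (Dn := smooth3_on_is_diff3 U n p OU Sn Up).
assert (DF := sheet_diff U z r n OU Zsol GF p Up).
assert (Dc := is_diff_X_cos p Up). assert (Ds := is_diff_X_sin p Up).
assert (DS := is_diff_sigma_X p Up).
assert (DN := is_diff3_plus _ _ _ _ _ _ _ (is_diff3_scal _ _ _ _ _ _ _ Dc Dn)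
                (is_diff3_scal _ _ _ _ _ _ _ Ds Dx)).
apply (is_diff3_ext_loc _ (n_X A z n)) in DN;
  [|apply filter_forall; intros w; symmetry; apply n_XE].
assert (DR := is_diff3_minus _ _ _ _ _ _ _ DF (is_diff3_scal _ _ _ _ _ _ _ DS DN)).
change (is_diff3 (r_X A z r n) p) with
  (is_diff3 (fun q => minus (sheet r n (sigma_of z) q) (scal (sigma_of (X_z A z) q) (n_X A z n q))) p).
change (rho_of (X_z A z) p) with (sigma_of (X_z A z) p - 1).
assert (Fr := frame_expand U z r n OU Zsol GF p).
assert (Ec : X_cos A z p * X_den A z p = p_of A (fst p) ^ 2 * z p - a12 A ^ 2)
  by (unfold X_cos; field; lra).
assert (Es : X_sin A z p * X_den A z p = 2 * a12 A * p_of A (fst p)) by (unfold X_sin; field; lra).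
rewrite n_XE in *.
set (c := X_cos A z p) in *. set (s := X_sin A z p) in *. set (D := X_den A z p) in *.
set (P := p_of A (fst p)) in *. set (a := a12 A) in *.
set (z0 := z p) in *. set (zx := pdx z p) in *. set (zy := pdy z p) in *.
set (S := sigma_of (X_z A z) p) in *.
assert (ED : D = P ^ 2 * z0 + a ^ 2) by reflexivity.
assert (Ec' : c = (P ^ 2 * z0 - a ^ 2) / D) by reflexivity.
assert (Es' : s = 2 * a * P / D) by reflexivity.
match type of Dc with is_diff _ _ ?u ?v => set (cx := u) in *; set (cy := v) in * end.
match type of Ds with is_diff _ _ ?u ?v => set (sx := u) in *; set (sy := v) in * end.
match type of DS with is_diff _ _ ?u ?v => set (Sx := u) in *; set (Sy := v) in * end.
match type of DN with is_diff3 _ _ ?u ?v => set (nx := u) in *; set (ny := v) in * end.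
match type of DR with is_diff3 _ _ ?u ?v => set (rx := u) in *; set (ry := v) in * end.
set (n0 := n p) in *. set (n1 := vdx n p) in *. set (n2 := vdy n p) in *.
set (n11 := vdx (vdx n) p) in *. set (n12 := vdy (vdx n) p) in *.
(* Both are shown orthogonal to n and n_x, hence multiples of n_y, whatever the unknown components
   of n_xx and n_xy are. *)
set (qx := plus rx (scal (S - 1) nx)). set (qy := plus ry (scal (S - 1) ny)).
assert (Dsym := dot_sym n1 n0). rewrite Nx in Dsym.
assert (Dsym2 := dot_sym n2 n0). rewrite Ny in Dsym2.
assert (Dsym3 := dot_sym n2 n1). rewrite Nxy in Dsym3.
assert (K1 := dot_sym n11 n0). rewrite M1 in K1. assert (K2 := dot_sym n12 n0). rewrite M2 in K2.
assert (K3 := dot_sym n11 n1). rewrite M3 in K3. assert (K4 := dot_sym n12 n1). rewrite M4 in K4.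
assert (Q1 : dot qx n0 = 0).
{ unfold qx, rx, nx. dots.
  unfold Sx, cx. rewrite Ec', Es', ED in *. field. split; lra. }
assert (Q2 : dot qx n1 = 0).
{ unfold qx, rx, nx. dots.
  unfold Sx, sx. rewrite Ec', Es', ED in *. field. split; lra. }
assert (Q3 : dot qy n0 = 0).
{ unfold qy, ry, ny. dots.
  unfold Sy, cy. rewrite Ec', Es', ED in *. field. split; lra. }
assert (Q4 : dot qy n1 = 0).
{ unfold qy, ry, ny. dots.
  unfold Sy, sy. rewrite Ec', Es', ED in *. field. split; lra. }
assert (Ecs : c * c + s * s * z0 = 1) by (rewrite Ec', Es', ED in *; field; lra).
(* The fifth witness t is n'_A = c n + s n_x turned by a right angle in the tangent plane, so |t|^2
   = z. The next two are the scalar products of t with the derivatives of the sheet, divided by z;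
   the last two come from [frame_expand]. *)
exists rx, ry, nx, ny, (plus (scal (- (s * z0)) n0) (scal c n1)),
  (c - s * (zx / (2 * z0))), (- (s * (zy / (2 * z0)))), (z0 * dot qx n2), (z0 * dot qy n2).
split; [exact DR|]. split; [exact DN|].
split; [|split; [|split; [|split; [|split; [|split]]]]].
- transitivity (c * c + s * s * z0); [dots; ring|exact Ecs].
- unfold rx, nx. dots.
  unfold Sx, cx, sx. rewrite Ec', Es', ED in *. field. split; lra.
- unfold ry, ny. dots.
  unfold Sy, cy, sy. rewrite Ec', Es', ED in *. field. split; lra.
- transitivity (plus (scal (zx / (2 * z0) - Sx * c) n0) (scal (1 - Sx * s) n1)).
  + unfold rx. clear. clearbody nx n0 n1 S Sx c s zx z0. vec_ring.
  + replace (zx / (2 * z0) - Sx * c) with ((c - s * (zx / (2 * z0))) * - (s * z0))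
      by (unfold Sx; rewrite Ec', Es', ED in *; field; split; lra).
    replace (1 - Sx * s) with ((c - s * (zx / (2 * z0))) * c)
      by (unfold Sx; rewrite Ec', Es', ED in *; field; split; lra).
    clear. clearbody n0 n1 c s zx z0. vec_ring.
- transitivity (plus (scal (zy / (2 * z0) - Sy * c) n0) (scal (- (Sy * s)) n1)).
  + unfold ry. clear. clearbody ny n0 n1 S Sy c s zy z0. vec_ring.
  + replace (zy / (2 * z0) - Sy * c) with (- (s * (zy / (2 * z0))) * - (s * z0))
      by (unfold Sy; rewrite Ec', Es', ED in *; field; split; lra).
    replace (- (Sy * s)) with (- (s * (zy / (2 * z0))) * c)
      by (unfold Sy; rewrite Ec', Es', ED in *; field; split; lra).
    clear. clearbody n0 n1 c s zy z0. vec_ring.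
- now apply Fr.
- now apply Fr.
Qed.

Lemma smooth3_on_n_X V : open V -> (forall p, V p -> U p) -> smooth3_on V (n_X A z n).
Proof.
intros OV VU. apply (smooth3_on_mono U); auto.
apply (smooth3_on_ext U (fun w => plus (scal (X_cos A z w) (n w)) (scal (X_sin A z w) (vdx n w))));
  auto; [intros w _; symmetry; apply n_XE|].
assert (ND : forall p, U p -> X_den A z p <> 0).
{ intros p Up. apply Rgt_not_eq, X_den_pos; auto. }
apply smooth3_on_plus; auto; apply smooth3_on_scal; auto; try now apply smooth3_on_vdx.
- apply smooth_on_div; auto; [|now apply smooth_on_X_den].
  apply smooth_on_minus; auto; [|now apply smooth_on_const].
  apply smooth_on_mult; auto. now apply smooth_on_pow, smooth_on_p_of.
- apply smooth_on_div; auto; [|now apply smooth_on_X_den].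
  apply smooth_on_mult; auto; [now apply smooth_on_const|now apply smooth_on_p_of].
Qed.

Lemma smooth3_on_r_X V : open V -> (forall p, V p -> U p) -> smooth3_on V (r_X A z r n).
Proof.
intros OV VU. apply (smooth3_on_mono U); auto.
apply smooth3_on_minus; auto.
- apply smooth3_on_plus; auto. apply smooth3_on_scal; auto. now apply smooth_on_sigma_of.
- apply (smooth3_on_scal U (sigma_of (X_z A z))); auto; [|now apply smooth3_on_n_X].
  apply smooth_on_sigma_of; auto; [now apply smooth_on_X_z|].
  intros p Up. now apply X_z_pos; auto.
Qed.

Lemma X_surface V :
  open V -> (forall p, V p -> U p) -> (forall p, V p -> immersion_at (r_X A z r n) p) ->
  ca_surface V (r_X A z r n) (n_X A z n) (rho_of (X_z A z)) (sigma_of (X_z A z)).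
Proof.
intros OV VU Im.
split; [exact OV|]. split; [now apply smooth3_on_r_X|]. split; [now apply smooth3_on_n_X|].
split; [exact Im|]. split; [|split].
- intros p Vp.
  destruct (X_frame p (VU p Vp)) as (rx & ry & nx & ny & t & tx & ty & kx & ky & Dr & Dn & E1 & E2 & E3 & _).
  destruct (is_diff3_vd _ _ _ _ Dr) as [-> ->]. auto.
- intros p Vp.
  destruct (X_frame p (VU p Vp)) as (rx & ry & nx & ny & t & tx & ty & kx & ky & Dr & Dn
    & _ & _ & _ & T1 & T2 & K1 & K2).
  split.
  + destruct (rank_one_kernel _ _ _ _ _ K1 K2) as (v & Nv & Ev).
    now apply (principal_radius_of_kernel _ _ p _ rx ry nx ny v); auto.
  + destruct (rank_one_kernel _ _ _ _ _ T1 T2) as (v & Nv & Ev).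
    now apply (principal_radius_of_kernel _ _ p _ rx ry nx ny v); auto.
- exists 1. split; [now left|]. intros p _. unfold rho_of, sigma_of. ring.
Qed.

End XSurface.

(** * There are no other surfaces with the sheet r + sigma n *)

(** Every point is reached from the centre by two axis-parallel segments inside the square, so a
    function with zero differential is constant on it. *)
Definition square (p : R * R) (d : R) (q : R * R) : Prop :=
  (fst p - d < fst q /\ fst q < fst p + d) /\ (snd p - d < snd q /\ snd q < snd p + d).

Lemma open_square p d : open (square p d).
Proof.
apply open_and; apply open_and.
- apply (open_comp fst (fun t => fst p - d < t)); [|apply open_gt].
  intros q _. apply (is_diff_continuous _ q 1 0), is_diff_fst.
- apply (open_comp fst (fun t => t < fst p + d)); [|apply open_lt].
  intros q _. apply (is_diff_continuous _ q 1 0), is_diff_fst.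
- apply (open_comp snd (fun t => snd p - d < t)); [|apply open_gt].
  intros q _. apply (is_diff_continuous _ q 0 1), is_diff_snd.
- apply (open_comp snd (fun t => t < snd p + d)); [|apply open_lt].
  intros q _. apply (is_diff_continuous _ q 0 1), is_diff_snd.
Qed.

Lemma locally_square (P : R * R -> Prop) p :
  locally p P -> exists d, 0 < d /\ forall q, square p d q -> P q.
Proof.
intros [d Hd]. exists d. split; [apply cond_pos|].
intros q [Hx Hy]. apply Hd. destruct p, q; simpl in *.
split; simpl; apply Rabs_def1; unfold minus, plus, opp; simpl; lra.
Qed.

Lemma derive0_const (f : R -> R) a b :
  (forall t, Rmin a b <= t <= Rmax a b -> is_derive f t 0) -> f a = f b.
Proof.
intros H. destruct (Rtotal_order a b) as [L|[->|L]]; [|reflexivity|].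
- apply eq_is_derive; [|exact L]. intros t Ht. apply H.
  rewrite Rmin_left, Rmax_right; lra.
- symmetry. apply eq_is_derive; [|exact L]. intros t Ht. apply H.
  rewrite Rmin_right, Rmax_left; lra.
Qed.

Lemma is_diff0_const_square f p d q :
  0 < d -> (forall w, square p d w -> is_diff f w 0 0) -> square p d q -> f q = f p.
Proof.
intros Hd H [Hx Hy]. destruct p as [x0 y0], q as [x y]. simpl in *.
transitivity (f (x, y0)).
- apply (derive0_const (fun t => f (x, t))). intros t Ht.
  apply (is_diff_pd f (x, t) 0 0). apply H. split; [exact Hx|]. simpl.
  revert Ht. unfold Rmin, Rmax. repeat destruct Rle_dec; lra.
- apply (derive0_const (fun t => f (t, y0))). intros t Ht.
  apply (is_diff_pd f (t, y0) 0 0). apply H. split; simpl; [|lra].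
  revert Ht. unfold Rmin, Rmax. repeat destruct Rle_dec; lra.
Qed.

Lemma dmap_lin f p (a b : R) (v w : R * R) :
  dmap f p (plus (scal a v) (scal b w)) = plus (scal a (dmap f p v)) (scal b (dmap f p w)).
Proof.
unfold dmap. generalize (vdx f p) (vdy f p). intros x y.
destruct v as [v1 v2], w as [w1 w2]. vec_ring.
Qed.

(* Because principal directions for distinct radii are orthogonal. *)
Lemma focal_orthogonality D r n p s :
  open D -> smooth3_on D r -> smooth3_on D n -> D p -> unit_normal_on D r n ->
  immersion_at r p -> principal_radius r n p s -> principal_radius r n p (s - 1) ->
  (exists t, forall v, exists k : R, plus (dmap r p v) (scal s (dmap n p v)) = scal k t) /\
  (forall v w, dot (plus (dmap r p v) (scal s (dmap n p v)))
                   (plus (dmap r p w) (scal (s - 1) (dmap n p w))) = 0).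
Proof.
intros OD Sr Sn Dp Un Im [Ns (e & Ne & He)] [Ns' (f & Nf & Hf)].
(* Symmetry of the second fundamental form, from differentiating n . r_x = 0 and n . r_y = 0 and
   equality of the mixed derivatives of r. *)
assert (Sym : forall v w, dot (dmap n p v) (dmap r p w) = dot (dmap n p w) (dmap r p v)).
{ assert (Dn := smooth3_on_is_diff3 D n p OD Sn Dp).
  assert (Dx := smooth3_on_is_diff3 D _ p OD (smooth3_on_vdx _ _ Sr) Dp).
  assert (Dy := smooth3_on_is_diff3 D _ p OD (smooth3_on_vdy _ _ Sr) Dp).
  rewrite (smooth3_on_Schwarz D r p OD Sr Dp) in Dy.
  assert (Cx := is_diff_dot _ _ _ _ _ _ _ Dn Dx). assert (Cy := is_diff_dot _ _ _ _ _ _ _ Dn Dy).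
  apply (is_diff_ext_loc _ (fun _ => 0)) in Cx.
  2: { apply (locally_in D); auto. intros q Dq. now apply Un. }
  apply (is_diff_ext_loc _ (fun _ => 0)) in Cy.
  2: { apply (locally_in D); auto. intros q Dq. now apply Un. }
  destruct (is_diff_unique _ _ _ _ _ _ Cx (is_diff_const 0 p)) as [_ E1].
  destruct (is_diff_unique _ _ _ _ _ _ Cy (is_diff_const 0 p)) as [E2 _].
  intros v w. unfold dmap. autorewrite with dot.
  assert (E3 : dot (vdx n p) (vdy r p) = dot (vdy n p) (vdx r p)) by lra.
  rewrite E3. ring. }
assert (He' : dmap r p e = opp (scal s (dmap n p e))).
{ revert He. generalize (dmap r p e) (dmap n p e). intros x y E.
  transitivity (scal s (scal (1 / s) x)); [|rewrite <- E; vec_ring].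
  apply vec_eq; repeat (unfold scal, mult; simpl); now field. }
assert (Hf' : dmap r p f = opp (scal (s - 1) (dmap n p f))).
{ revert Hf. generalize (dmap r p f) (dmap n p f). intros x y E.
  transitivity (scal (s - 1) (scal (1 / (s - 1)) x)); [|rewrite <- E; vec_ring].
  apply vec_eq; repeat (unfold scal, mult; simpl); now field. }
(* Symmetry gives s times the product equal to (s - 1) times the product. *)
assert (Orth : dot (dmap n p e) (dmap n p f) = 0).
{ assert (E := Sym e f). rewrite He', Hf' in E. autorewrite with dot in E.
  rewrite (dot_sym (dmap n p f)) in E. lra. }
(* On a common direction both radii would apply, forcing dn and then dr to vanish there, against
   immersion. *)
assert (Indep : fst e * snd f - snd e * fst f <> 0).
{ intros E.
  assert (Par : exists k : R, f = scal k e \/ e = zero).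
  { destruct e as [e1 e2], f as [f1 f2]. simpl in E.
    destruct (Req_dec e1 0) as [Z1|Z1].
    - destruct (Req_dec e2 0) as [Z2|Z2].
      + exists 0. right. now rewrite Z1, Z2.
      + exists (f2 / e2). left. rewrite Z1 in *.
        assert (F : f1 = 0) by (apply (Rmult_eq_reg_l e2); lra).
        rewrite F. apply injective_projections; repeat (unfold scal, mult; simpl); field; exact Z2.
    - exists (f1 / e1). left. apply injective_projections; repeat (unfold scal, mult; simpl); [now field|].
      apply (Rmult_eq_reg_l e1); [|exact Z1].
      transitivity (e1 * f2); [reflexivity|]. transitivity (e2 * f1); [lra|now field]. }
  destruct Par as [k [K|K]]; [|now apply Ne].
  assert (L : forall g, dmap g p f = scal k (dmap g p e)).
  { intros g. rewrite K. destruct e as [e1 e2]. unfold dmap.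
    generalize (vdx g p) (vdy g p). intros x y. vec_ring. }
  assert (Z : dmap n p f = zero).
  { rewrite (L r), He' in Hf'. rewrite (L n) in *.
    revert Hf'. generalize (dmap n p e). intros y E'.
    transitivity (minus (opp (scal (s - 1) (scal k y))) (scal k (opp (scal s y)))).
    - vec_ring.
    - rewrite E'. clear. vec_ring. }
  apply Nf, Im. rewrite Hf', Z. vec_ring. }
set (J := fst e * snd f - snd e * fst f) in *.
assert (Dec : forall g v, dmap g p v =
   plus (scal ((fst v * snd f - snd v * fst f) / J) (dmap g p e))
        (scal ((fst e * snd v - snd e * fst v) / J) (dmap g p f))).
{ intros g v. rewrite <- dmap_lin. f_equal. unfold J in *. destruct e, f, v. simpl in *.
  apply injective_projections; repeat (unfold plus, scal, mult; simpl); now field. }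
(* dr + s dn annihilates e and so has image in the line of dn f; below, dr + (s - 1) dn annihilates
   f and has image in the line of dn e. *)
assert (EP : forall v, plus (dmap r p v) (scal s (dmap n p v)) =
   scal ((fst e * snd v - snd e * fst v) / J) (dmap n p f)).
{ intros v. rewrite (Dec r v), (Dec n v), He', Hf'.
  generalize ((fst v * snd f - snd v * fst f) / J) ((fst e * snd v - snd e * fst v) / J)
    (dmap n p e) (dmap n p f). clear. intros. vec_ring. }
assert (EQ : forall v, plus (dmap r p v) (scal (s - 1) (dmap n p v)) =
   scal (- ((fst v * snd f - snd v * fst f) / J)) (dmap n p e)).
{ intros v. rewrite (Dec r v), (Dec n v), He', Hf'.
  generalize ((fst v * snd f - snd v * fst f) / J) ((fst e * snd v - snd e * fst v) / J)
    (dmap n p e) (dmap n p f). clear. intros. vec_ring. }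
split.
- exists (dmap n p f). intros v. eexists. apply EP.
- intros v w. rewrite EP, EQ. autorewrite with dot. rewrite dot_sym, Orth. ring.
Qed.

(* exp S solves Hess f = f g on the hyperbolic plane d sigma^2 + z dx^2 and is
   null, hence equals ((a11 + a12 x)^2 z + a12^2) / sqrt z. *)
Lemma null_solution p0 d (z S al g : R * R -> R) :
  0 < d ->
  (forall p, square p0 d p ->
     0 < z p /\ g p ^ 2 = z p * (1 - al p ^ 2) /\
     exists zx zy, is_diff z p zx zy /\
       let sx := zx / (2 * z p) in let sy := zy / (2 * z p) in
       let Sx := g p + sx * al p in let Sy := sy * al p in
       is_diff S p Sx Sy /\
       is_diff al p (sx - Sx * al p + g p) (sy - Sy * al p) /\
       is_diff g p (z p - Sx * g p - al p * z p + g p * sx) (- Sy * g p + g p * sy)) ->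
  exists a b : R, (a <> 0 \/ b <> 0) /\
    forall p, square p0 d p ->
      let P := a + b * fst p in
      exp (S p) * sqrt (z p) = P ^ 2 * z p + b ^ 2 /\
      al p * (exp (S p) * sqrt (z p)) = P ^ 2 * z p - b ^ 2 /\
      g p * (exp (S p) * sqrt (z p)) = 2 * b * P * z p.
Proof.
intros Hd H.
(* First integrals, read off from the expected solution with P = a + b x. There [B] is b^2, [G] is 2
   b P, [C] is 2 a b and [Q] is a^2; [B], [C], [Q] are the coefficients of exp S over x^2 sqrt z + 1
   / sqrt z, x sqrt z and sqrt z. *)
set (B := fun q => 1 / 2 * (exp (S q) * (sqrt (z q) * (1 - al q)))).
set (G := fun q => exp (S q) * (g q / sqrt (z q))).
set (C := fun q => G q - 2 * (B q * fst q)).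
set (Q := fun q => 1 / 2 * (exp (S q) * ((1 + al q) / sqrt (z q))) + B q * fst q ^ 2 - G q * fst q).
assert (K : forall p, square p0 d p -> is_diff B p 0 0 /\ is_diff C p 0 0 /\ is_diff Q p 0 0).
{ intros p Hp. destruct (H p Hp) as (zp & Eg & zx & zy & Dz & DS & Da & Dg).
  assert (Sp := sqrt_lt_R0 (z p) zp). assert (Ss := sqrt_sqrt (z p) (Rlt_le _ _ zp)).
  assert (Dh := is_diff_sqrt z p _ _ zp Dz). assert (DE := is_diff_exp S p _ _ DS).
  assert (Nh : sqrt (z p) <> 0) by lra.
  assert (DB : is_diff B p 0 0).
  { refine (is_diff_eq _ _ _ _ _ _ (is_diff_mult _ _ _ _ _ _ _ (is_diff_const (1 / 2) p)
      (is_diff_mult _ _ _ _ _ _ _ DE (is_diff_mult _ _ _ _ _ _ _ Dh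
        (is_diff_minus _ _ _ _ _ _ _ (is_diff_const 1 p) Da)))) _ _);
    (set (h := sqrt (z p)) in *; rewrite <- Ss; field; exact Nh). }
  assert (DG : is_diff G p (2 * B p) 0).
  { refine (is_diff_eq _ _ _ _ _ _ (is_diff_mult _ _ _ _ _ _ _ DE
      (is_diff_div _ _ _ _ _ _ _ Nh Dg Dh)) _ _); unfold B;
    (set (h := sqrt (z p)) in *; rewrite <- Ss; field; exact Nh). }
  split; [exact DB|split].
  - refine (is_diff_eq _ _ _ _ _ _ (is_diff_minus _ _ _ _ _ _ _ DG
      (is_diff_mult _ _ _ _ _ _ _ (is_diff_const 2 p)
        (is_diff_mult _ _ _ _ _ _ _ DB (is_diff_fst p)))) _ _); ring.
  - refine (is_diff_eq _ _ _ _ _ _ (is_diff_minus _ _ _ _ _ _ _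
      (is_diff_plus _ _ _ _ _ _ _
        (is_diff_mult _ _ _ _ _ _ _ (is_diff_const (1 / 2) p)
          (is_diff_mult _ _ _ _ _ _ _ DE (is_diff_div _ _ _ _ _ _ _ Nh
             (is_diff_plus _ _ _ _ _ _ _ (is_diff_const 1 p) Da) Dh)))
        (is_diff_mult _ _ _ _ _ _ _ DB (is_diff_sqr _ _ _ _ (is_diff_fst p))))
      (is_diff_mult _ _ _ _ _ _ _ DG (is_diff_fst p))) _ _); unfold G, B;
    (set (h := sqrt (z p)) in *; rewrite <- Ss; field; exact Nh). }
assert (P0 : square p0 d p0) by (unfold square; lra).
assert (Kc : forall p, square p0 d p -> B p = B p0 /\ C p = C p0 /\ Q p = Q p0).
{ intros p Hp. repeat split;
    (apply (is_diff0_const_square _ p0 d); [exact Hd| |exact Hp]; intros w Hw; now apply K). }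
(* The null condition, from g^2 = z (1 - al^2). That relation also forces al <= 1, and al = 1, g = 0
   when [B] vanishes. *)
assert (Rel : 4 * B p0 * Q p0 = C p0 ^ 2 /\ 0 <= B p0 /\ (B p0 = 0 -> 0 < Q p0 /\ C p0 = 0)).
{ destruct (H p0 P0) as (zp & Eg & _).
  assert (Sp := sqrt_lt_R0 (z p0) zp). assert (Ss := sqrt_sqrt (z p0) (Rlt_le _ _ zp)).
  assert (Xp := exp_pos (S p0)).
  unfold C, Q, G, B. set (h := sqrt (z p0)) in *. set (E := exp (S p0)) in *.
  rewrite <- Ss in Eg.
  assert (Al : al p0 <= 1).
  { apply Rnot_lt_le. intros L. assert (G0 := pow2_ge_0 (g p0)). rewrite Eg in G0.
    assert (L1 : 0 < h * h) by now apply Rmult_lt_0_compat.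
    assert (L2 : 0 < al p0 ^ 2 - 1) by nra.
    assert (L3 := Rmult_lt_0_compat _ _ L1 L2). lra. }
  split; [|split].
  - transitivity (E ^ 2 * ((h * h * (1 - al p0 ^ 2)) / h ^ 2)
      + 4 * (1 / 2 * (E * (h * (1 - al p0)))) *
        (1 / 2 * (E * (h * (1 - al p0))) * fst p0 ^ 2 - E * (g p0 / h) * fst p0)).
    + field. lra.
    + rewrite <- Eg. field. lra.
  - apply Rmult_le_pos; [lra|]. apply Rmult_le_pos; [lra|]. apply Rmult_le_pos; lra.
  - intros Z. assert (Z1 : al p0 = 1).
    { apply Rmult_integral in Z as [Z|Z]; [lra|]. apply Rmult_integral in Z as [Z|Z]; [lra|].
      apply Rmult_integral in Z as [Z|Z]; lra. }
    assert (Z2 : g p0 = 0).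
    { rewrite Z1 in Eg. apply Rsqr_0_uniq. unfold Rsqr. transitivity (g p0 ^ 2); [ring|].
      rewrite Eg. ring. }
    rewrite Z1, Z2. split; [|field; lra].
    replace (1 / 2 * (E * ((1 + 1) / h)) + 1 / 2 * (E * (h * (1 - 1))) * fst p0 ^ 2
      - E * (0 / h) * fst p0) with (E / h) by (field; lra).
    now apply Rdiv_lt_0_compat. }
destruct Rel as (Rel & B0 & BZ).
(* A null vector on the nonnegative half-cone is the square of a pair (a, b); the formula for a
   divides by b, so b = 0 is treated apart. *)
assert (AB : exists a b : R, (a <> 0 \/ b <> 0) /\ b ^ 2 = B p0 /\ 2 * a * b = C p0 /\ a ^ 2 = Q p0).
{ destruct (Req_dec (B p0) 0) as [Z|Z].
  - destruct (BZ Z) as [Q0 C0]. exists (sqrt (Q p0)), 0.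
    split; [left; apply Rgt_not_eq, sqrt_lt_R0; exact Q0|].
    rewrite Z, C0. split; [ring|split; [ring|]]. rewrite pow2_sqrt; lra.
  - assert (BP : 0 < B p0) by lra. assert (SB := sqrt_lt_R0 _ BP).
    assert (SS := sqrt_sqrt _ B0).
    exists (C p0 / (2 * sqrt (B p0))), (sqrt (B p0)). split; [right; lra|].
    split; [rewrite pow2_sqrt; lra|]. split; [field; lra|].
    apply (Rmult_eq_reg_l (4 * B p0)); [|lra]. rewrite Rel.
    set (h := sqrt (B p0)) in *. rewrite <- SS. field. lra. }
destruct AB as (a & b & Nab & Eb & Ec & Ea). exists a, b. split; [exact Nab|].
intros p Hp P. destruct (Kc p Hp) as (K1 & K2 & K3).
destruct (H p Hp) as (zp & Eg & _).
assert (Sp := sqrt_lt_R0 (z p) zp). assert (Ss := sqrt_sqrt (z p) (Rlt_le _ _ zp)).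
assert (EG : G p = 2 * b * P).
{ transitivity (C p + 2 * (B p * fst p)); [unfold C; ring|].
  rewrite K1, K2, <- Eb, <- Ec. unfold P. ring. }
assert (EA : 1 / 2 * (exp (S p) * ((1 + al p) / sqrt (z p))) = P ^ 2).
{ transitivity (Q p - B p * fst p ^ 2 + G p * fst p); [unfold Q; ring|].
  rewrite EG, K1, K3, <- Ea, <- Eb. unfold P. ring. }
assert (EB : B p = b ^ 2) by (rewrite K1; now symmetry).
rewrite <- EB, <- EA.
split; [|split].
- unfold B. set (h := sqrt (z p)) in *. rewrite <- Ss. field. lra.
- unfold B. set (h := sqrt (z p)) in *. rewrite <- Ss. field. lra.
- rewrite <- EG. unfold G. set (h := sqrt (z p)) in *. rewrite <- Ss. field. lra.
Qed.

Lemma smooth2_on_cont D (f : R * R -> R * R) p : smooth2_on D f -> D p -> continuous f p.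
Proof.
intros [H1 H2] Hp.
apply (continuous_ext (fun q => (fst (f q), snd (f q)))); [intros q; now destruct (f q)|].
apply (continuous_comp_2 (fun q => fst (f q)) (fun q => snd (f q)) (fun u v => (u, v)));
  [now apply (smooth_on_cont D)|now apply (smooth_on_cont D)|].
apply (continuous_ext (fun q => q)); [now intros [u v]|apply continuous_id].
Qed.

Lemma smooth2_on_mono (D D' : R * R -> Prop) f :
  (forall p, D' p -> D p) -> smooth2_on D f -> smooth2_on D' f.
Proof. intros E [H1 H2]. split; now apply (smooth_on_mono D). Qed.

(** A diffeomorphism found for one pair of maps is reused for another pair that it matches only on a
    smaller domain. The new target is the part of [W] that [psi] sends into [V']. *)
Lemma same_surface_near_shrink (f g : R * R -> vec) (p q : R * R) (V W V' : R * R -> Prop) phi psi :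
  open W -> W q -> diffeo V W phi psi -> phi p = q ->
  open V' -> V' p -> (forall w, V' w -> V w) -> (forall w, V' w -> f w = g (phi w)) ->
  same_surface_near f p g q.
Proof.
intros OW Wq Dif Epq OV' Vp' VV E.
destruct Dif as (Sphi & Spsi & HV & HW).
exists V', (fun w => W w /\ V' (psi w)), phi, psi.
split; [exact OV'|]. split; [exact Vp'|]. split.
{ intros w [Ww Vw]. apply filter_and; [now apply OW|].
  apply (smooth2_on_cont W psi w Spsi Ww). now apply OV'. }
split; [split; [exact Wq|]|].
{ destruct (HV p (VV p Vp')) as [_ Ep]. now rewrite <- Epq, Ep. }
split; [|split; [exact Epq|exact E]].
split; [now apply (smooth2_on_mono V)|]. split; [apply (smooth2_on_mono W); tauto|]. split.
- intros w Vw. destruct (HV w (VV w Vw)) as [Ww Ew]. rewrite Ew. tauto.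
- intros w [Ww Vw]. split; [exact Vw|]. now apply HW.
Qed.

(** * Comparison of two surfaces along a common sheet *)

Section XExhaust.

Variables (U : R * R -> Prop) (z : R * R -> R) (r n : R * R -> vec).
Hypothesis OU : open U.
Hypothesis Zsol : ca_solution U z.
Hypothesis GF : gauss_frame U z r n.

Let Sz : smooth_on U z := proj1 Zsol.
Let Pz : forall p, U p -> 0 < z p := proj1 (proj2 Zsol).
Let Sr : smooth3_on U r := proj1 GF.
Let Sn : smooth3_on U n := proj1 (proj2 GF).

Variables (D : R * R -> Prop) (r1 n1 : R * R -> vec) (s1 : R * R -> R).
Hypothesis OD : open D.
Hypothesis Sr1 : smooth3_on D r1.
Hypothesis Sn1 : smooth3_on D n1.
Hypothesis Im1 : forall w, D w -> immersion_at r1 w.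
Hypothesis Un1 : unit_normal_on D r1 n1.
Hypothesis Rad1 : forall w, D w ->
  principal_radius r1 n1 w (s1 w) /\ principal_radius r1 n1 w (s1 w - 1).

(* The normals of the second surface are tangent to the sheet, and its support
   function S satisfies grad S = N and Hess S = g - dS^2 there. *)
Lemma sheet_eikonal V (phi : R * R -> R * R) p :
  open V -> smooth2_on V phi -> V p -> (forall q, V q -> U q /\ D (phi q)) ->
  (forall q, V q -> sheet r n (sigma_of z) q = sheet r1 n1 s1 (phi q)) ->
  pdy z p <> 0 ->
  let S q := s1 (phi q) in
  let al q := dot (n1 (phi q)) (n q) in
  let g q := dot (n1 (phi q)) (vdx n q) in
  let sx := pdx z p / (2 * z p) in let sy := pdy z p / (2 * z p) in
  let Sx := g p + sx * al p in let Sy := sy * al p in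
  g p ^ 2 = z p * (1 - al p ^ 2) /\
  n1 (phi p) = plus (scal (al p) (n p)) (scal (g p / z p) (vdx n p)) /\
  is_diff S p Sx Sy /\
  is_diff al p (sx - Sx * al p + g p) (sy - Sy * al p) /\
  is_diff g p (z p - Sx * g p - al p * z p + g p * sx) (- Sy * g p + g p * sy).
Proof.
intros OV Sphi Vp VUD EF Nzy S al g sx sy Sx Sy.
assert (Up : U p) by now apply VUD. assert (Dp : D (phi p)) by now apply VUD.
assert (zp := Pz p Up).
assert (Nsy : sy <> 0).
{ unfold sy. intros E. apply Nzy. apply (Rmult_eq_reg_r (/ (2 * z p))).
  - rewrite Rmult_0_l. exact E.
  - apply Rinv_neq_0_compat. lra. }
assert (SN : smooth3_on V (fun q => n1 (phi q))).
{ apply (smooth3_on_comp V D n1); auto. intros q Vq. now apply VUD. }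
assert (SR : smooth3_on V (fun q => r1 (phi q))).
{ apply (smooth3_on_comp V D r1); auto. intros q Vq. now apply VUD. }
set (N := fun q => n1 (phi q)) in *. set (R1 := fun q => r1 (phi q)) in *.
assert (D1 := smooth_on_is_diff V _ p OV (proj1 Sphi) Vp).
assert (D2 := smooth_on_is_diff V _ p OV (proj2 Sphi) Vp).
assert (DN := is_diff3_comp_map D n1 phi p _ _ _ _ OD Dp Sn1 D1 D2).
assert (DR := is_diff3_comp_map D r1 phi p _ _ _ _ OD Dp Sr1 D1 D2).
set (vx := (pdx (fun q => fst (phi q)) p, pdx (fun q => snd (phi q)) p)) in *.
set (vy := (pdy (fun q => fst (phi q)) p, pdy (fun q => snd (phi q)) p)) in *.
destruct (Rad1 _ Dp) as [P1 P2].
destruct (focal_orthogonality D r1 n1 (phi p) (s1 (phi p)) OD Sr1 Sn1 Dp Un1 (Im1 _ Dp) P1 P2)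
  as [[t Ht] Orth].
destruct (Ht vx) as [kx Ekx]. destruct (Ht vy) as [ky Eky]. clear Ht.
assert (Oxx := Orth vx vx). assert (Oxy := Orth vx vy). assert (Oyx := Orth vy vx).
assert (Oyy := Orth vy vy). clear Orth.
destruct (Un1 _ Dp) as (U1 & U2 & U3).
assert (NR : forall v, dot (N p) (dmap r1 (phi p) v) = 0).
{ intros v. unfold dmap, N. autorewrite with dot. rewrite U2, U3. ring. }
assert (NRx := NR vx). assert (NRy := NR vy). clear NR.
(* S = (F - r1) . n1 is differentiable because everything else is. *)
assert (DF := sheet_diff U z r n OU Zsol GF p Up).
set (F := sheet r n (sigma_of z)) in *.
assert (DS := is_diff_dot _ _ _ _ _ _ _ (is_diff3_minus _ _ _ _ _ _ _ DF DR) DN).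
apply (is_diff_ext_loc _ S) in DS.
2: { apply (locally_in V); auto. intros q Vq. rewrite (EF q Vq). unfold sheet, S.
  destruct (Un1 (phi q) (proj2 (VUD q Vq))) as (E & _).
  autorewrite with dot. rewrite E. ring. }
match type of DS with is_diff _ _ ?u ?v => set (Sx' := u) in *; set (Sy' := v) in * end.
clearbody Sx' Sy'.
assert (DF' := is_diff3_plus _ _ _ _ _ _ _ DR (is_diff3_scal _ _ _ _ _ _ _ DS DN)).
apply (is_diff3_ext_loc _ F) in DF'.
2: { apply (locally_in V); auto. intros q Vq. symmetry. exact (EF q Vq). }
assert (EFd : forall a b a' b', is_diff3 F p a b -> is_diff3 F p a' b' -> a = a' /\ b = b').
{ intros a b a' b' Ha Hb. apply is_diff3_vd in Ha as [<- <-]. now apply is_diff3_vd in Hb as [<- <-]. }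
destruct (EFd _ _ _ _ DF DF') as [Ex Ey]. clear EFd DF DF'.
assert (DN1 := is_diff_dot _ _ _ _ _ _ _ DN DN).
apply (is_diff_ext_loc _ (fun _ => 1)) in DN1.
2: { apply (locally_in V); auto. intros q Vq. now apply Un1, VUD. }
destruct (is_diff_unique _ _ _ _ _ _ DN1 (is_diff_const 1 p)) as [NNx NNy]. clear DN1.
destruct (frame_dots U z r n OU GF p Up) as (F1 & Fx & Fy & Fxx & Fxy & Fyy).
destruct (frame_second U z r n OU Zsol GF p Up) as (Dnx & M1 & M2 & M3 & M4).
assert (Dn := smooth3_on_is_diff3 U n p OU Sn Up).
assert (Dal : is_diff al p
    (dot (dmap n1 (phi p) vx) (n p) + dot (N p) (vdx n p))
    (dot (dmap n1 (phi p) vy) (n p) + dot (N p) (vdy n p)))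
  by exact (is_diff_dot _ _ _ _ _ _ _ DN Dn).
assert (Dg : is_diff g p
    (dot (dmap n1 (phi p) vx) (vdx n p) + dot (N p) (vdx (vdx n) p))
    (dot (dmap n1 (phi p) vy) (vdx n p) + dot (N p) (vdy (vdx n) p)))
  by exact (is_diff_dot _ _ _ _ _ _ _ DN Dnx).
assert (Eal : dot (N p) (n p) = al p) by reflexivity.
assert (Eg : dot (N p) (vdx n p) = g p) by reflexivity.
change (n1 (phi p)) with (N p) in *. change (s1 (phi p)) with (S p) in *.
fold sx in Ex. fold sy in Ey.
clear U2 U3 DR DN D1 D2 P1 P2 Dn Dnx SN SR Im1 Un1 Rad1 Sr1 Sn1.
set (Nx := dmap n1 (phi p) vx) in *. set (Ny := dmap n1 (phi p) vy) in *.
set (Rx := dmap r1 (phi p) vx) in *. set (Ry := dmap r1 (phi p) vy) in *.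
clearbody Nx Ny Rx Ry vx vy.
unfold Sx, Sy.
set (N0 := N p) in *. set (n0 := n p) in *. set (nx := vdx n p) in *. set (ny := vdy n p) in *.
set (nxx := vdx (vdx n) p) in *. set (nxy := vdy (vdx n) p) in *.
set (a := al p) in *. set (b := g p) in *. set (S0 := S p) in *.
assert (Zx : pdx z p = 2 * z p * sx) by (unfold sx; field; lra).
assert (Zy : pdy z p = 2 * z p * sy) by (unfold sy; field; lra).
set (z0 := z p) in *.
rewrite Zx in M3. rewrite Zy in M4.
clearbody N0 n0 nx ny nxx nxy a b S0 z0 sx sy.
assert (NxN : dot N0 Nx = 0) by (rewrite (dot_sym Nx) in NNx; lra).
assert (NyN : dot N0 Ny = 0) by (rewrite (dot_sym Ny) in NNy; lra).
assert (nN := dot_sym n0 N0). rewrite Eal in nN.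
assert (nxN := dot_sym nx N0). rewrite Eg in nxN.
(* The differential of r1 + S N is multiplied by N: dr1 and dN are orthogonal to N, so only dS
   remains. *)
assert (ESx : Sx' = b + sx * a).
{ assert (E := f_equal (dot N0) Ex). autorewrite with dot in E.
  rewrite Eg, Eal, NRx, U1, NxN in E. lra. }
assert (ESy : Sy' = sy * a).
{ assert (E := f_equal (dot N0) Ey). autorewrite with dot in E.
  rewrite Eal, NRy, U1, NyN in E. lra. }
assert (PFx : plus Rx (scal S0 Nx) = minus (plus nx (scal sx n0)) (scal Sx' N0))
  by (rewrite Ex; clear; vec_ring).
assert (PFy : plus Ry (scal S0 Ny) = minus (scal sy n0) (scal Sy' N0))
  by (rewrite Ey; clear; vec_ring).
assert (Qx : plus Rx (scal (S0 - 1) Nx) = minus (minus (plus nx (scal sx n0)) (scal Sx' N0)) Nx)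
  by (rewrite <- PFx; clear; vec_ring).
assert (Qy : plus Ry (scal (S0 - 1) Ny) = minus (minus (scal sy n0) (scal Sy' N0)) Ny)
  by (rewrite <- PFy; clear; vec_ring).
(* N is tangent to the sheet *)
assert (Det : det3 nx n0 N0 = 0).
{ apply (Rmult_eq_reg_l sy); [|exact Nsy]. rewrite Rmult_0_r.
  (* Modulo N, the derivatives of the sheet are the two multiples of [t] supplied by
     [focal_orthogonality], so with N they have determinant zero; the factor [sy] splits off. *)
  transitivity (det3 (minus (plus nx (scal sx n0)) (scal Sx' N0)) (minus (scal sy n0) (scal Sy' N0)) N0).
  - clear. unfold det3. vec_ring.
  - rewrite <- PFx, <- PFy, Ekx, Eky. clear. unfold det3. vec_ring. }
(* The vanishing Gram determinant says that N is a unit vector in the plane of n and n_x. *)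
assert (Gr := det3_gram nx n0 N0). rewrite Det, Fxx, F1, U1, nN, nxN, (dot_sym nx n0), Fx in Gr.
assert (Rel : b ^ 2 = z0 * (1 - a ^ 2)) by lra.
assert (EN : N0 = plus (scal a n0) (scal (b / z0) nx)).
{ assert (W : minus N0 (plus (scal a n0) (scal (b / z0) nx)) = zero).
  { apply dot_self_eq0. autorewrite with dot.
    rewrite U1, nN, nxN, Eal, Eg, F1, Fxx, (dot_sym nx n0), Fx.
    transitivity (1 - a ^ 2 - b ^ 2 / z0); [field; lra|]. rewrite Rel. field. lra. }
  transitivity (plus (minus N0 (plus (scal a n0) (scal (b / z0) nx)))
    (plus (scal a n0) (scal (b / z0) nx))); [clear; vec_ring|]. rewrite W. clear. vec_ring. }
(* The derivatives [qx], [qy] of the other sheet are orthogonal to N and to the derivatives of this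
   sheet modulo N. As [sy] is nonzero, they are orthogonal to n and n_x separately. These four
   equations give the tangential part of dN, that is, the Hessian of S. *)
rewrite PFx, Qx in Oxx. rewrite PFx, Qy in Oxy. rewrite PFy, Qx in Oyx. rewrite PFy, Qy in Oyy.
set (qx := minus (minus (plus nx (scal sx n0)) (scal Sx' N0)) Nx) in *.
set (qy := minus (minus (scal sy n0) (scal Sy' N0)) Ny) in *.
assert (Nqx : dot N0 qx = 0).
{ unfold qx. autorewrite with dot. rewrite Eg, Eal, U1, NxN, ESx. ring. }
assert (Nqy : dot N0 qy = 0).
{ unfold qy. autorewrite with dot. rewrite Eal, U1, NyN, ESy. ring. }
assert (n0qx : dot n0 qx = 0).
{ apply (Rmult_eq_reg_l sy); [|exact Nsy]. rewrite dot_minus_l, !dot_scal_l, Nqx in Oyx. lra. }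
assert (n0qy : dot n0 qy = 0).
{ apply (Rmult_eq_reg_l sy); [|exact Nsy]. rewrite dot_minus_l, !dot_scal_l, Nqy in Oyy. lra. }
assert (nxqx : dot nx qx = 0).
{ rewrite dot_minus_l, dot_plus_l, !dot_scal_l, Nqx, n0qx in Oxx. lra. }
assert (nxqy : dot nx qy = 0).
{ rewrite dot_minus_l, dot_plus_l, !dot_scal_l, Nqy, n0qy in Oxy. lra. }
unfold qx, qy in *. autorewrite with dot in n0qx, n0qy, nxqx, nxqy.
rewrite nN, ?F1, ?Fx, ESx, ?(dot_sym n0 Nx) in n0qx. rewrite nN, F1, ESy, (dot_sym n0 Ny) in n0qy.
rewrite nxN, Fxx, (dot_sym nx n0), Fx, ESx, (dot_sym nx Nx) in nxqx.
rewrite nxN, (dot_sym nx n0), Fx, ESy, (dot_sym nx Ny) in nxqy.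
(* N has no component along n_y, so the undetermined components of n_xx and n_xy drop out. *)
assert (Nny : dot N0 ny = 0).
{ rewrite EN. autorewrite with dot. rewrite Fy, Fxy. ring. }
assert (Nnxx : dot N0 nxx = - (a * z0) + b * sx).
{ rewrite EN. autorewrite with dot. rewrite M1, M3. field. lra. }
assert (Nnxy : dot N0 nxy = b * sy).
{ rewrite EN. autorewrite with dot. rewrite M2, M4. field. lra. }
rewrite Eg, Nny in Dal. rewrite Nnxx, Nnxy in Dg.
rewrite <- ESx, <- ESy.
split; [exact Rel|]. split; [exact EN|]. split; [exact DS|].
split; [apply (is_diff_eq _ _ _ _ _ _ Dal); rewrite ?ESx, ?ESy; lra|].
apply (is_diff_eq _ _ _ _ _ _ Dg); rewrite ?ESx, ?ESy; lra.
Qed.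

(** [r_X] and [n_X] depend on the first row only, so any completion to determinant 1 serves. *)
Lemma exists_mat2 (a b : R) : a <> 0 \/ b <> 0 -> exists A, a11 A = a /\ a12 A = b /\ det2 A = 1.
Proof.
intros [H|H].
- exists (Mat2 a b 0 (/ a)). repeat split. unfold det2; simpl. now field.
- exists (Mat2 a b (- / b) 0). repeat split. unfold det2; simpl. now field.
Qed.

(** Integrating the eikonal system gives exp S = D / sqrt z. Hence S is half the logarithm of z'_A
    and N is n'_A, and subtracting S N from the common sheet returns r1 in the parameters of the
    seed. *)
Lemma X_exhaust p0 w0 :
  U p0 -> D w0 -> immersion_at (sheet r n (sigma_of z)) p0 ->
  same_surface_near (sheet r n (sigma_of z)) p0 (sheet r1 n1 s1) w0 ->
  exists A, det2 A = 1 /\ same_surface_near (r_X A z r n) p0 r1 w0.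
Proof.
intros Up0 Dw0 Im (V & W & phi & psi & OV & Vp0 & OW & Ww0 & Dif & Ep0 & EF).
assert (Dif' := Dif). destruct Dif' as (Sphi & _ & HV & _).
(* If z_y vanished, the y-derivative of the sheet would vanish, against immersion. *)
assert (Nzy : pdy z p0 <> 0).
{ intros Z. destruct (is_diff3_vd _ _ _ _ (sheet_diff U z r n OU Zsol GF p0 Up0)) as [_ E].
  assert (K : (0, 1) = (0, 0) :> R * R); [|injection K; lra].
  apply Im. unfold dmap. rewrite E, Z. simpl.
  generalize (vdx (sheet r n (sigma_of z)) p0) (n p0). intros u v.
  unfold Rdiv. rewrite Rmult_0_l. clear. vec_ring. }
assert (L : locally p0 (fun q => (V q /\ U q) /\ (D (phi q) /\ pdy z q <> 0))).
{ apply filter_and; apply filter_and.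
  - now apply OV.
  - now apply OU.
  - apply (smooth2_on_cont V phi p0 Sphi Vp0). apply OD. now rewrite Ep0.
  - apply (smooth_on_cont U (pdy z) p0 (smooth_on_pdy _ _ Sz) Up0 (fun t => t <> 0)).
    now apply (open_neq 0). }
destruct (locally_square _ _ L) as (d & Hd & HQ).
assert (OQ := open_square p0 d).
assert (Sq : smooth2_on (square p0 d) phi).
{ apply (smooth2_on_mono V); auto. intros q Hq. now apply HQ. }
assert (Eik := fun p Hp => sheet_eikonal (square p0 d) phi p OQ Sq Hp
  (fun q Hq => conj (proj2 (proj1 (HQ q Hq))) (proj1 (proj2 (HQ q Hq))))
  (fun q Hq => EF q (proj1 (proj1 (HQ q Hq)))) (proj2 (proj2 (HQ p Hp)))).
cbv zeta beta in Eik.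
destruct (null_solution p0 d z (fun q => s1 (phi q)) (fun q => dot (n1 (phi q)) (n q))
  (fun q => dot (n1 (phi q)) (vdx n q)) Hd) as (a & b & Nab & Hab).
{ intros p Hp. assert (Up : U p) by now apply HQ. destruct (Eik p Hp) as (E1 & _ & E2 & E3 & E4).
  split; [now apply Pz|]. split; [exact E1|]. exists (pdx z p), (pdy z p).
  split; [now apply (smooth_on_is_diff U)|]. split; [exact E2|split; [exact E3|exact E4]]. }
destruct (exists_mat2 a b Nab) as (A & Ea & Eb & DA).
exists A. split; [exact DA|].
apply (same_surface_near_shrink _ _ _ _ V W (square p0 d) phi psi); auto.
- unfold square. lra.
- intros q Hq. now apply HQ.
- intros p Hp. assert (Up : U p) by now apply HQ. assert (zp := Pz p Up).
  destruct (Eik p Hp) as (_ & EN & _). destruct (Hab p Hp) as (H1 & H2 & H3).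
  assert (HD : 0 < X_den A z p) by (apply X_den_pos; auto; rewrite DA; lra).
  assert (EP : p_of A (fst p) = a + b * fst p) by (unfold p_of; now rewrite Ea, Eb).
  assert (ED : X_den A z p = exp (s1 (phi p)) * sqrt (z p))
    by (unfold X_den; now rewrite EP, Eb, H1).
  assert (ES : sigma_of (X_z A z) p = s1 (phi p)).
  { unfold sigma_of. replace (X_z A z p) with (exp (s1 (phi p)) * exp (s1 (phi p))).
    - rewrite <- exp_plus, ln_exp. field.
    - change (X_z A z p) with (X_den A z p ^ 2 / z p). rewrite ED.
      assert (Ss := sqrt_sqrt (z p) (Rlt_le _ _ zp)). assert (Sp := sqrt_lt_R0 _ zp).
      set (h := sqrt (z p)) in *. rewrite <- Ss. field. lra. }
  assert (EN' : n_X A z n p = n1 (phi p)).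
  { rewrite n_XE, EN. f_equal; f_equal.
    - unfold X_cos. rewrite EP, Eb, <- H2, <- ED. field. lra.
    - unfold X_sin. rewrite EP, Eb. apply (Rmult_eq_reg_r (X_den A z p * z p)); [|nra].
      transitivity (2 * b * (a + b * fst p) * z p); [field; lra|].
      rewrite <- H3, <- ED. field. lra. }
  unfold r_X. fold (sigma_of (X_z A z) p).
  rewrite ES, EN', (EF p (proj1 (proj1 (HQ p Hp)))). unfold sheet.
  generalize (r1 (phi p)) (n1 (phi p)) (s1 (phi p)). clear. intros. vec_ring.
Qed.

End XExhaust.

(** * The reciprocal symmetry exchanging X_A and Y_A *)

(** The partial derivatives of a function composed with [sw] are convertible to the exchanged ones,
    which the [change] and [reflexivity] steps below exploit. *)
Definition sw (p : R * R) : R * R := (snd p, fst p).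

Lemma sw_sw p : sw (sw p) = p.
Proof. now destruct p. Qed.

Lemma smooth2_on_sw D : open D -> smooth2_on D sw.
Proof. intros OD. split; [now apply smooth_on_snd|now apply smooth_on_fst]. Qed.

Lemma continuous_sw p : continuous sw p.
Proof. apply (smooth2_on_cont (fun _ => True)); [apply smooth2_on_sw, open_true|exact I]. Qed.

Lemma open_sw D : open D -> open (fun p => D (sw p)).
Proof. intros OD. apply (open_comp sw D); [|exact OD]. intros p _. apply continuous_sw. Qed.

Lemma smooth_on_sw D f : open D -> smooth_on D f -> smooth_on (fun p => D (sw p)) (fun p => f (sw p)).
Proof.
intros OD Sf. assert (OS := open_sw D OD).
apply (smooth_on_comp _ D f sw); auto. now apply smooth2_on_sw.
Qed.

Lemma smooth3_on_sw D f :
  open D -> smooth3_on D f -> smooth3_on (fun p => D (sw p)) (fun p => f (sw p)).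
Proof.
intros OD Sf. assert (OS := open_sw D OD).
apply (smooth3_on_comp _ D f sw); auto. now apply smooth2_on_sw.
Qed.

Lemma dmap_sw f p v : dmap (fun q => f (sw q)) p v = dmap f (sw p) (sw v).
Proof.
unfold dmap. change (vdx (fun q => f (sw q)) p) with (vdy f (sw p)).
change (vdy (fun q => f (sw q)) p) with (vdx f (sw p)).
generalize (vdx f (sw p)) (vdy f (sw p)). destruct v as [v1 v2]. intros. vec_ring.
Qed.

Lemma vd_opp f p : vdx (fun q => opp (f q)) p = opp (vdx f p) /\ vdy (fun q => opp (f q)) p = opp (vdy f p).
Proof. split; apply vec_eq; apply Derive_opp. Qed.

Lemma dmap_opp f p v : dmap (fun q => opp (f q)) p v = opp (dmap f p v).
Proof.
unfold dmap. destruct (vd_opp f p) as [-> ->].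
generalize (vdx f p) (vdy f p). destruct v as [v1 v2]. intros. vec_ring.
Qed.

Lemma immersion_at_sw f p : immersion_at f p -> immersion_at (fun q => f (sw q)) (sw p).
Proof.
intros Im v Hv. rewrite dmap_sw, sw_sw in Hv. apply Im in Hv.
destruct v as [v1 v2]. unfold sw in Hv. simpl in Hv. now injection Hv as -> ->.
Qed.

Lemma same_surface_near_sw f p g q :
  same_surface_near f p g q -> same_surface_near (fun w => f (sw w)) (sw p) g q.
Proof.
intros (V & W & phi & psi & OV & Vp & OW & Wq & (Sphi & Spsi & HV & HW) & Ep & E).
assert (OS := open_sw V OV).
exists (fun w => V (sw w)), W, (fun w => phi (sw w)), (fun w => sw (psi w)).
split; [exact OS|]. split; [now rewrite sw_sw|]. split; [exact OW|]. split; [exact Wq|].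
split; [|split].
- split; [|split; [|split]].
  + destruct Sphi as [S1 S2]. split.
    * now apply (smooth_on_sw V (fun w => fst (phi w))).
    * now apply (smooth_on_sw V (fun w => snd (phi w))).
  + destruct Spsi as [S1 S2]. split; [exact S2|exact S1].
  + intros w Vw. destruct (HV _ Vw) as [Ww Ew]. split; [exact Ww|]. now rewrite Ew, sw_sw.
  + intros w Ww. destruct (HW _ Ww) as [Vw Ew]. rewrite sw_sw. now split.
- now rewrite sw_sw.
- intros w Vw. now apply E.
Qed.

Lemma same_surface_near_ext (U : R * R -> Prop) f f' p g q :
  open U -> U p -> (forall w, U w -> f w = f' w) ->
  same_surface_near f p g q -> same_surface_near f' p g q.
Proof.
intros OU Up Ef (V & W & phi & psi & OV & Vp & OW & Wq & Dif & Ep & E).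
apply (same_surface_near_shrink f' g p q V W (fun w => V w /\ U w) phi psi); auto.
- now apply open_and.
- tauto.
- intros w [Vw Uw]. rewrite <- Ef; auto.
Qed.

Lemma ca_solution_ext (D D' : R * R -> Prop) z z' :
  open D' -> (forall p, D' p -> D p) -> (forall p, D' p -> z p = z' p) ->
  ca_solution D z -> ca_solution D' z'.
Proof.
intros OD DD E (Sz & Pz & Ez).
assert (Sz' : smooth_on D' z') by (apply (smooth_on_ext D' z); auto; now apply (smooth_on_mono D)).
assert (L : forall f f' : R * R -> R, (forall p, D' p -> f p = f' p) ->
  forall p, D' p -> pdx f p = pdx f' p /\ pdy f p = pdy f' p).
{ intros f f' Ef p Dp. now apply pd_ext_loc, (locally_in D'). }
split; [exact Sz'|]. split.
- intros p Dp. rewrite <- E; auto.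
- intros p Dp. rewrite <- (Ez p (DD p Dp)).
  assert (E' : forall w, D' w -> 1 / z' w = 1 / z w) by (intros w Dw; now rewrite E).
  assert (E1 := fun w Dw => proj2 (L z' z (fun q Dq => eq_sym (E q Dq)) w Dw)).
  assert (E2 := fun w Dw => proj1 (L (fun q => 1 / z' q) (fun q => 1 / z q) E' w Dw)).
  now rewrite (proj2 (L _ _ E1 p Dp)), (proj1 (L _ _ E2 p Dp)).
Qed.

Definition dual_z (z : R * R -> R) (p : R * R) : R := 1 / z (sw p).

Lemma ca_solution_dual D z :
  open D -> ca_solution D z -> ca_solution (fun p => D (sw p)) (dual_z z).
Proof.
intros OD (Sz & Pz & Ez). assert (OS := open_sw D OD).
split; [|split].
- apply smooth_on_div; auto; [|now apply smooth_on_const|now apply (smooth_on_sw D z)].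
  intros p Dp. apply Rgt_not_eq. now apply Pz.
- intros p Dp. apply Rdiv_lt_0_compat; [lra|now apply Pz].
- intros p Dp.
  (* The total inverse is an involution even at 0, so this is an equality of functions on the whole
     plane and may be rewritten under the derivatives. *)
  replace (fun q => 1 / dual_z z q) with (fun q => z (sw q)).
  2: { apply functional_extensionality. intros q. unfold dual_z, Rdiv.
       now rewrite !Rmult_1_l, Rinv_inv. }
  rewrite <- (Ez (sw p) Dp). rewrite (Rplus_comm (pdy (pdy z) (sw p))). reflexivity.
Qed.

Lemma pd_dual D z p :
  open D -> smooth_on D z -> (forall q, D q -> 0 < z q) -> D (sw p) ->
  pdx (dual_z z) p = - (pdy z (sw p) / z (sw p) ^ 2) /\
  pdy (dual_z z) p = - (pdx z (sw p) / z (sw p) ^ 2).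
Proof.
intros OD Sz Pz Dp. assert (zp := Pz _ Dp).
assert (H := is_diff_div (fun _ => 1) z (sw p) _ _ _ _ (Rgt_not_eq _ _ zp)
  (is_diff_const 1 (sw p)) (smooth_on_is_diff D z _ OD Sz Dp)).
apply is_diff_pdE in H as [H1 H2].
split.
- transitivity (pdy (fun q => 1 / z q) (sw p)); [reflexivity|]. rewrite H2. field. lra.
- transitivity (pdx (fun q => 1 / z q) (sw p)); [reflexivity|]. rewrite H1. field. lra.
Qed.

Lemma is_derive_eq (f : R -> R) (x l l' : R) : is_derive f x l -> l = l' -> is_derive f x l'.
Proof. now intros H <-. Qed.

(** Duality sends z_y dx + (z_x / z^2) dy and y dx - x dy to their negatives, hence the sign of chi;
    exchanging the factors x and y exchanges eta and xi. *)
Lemma potentials_dual D z chi eta xi :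
  open D -> smooth_on D z -> (forall q, D q -> 0 < z q) -> potentials D z chi eta xi ->
  potentials (fun p => D (sw p)) (dual_z z)
    (fun p => - chi (sw p)) (fun p => xi (sw p)) (fun p => eta (sw p)).
Proof.
intros OD Sz Pz pot x y Dp. unfold sw in Dp; simpl in Dp.
destruct (pd_dual D z (x, y) OD Sz Pz Dp) as [-> ->].
destruct (pot y x Dp) as (cx & cy & ex & ey & xx & xy).
assert (zp := Pz _ Dp). change (sw (x, y)) with (y, x). unfold dual_z.
change (sw (x, y)) with (y, x).
unfold is_pdx, is_pdy in *; simpl in *.
split; [|split; [|split; [|split; [|split]]]].
- refine (is_derive_eq _ _ _ _ (is_derive_opp (fun t => chi (y, t)) x _ cy) _). unfold opp; simpl. field. lra.
- refine (is_derive_eq _ _ _ _ (is_derive_opp (fun t => chi (t, x)) y _ cx) _). unfold opp; simpl. field. lra.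
- refine (is_derive_eq _ _ _ _ xy _). field. lra.
- refine (is_derive_eq _ _ _ _ xx _). field. lra.
- refine (is_derive_eq _ _ _ _ ey _). field. lra.
- refine (is_derive_eq _ _ _ _ ex _). field. lra.
Qed.

Lemma smooth2_on_ext D f g :
  open D -> (forall p, D p -> f p = g p) -> smooth2_on D f -> smooth2_on D g.
Proof.
intros OD E [H1 H2].
split; [apply (smooth_on_ext D (fun p => fst (f p)))|apply (smooth_on_ext D (fun p => snd (f p)))];
  auto; intros p Hp; now rewrite E.
Qed.

(** Y_A is X_A for the dual solution, with the same matrix and sign, followed by the swap of
    coordinates and z -> 1 / z. The factor [half_e] concerns surfaces and does not enter. *)
Lemma Y_solution U z chi eta xi A e V W psi :
  open U -> ca_solution U z -> potentials U z chi eta xi ->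
  is_sign (det2 A) -> is_sign e ->
  open V -> open W -> (forall p, V p -> U p) ->
  diffeo V W (fun p => (Y_x A e chi xi p, Y_y A z p)) psi ->
  ca_solution W (fun w => Y_z A z (psi w)).
Proof.
intros OU Zsol pot sA se OV OW VU (Sphi & Spsi & HV & HW).
assert (Zsol' := Zsol). destruct Zsol' as (Sz & Pz & _).
assert (OVs := open_sw V OV). assert (OWs := open_sw W OW).
assert (EP : forall p, V (sw p) ->
  (X_x A (dual_z z) p, X_y A e (fun p => - chi (sw p)) (fun p => xi (sw p)) p)
  = sw (Y_x A e chi xi (sw p), Y_y A z (sw p))).
{ intros p Vp. assert (zp := Pz _ (VU _ Vp)).
  assert (HD : 0 < X_den A (dual_z z) p).
  { apply X_den_pos; [now apply is_sign_neq0|]. apply Rdiv_lt_0_compat; lra. }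
  apply injective_projections; simpl.
  - unfold X_x, Y_y, X_den, dual_z, q_of, p_of in *. simpl in *.
    assert (0 < (a11 A + a12 A * fst p) ^ 2 + a12 A ^ 2 * z (sw p)).
    { replace ((a11 A + a12 A * fst p) ^ 2 + a12 A ^ 2 * z (sw p)) with
       (((a11 A + a12 A * fst p) ^ 2 * (1 / z (sw p)) + a12 A ^ 2) * z (sw p)) by (field; lra).
      now apply Rmult_lt_0_compat. }
    field. simpl in *. repeat split; lra.
  - unfold X_y, Y_x, q_of, p_of. simpl. ring. }
assert (H : ca_solution (fun p => W (sw p)) (fun w => X_z A (dual_z z) (sw (psi (sw w))))).
{ apply (X_solution (fun p => U (sw p)) (dual_z z) (fun p => - chi (sw p)) (fun p => xi (sw p))
    (fun p => eta (sw p)) A e (fun p => V (sw p)) (fun p => W (sw p)) (fun w => sw (psi (sw w))));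
    auto.
  - now apply open_sw.
  - now apply ca_solution_dual.
  - now apply potentials_dual.
  - split; [|split; [|split]].
    + apply (smooth2_on_ext _ (fun p => sw (Y_x A e chi xi (sw p), Y_y A z (sw p)))); auto.
      * intros p Vp. symmetry. now apply EP.
      * destruct Sphi as [S1 S2]. split.
        -- now apply (smooth_on_sw V (Y_y A z)).
        -- now apply (smooth_on_sw V (Y_x A e chi xi)).
    + destruct Spsi as [S1 S2]. split.
      * now apply (smooth_on_sw W (fun w => snd (psi w))).
      * now apply (smooth_on_sw W (fun w => fst (psi w))).
    + intros p Vp. rewrite EP, !sw_sw; [|exact Vp]. destruct (HV _ Vp) as [Ww Ew].
      split; [exact Ww|]. rewrite Ew. apply sw_sw.
    + intros q Wq. destruct (HW _ Wq) as [Vw Ew].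
      rewrite EP; rewrite !sw_sw; [|exact Vw]. split; [exact Vw|].
      rewrite Ew. apply sw_sw. }
(* Dualizing a second time turns the transformed dual solution into the reciprocal of [X_z], which
   is [Y_z]. *)
apply ca_solution_dual in H; [|exact OWs].
apply (ca_solution_ext (fun q => W (sw (sw q)))) with (4 := H); auto.
- intros p Wp. now rewrite sw_sw.
- intros p Wp. unfold dual_z. rewrite sw_sw. assert (zp := Pz _ (VU _ (proj1 (HW _ Wp)))).
  assert (HD : 0 < X_den A (dual_z z) (sw (psi p))).
  { apply X_den_pos; [now apply is_sign_neq0|]. unfold dual_z. rewrite sw_sw.
    apply Rdiv_lt_0_compat; lra. }
  unfold X_z, Y_z, X_den, dual_z, q_of, p_of in *. rewrite sw_sw in *. simpl in *.
  set (Z := z (psi p)) in *. set (x := snd (psi p)) in *.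
  assert (0 < (a11 A + a12 A * x) ^ 2 + a12 A ^ 2 * Z).
  { replace ((a11 A + a12 A * x) ^ 2 + a12 A ^ 2 * Z) with
     (((a11 A + a12 A * x) ^ 2 * (1 / Z) + a12 A ^ 2) * Z) by (field; lra).
    now apply Rmult_lt_0_compat. }
  field. simpl in *. repeat split; try lra.
Qed.

(* The reciprocal solution belongs to a parallel surface with opposite normal. *)
Definition dual_r (r n : R * R -> vec) (p : R * R) : vec := minus (r (sw p)) (n (sw p)).

Definition dual_n (n : R * R -> vec) (p : R * R) : vec := opp (n (sw p)).

Lemma vd_dual_n n p : vdx (dual_n n) p = opp (vdy n (sw p)) /\ vdy (dual_n n) p = opp (vdx n (sw p)).
Proof. destruct (vd_opp (fun q => n (sw q)) p) as [H1 H2]. split; [exact H1|exact H2]. Qed.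

Lemma ln_1_div x : 0 < x -> ln (1 / x) = - ln x.
Proof. intros H. unfold Rdiv. now rewrite Rmult_1_l, ln_Rinv. Qed.

(** For the normal -n the parallel surface r - n has radii - (rho + 1) and - (sigma + 1), which are
    sigma and rho of 1 / z. Without the unit shift the normalization of the radii would fail. *)
Lemma gauss_frame_dual U z r n :
  open U -> ca_solution U z -> gauss_frame U z r n ->
  gauss_frame (fun p => U (sw p)) (dual_z z) (dual_r r n) (dual_n n).
Proof.
intros OU Zsol GF. assert (OS := open_sw U OU).
assert (Pz := proj1 (proj2 Zsol)).
assert (GF' := GF). destruct GF' as (Sr & Sn & H).
assert (Sr' := smooth3_on_sw U r OU Sr). assert (Sn' := smooth3_on_sw U n OU Sn).
split; [now apply smooth3_on_minus|]. split; [now apply smooth3_on_opp|].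
intros p Up. assert (zp := Pz _ Up).
destruct (H _ Up) as (N1 & Nx & Nxy & Ny & Ex & Ey).
destruct (vd_dual_n n p) as [Dx Dy]. rewrite Dx, Dy.
assert (Dr := is_diff3_minus _ _ _ _ _ _ _ (smooth3_on_is_diff3 _ _ p OS Sr' Up)
  (smooth3_on_is_diff3 _ _ p OS Sn' Up)).
apply is_diff3_vd in Dr as [Rx Ry].
assert (Rx' : vdx (dual_r r n) p = minus (vdy r (sw p)) (vdy n (sw p))) by exact Rx.
assert (Ry' : vdy (dual_r r n) p = minus (vdx r (sw p)) (vdx n (sw p))) by exact Ry.
rewrite Rx', Ry', Ex, Ey. clear Rx Ry Rx' Ry' Dx Dy.
split; [|split; [|split; [|split; [|split]]]].
- unfold dual_n. autorewrite with dot. rewrite N1. ring.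
- autorewrite with dot. unfold dual_z.
  apply (Rmult_eq_reg_l (z (sw p))); [|lra].
  transitivity (z (sw p) * dot (vdy n (sw p)) (vdy n (sw p))); [ring|]. rewrite Ny. field. lra.
- autorewrite with dot. rewrite dot_sym, Nxy. ring.
- autorewrite with dot. unfold dual_z. rewrite Nx. field. lra.
- unfold rho_of, sigma_of, dual_z. rewrite ln_1_div; [|exact zp].
  generalize (vdy n (sw p)). clear. intros. vec_ring.
- unfold rho_of, sigma_of, dual_z. rewrite ln_1_div; [|exact zp].
  generalize (vdx n (sw p)). clear. intros. vec_ring.
Qed.

Lemma sheet_dual z r n p :
  0 < z (sw p) -> sheet (dual_r r n) (dual_n n) (sigma_of (dual_z z)) p = sheet r n (rho_of z) (sw p).
Proof.
intros zp. unfold sheet, dual_r, dual_n, sigma_of, rho_of, dual_z. rewrite ln_1_div; [|exact zp].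
generalize (r (sw p)) (n (sw p)). clear. intros. vec_ring.
Qed.

(** Scaling the first row fixes [n_X] and multiplies [X_z] by k^4, so for k > 0 [r_X] moves to a
    parallel surface at signed distance 2 ln k. The second row is divided by k to keep the
    determinant. *)
Definition scale_row (k : R) (A : mat2) : mat2 :=
  Mat2 (k * a11 A) (k * a12 A) (a21 A / k) (a22 A / k).

Lemma det2_scale_row k A : k <> 0 -> det2 (scale_row k A) = det2 A.
Proof. intros H. unfold det2, scale_row; simpl. now field. Qed.

Lemma scale_row_inv k A : k <> 0 -> scale_row k (scale_row (/ k) A) = A.
Proof. intros H. destruct A. unfold scale_row; simpl. f_equal; now field. Qed.

(* [sqrt e], which compensates the unit shift in [dual_r]. *)
Definition half_e : R := exp (1 / 2).

Lemma half_e_neq0 : half_e <> 0.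
Proof. apply Rgt_not_eq, exp_pos. Qed.

Lemma half_e_pow4 : half_e ^ 4 = exp 2.
Proof. unfold half_e. simpl. rewrite Rmult_1_r, <- !exp_plus. f_equal. lra. Qed.

(** * The surfaces [r_Y] as surfaces [r_X] of the dual data *)

Definition Y_den (A : mat2) (z : R * R -> R) (w : R * R) : R :=
  q_of A (snd w) ^ 2 + a12 A ^ 2 * z w.

Lemma Y_den_pos A z w : det2 A <> 0 -> 0 < z w -> 0 < Y_den A z w.
Proof.
intros N zp.
assert (H := X_den_pos A (fun _ => / z w) (snd w, fst w) N (Rinv_0_lt_compat _ zp)).
replace (Y_den A z w) with (X_den A (fun _ => / z w) (snd w, fst w) * z w).
- now apply Rmult_lt_0_compat.
- unfold X_den, Y_den, p_of, q_of. simpl. field. lra.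
Qed.

(** With the unscaled matrix the dual [X_z] is the reciprocal of [Y_z]; the row factor contributes
    k^4 = e^2, hence the 2. *)
Lemma Y_z_dual A z w :
  det2 A <> 0 -> 0 < z w ->
  0 < Y_z A z w /\ ln (X_z (scale_row half_e A) (dual_z z) (sw w)) = 2 - ln (Y_z A z w).
Proof.
intros N zp. assert (HD := Y_den_pos A z w N zp).
assert (YP : 0 < Y_z A z w) by (apply Rdiv_lt_0_compat; [exact zp|now apply pow_lt]).
split; [exact YP|].
transitivity (ln (exp 2 * / Y_z A z w)).
- f_equal. rewrite <- half_e_pow4.
  unfold X_z, Y_z, dual_z, Y_den, p_of, q_of in *. rewrite sw_sw. simpl in *. field.
  simpl. repeat split; lra.
- rewrite ln_mult; [|apply exp_pos|now apply Rinv_0_lt_compat]. rewrite ln_exp, ln_Rinv; lra.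
Qed.

Lemma n_Y_dual A z n w :
  det2 A <> 0 -> 0 < z w ->
  n_Y A z n w = opp (n_X (scale_row half_e A) (dual_z z) (dual_n n) (sw w)).
Proof.
intros N zp. assert (HD := Y_den_pos A z w N zp). assert (Hk := half_e_neq0).
unfold n_Y, n_X. destruct (vd_dual_n n (sw w)) as [-> _]. unfold dual_n, dual_z. rewrite sw_sw.
unfold Y_den, q_of, p_of in *. cbn [scale_row a11 a12 fst snd sw].
set (k := half_e) in *. generalize (n w) (vdy n w). intros a b.
set (D := (a11 A + a12 A * snd w) ^ 2 + a12 A ^ 2 * z w) in *.
set (c1 := (a11 A + a12 A * snd w) ^ 2 - a12 A ^ 2 * z w).
set (c2 := 2 * a12 A * (a11 A + a12 A * snd w) * z w).
transitivity (plus (scal (c1 / D) a) (scal (c2 / D) b)).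
- clear. unfold Rdiv. vec_ring.
- set (Q := k * a11 A + k * a12 A * snd w).
  set (D' := Q ^ 2 * (1 / z w) + (k * a12 A) ^ 2).
  set (c1' := Q ^ 2 * (1 / z w) - (k * a12 A) ^ 2).
  set (c2' := 2 * (k * a12 A) * Q).
  (* The factor k^2 occurs in numerators and denominator alike, so the normal is insensitive to the
     scaling. *)
  assert (ED : D' = k ^ 2 * D / z w) by (unfold D', D, Q; field; lra).
  replace (c1 / D) with (c1' / D').
  2: { rewrite ED. unfold c1', c1, Q. field. repeat split; lra. }
  replace (c2 / D) with (c2' / D').
  2: { rewrite ED. unfold c2', c2, Q. field. repeat split; lra. }
  clear. clearbody D' c1' c2'. unfold Rdiv. vec_ring.
Qed.

Lemma r_Y_dual A z r n w :
  det2 A <> 0 -> 0 < z w ->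
  r_Y A z r n w = r_X (scale_row half_e A) (dual_z z) (dual_r r n) (dual_n n) (sw w).
Proof.
intros N zp. destruct (Y_z_dual A z w N zp) as [YP E].
unfold r_Y, r_X. rewrite (n_Y_dual A z n w N zp), E, sheet_dual; rewrite sw_sw; [|exact zp].
generalize (sheet r n (rho_of z) w) (n_X (scale_row half_e A) (dual_z z) (dual_n n) (sw w)).
generalize (ln (Y_z A z w)). clear. intros L p q. replace (1 / 2 * (2 - L)) with (1 - 1 / 2 * L) by field.
vec_ring.
Qed.

Lemma sheet_Y A z r n w :
  sheet (r_Y A z r n) (n_Y A z n) (rho_of (Y_z A z)) w = sheet r n (rho_of z) w.
Proof.
unfold sheet at 1, r_Y. fold (rho_of (Y_z A z) w).
generalize (sheet r n (rho_of z) w) (n_Y A z n w). intros a b. vec_ring.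
Qed.

Lemma unit_normal_on_opp D r n : unit_normal_on D r n -> unit_normal_on D r (fun p => opp (n p)).
Proof.
intros H p Dp. destruct (H p Dp) as (H1 & H2 & H3). autorewrite with dot. rewrite H1, H2, H3.
repeat split; ring.
Qed.

Lemma principal_radius_opp r n p s :
  principal_radius r n p s -> principal_radius r (fun q => opp (n q)) p (- s).
Proof.
intros [Ns (v & Nv & Ev)]. split; [lra|]. exists v. split; [exact Nv|].
rewrite dmap_opp, Ev. replace (1 / - s) with (- (1 / s)) by now field.
generalize (dmap r p v). clear. intros. vec_ring.
Qed.

Lemma principal_radius_sw r n p s :
  principal_radius r n (sw p) s -> principal_radius (fun q => r (sw q)) (fun q => n (sw q)) p s.
Proof.
intros [Ns (v & Nv & Ev)]. split; [exact Ns|]. exists (sw v). split.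
- intros E. apply Nv. rewrite <- (sw_sw v), E. reflexivity.
- now rewrite !dmap_sw, sw_sw.
Qed.

Lemma ca_surface_opp_sw D r n rho sigma :
  ca_surface D r n rho sigma ->
  ca_surface (fun p => D (sw p)) (fun p => r (sw p)) (fun p => opp (n (sw p)))
    (fun p => - sigma (sw p)) (fun p => - rho (sw p)).
Proof.
intros (OD & Sr & Sn & Im & Un & Rad & (c & sc & Hc)).
assert (OS := open_sw D OD).
split; [exact OS|]. split; [now apply (smooth3_on_sw D r)|].
split; [apply smooth3_on_opp; auto; now apply (smooth3_on_sw D n)|].
split; [|split; [|split]].
- intros p Dp. rewrite <- (sw_sw p). now apply immersion_at_sw, Im.
- apply (unit_normal_on_opp _ (fun p => r (sw p)) (fun p => n (sw p))).
  intros p Dp. destruct (Un _ Dp) as (H1 & H2 & H3). split; [exact H1|split; [exact H3|exact H2]].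
- intros p Dp. destruct (Rad _ Dp) as [H1 H2].
  split; apply (principal_radius_opp (fun p => r (sw p)) (fun p => n (sw p)));
    now apply principal_radius_sw.
- exists c. split; [exact sc|]. intros p Dp. rewrite <- (Hc _ Dp). ring.
Qed.

Lemma ca_surface_ext D D' r r' n n' rho rho' sigma sigma' :
  open D' -> (forall p, D' p -> D p) ->
  (forall p, D' p -> r p = r' p /\ n p = n' p /\ rho p = rho' p /\ sigma p = sigma' p) ->
  ca_surface D r n rho sigma -> ca_surface D' r' n' rho' sigma'.
Proof.
intros OD DD E (_ & Sr & Sn & Im & Un & Rad & (c & sc & Hc)).
assert (Lr : forall p, D' p -> locally p (fun q => r q = r' q)).
{ intros p Dp. apply (locally_in D'); auto. intros q Dq. now apply E. }
assert (Ln : forall p, D' p -> locally p (fun q => n q = n' q)).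
{ intros p Dp. apply (locally_in D'); auto. intros q Dq. now apply E. }
assert (Rp : forall p s, D' p -> principal_radius r n p s -> principal_radius r' n' p s).
{ intros p s Dp [Ns (v & Nv & Ev)]. split; [exact Ns|]. exists v. split; [exact Nv|].
  now rewrite <- (dmap_ext_loc r r' p v (Lr p Dp)), <- (dmap_ext_loc n n' p v (Ln p Dp)). }
split; [exact OD|]. split; [|split; [|split; [|split; [|split]]]].
- apply (smooth3_on_ext D' r); auto; [|now apply (smooth3_on_mono D)]. intros p Dp. now apply E.
- apply (smooth3_on_ext D' n); auto; [|now apply (smooth3_on_mono D)]. intros p Dp. now apply E.
- intros p Dp. apply (immersion_at_ext_loc r); auto.
- intros p Dp. destruct (Un p (DD p Dp)) as (H1 & H2 & H3).
  destruct (E p Dp) as (_ & <- & _).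
  assert (Vd : vdx r' p = vdx r p /\ vdy r' p = vdy r p).
  { assert (Dr := smooth3_on_is_diff3 D' r p OD (smooth3_on_mono _ _ _ DD Sr) Dp).
    apply (is_diff3_vd r' p). now apply (is_diff3_ext_loc r); [apply Lr|]. }
  destruct Vd as [-> ->]. auto.
- intros p Dp. destruct (Rad p (DD p Dp)) as [H1 H2]. destruct (E p Dp) as (_ & _ & <- & <-).
  split; now apply Rp.
- exists c. split; [exact sc|]. intros p Dp. destruct (E p Dp) as (_ & _ & <- & <-). auto.
Qed.

(** Swapping parameters and reversing the normal of the dual [r_X] exchanges and negates its radii;
    by [Y_z_dual] the results are rho and sigma of [Y_z]. *)
Lemma Y_surface U z r n A V :
  open U -> ca_solution U z -> gauss_frame U z r n -> det2 A <> 0 ->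
  open V -> (forall p, V p -> U p) -> (forall p, V p -> immersion_at (r_Y A z r n) p) ->
  ca_surface V (r_Y A z r n) (n_Y A z n) (rho_of (Y_z A z)) (sigma_of (Y_z A z)).
Proof.
intros OU Zsol GF NA OV VU Im. assert (Pz := proj1 (proj2 Zsol)).
set (A' := scale_row half_e A).
assert (NA' : det2 A' <> 0) by (unfold A'; rewrite det2_scale_row; [exact NA|exact half_e_neq0]).
assert (H := X_surface (fun p => U (sw p)) (dual_z z) (dual_r r n) (dual_n n) A'
  (open_sw U OU) (ca_solution_dual U z OU Zsol) (gauss_frame_dual U z r n OU Zsol GF) NA'
  (fun p => V (sw p)) (open_sw V OV) (fun p => VU (sw p))).
apply ca_surface_opp_sw in H.
- apply (ca_surface_ext _ V) with (4 := H); [exact OV|intros p Vp; now rewrite sw_sw|].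
  intros p Vp. assert (zp := Pz _ (VU _ Vp)).
  destruct (Y_z_dual A z p NA zp) as [_ E].
  split; [symmetry; now apply r_Y_dual|]. split; [symmetry; now apply n_Y_dual|].
  unfold rho_of, sigma_of, A'. rewrite E. split; field.
- intros p Vp. apply (immersion_at_ext_loc (fun q => r_Y A z r n (sw q))).
  + apply (locally_in (fun q => V (sw q))); [now apply open_sw|exact Vp|].
    intros q Vq. rewrite r_Y_dual; [now rewrite sw_sw|exact NA|now apply Pz, VU].
  + rewrite <- (sw_sw p). now apply immersion_at_sw, Im.
Qed.

(* Up to the orientation of the normal, the common sheet belongs to the larger radius. *)
Lemma orient_sheet F p0 D r1 n1 rho1 sigma1 w0 :
  ca_surface D r1 n1 rho1 sigma1 ->
  same_surface_near F p0 (sheet r1 n1 rho1) w0 \/ same_surface_near F p0 (sheet r1 n1 sigma1) w0 ->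
  exists n' s', smooth3_on D n' /\ unit_normal_on D r1 n' /\
    (forall w, D w -> principal_radius r1 n' w (s' w) /\ principal_radius r1 n' w (s' w - 1)) /\
    same_surface_near F p0 (sheet r1 n' s') w0.
Proof.
intros (OD & Sr & Sn & Im & Un & Rad & (c & sc & Hc)) Same.
(* Here s is the radius of the shared sheet and t the other one; when t = s + 1 the normal is
   reversed, which turns the radii into - s and - s - 1 and keeps the sheet. *)
assert (Red : forall s t : R * R -> R,
  (forall w, D w -> principal_radius r1 n1 w (s w) /\ principal_radius r1 n1 w (t w)) ->
  (forall w, D w -> t w = s w - 1) \/ (forall w, D w -> t w = s w + 1) ->
  same_surface_near F p0 (sheet r1 n1 s) w0 ->
  exists n' s', smooth3_on D n' /\ unit_normal_on D r1 n' /\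
    (forall w, D w -> principal_radius r1 n' w (s' w) /\ principal_radius r1 n' w (s' w - 1)) /\
    same_surface_near F p0 (sheet r1 n' s') w0).
{ intros s t Hst [Et|Et] Sf.
  - exists n1, s. split; [exact Sn|split; [exact Un|split; [|exact Sf]]].
    intros w Dw. rewrite <- Et; auto.
  - exists (fun w => opp (n1 w)), (fun w => - s w).
    split; [now apply smooth3_on_opp|split; [now apply unit_normal_on_opp|split]].
    + intros w Dw. destruct (Hst w Dw) as [H1 H2]. rewrite (Et w Dw) in H2.
      replace (- s w - 1) with (- (s w + 1)) by ring.
      split; now apply principal_radius_opp.
    + replace (sheet r1 (fun w => opp (n1 w)) (fun w => - s w)) with (sheet r1 n1 s); [exact Sf|].
      apply functional_extensionality. intros w. unfold sheet.
      generalize (r1 w) (n1 w) (s w). clear. intros. vec_ring. }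
destruct Same as [Sf|Sf].
- apply (Red rho1 sigma1); auto.
  destruct sc as [-> | ->]; [right|left]; intros w Dw; specialize (Hc w Dw); lra.
- apply (Red sigma1 rho1); auto.
  + intros w Dw. destruct (Rad w Dw). auto.
  + destruct sc as [-> | ->]; [left|right]; intros w Dw; specialize (Hc w Dw); lra.
Qed.

Theorem proposition3
  (U : R * R -> Prop) (z chi eta xi : R * R -> R)
  (U_open : open U) (U_sc : simply_connected U)
  (z_sol : ca_solution U z) (pot : potentials U z chi eta xi) :
  (* (i) *)
  (forall (A : mat2) (e : R), is_sign (det2 A) -> is_sign e ->
   forall (V W : R * R -> Prop) (psi : R * R -> R * R),
     open V -> open W -> (forall p, V p -> U p) ->
     (diffeo V W (fun p => (X_x A z p, X_y A e chi eta p)) psi ->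
      ca_solution W (fun w => X_z A z (psi w))) /\
     (diffeo V W (fun p => (Y_x A e chi xi p, Y_y A z p)) psi ->
      ca_solution W (fun w => Y_z A z (psi w))))
  /\
  (* (ii) *)
  (forall r n : R * R -> R * R * R, corresponds U z r n ->
   (* the surfaces r'_A and r*_A have constant astigmatism and share a sheet with r *)
   (forall A : mat2, is_sign (det2 A) ->
     (forall p, U p ->
        sheet (r_X A z r n) (n_X A z n) (sigma_of (X_z A z)) p
        = sheet r n (sigma_of z) p) /\
     (forall p, U p ->
        sheet (r_Y A z r n) (n_Y A z n) (rho_of (Y_z A z)) p
        = sheet r n (rho_of z) p) /\
     (forall V : R * R -> Prop, open V -> (forall p, V p -> U p) ->
        ((forall p, V p -> immersion_at (r_X A z r n) p) ->
         ca_surface V (r_X A z r n) (n_X A z n)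
           (rho_of (X_z A z)) (sigma_of (X_z A z))) /\
        ((forall p, V p -> immersion_at (r_Y A z r n) p) ->
         ca_surface V (r_Y A z r n) (n_Y A z n)
           (rho_of (Y_z A z)) (sigma_of (Y_z A z)))))
   /\
   (* and there are no others *)
   (forall p0, U p0 ->
    forall (D : R * R -> Prop) (r1 n1 : R * R -> R * R * R) (rho1 sigma1 : R * R -> R),
      ca_surface D r1 n1 rho1 sigma1 ->
    forall w0, D w0 ->
      (immersion_at (sheet r n (sigma_of z)) p0 ->
       same_surface_near (sheet r n (sigma_of z)) p0 (sheet r1 n1 rho1) w0 \/
       same_surface_near (sheet r n (sigma_of z)) p0 (sheet r1 n1 sigma1) w0 ->
       exists A : mat2, is_sign (det2 A) /\
         same_surface_near (r_X A z r n) p0 r1 w0) /\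
      (immersion_at (sheet r n (rho_of z)) p0 ->
       same_surface_near (sheet r n (rho_of z)) p0 (sheet r1 n1 rho1) w0 \/
       same_surface_near (sheet r n (rho_of z)) p0 (sheet r1 n1 sigma1) w0 ->
       exists A : mat2, is_sign (det2 A) /\
         same_surface_near (r_Y A z r n) p0 r1 w0))).
Proof.
split.
{ intros A e sA se V W psi OV OW VU. split; intros Dif.
  - now apply (X_solution U z chi eta xi A e V W psi).
  - now apply (Y_solution U z chi eta xi A e V W psi). }
intros r n Cor. assert (GF := corresponds_gauss_frame U z r n U_open z_sol Cor).
assert (Pz := proj1 (proj2 z_sol)).
split.
{ intros A sA. assert (NA := is_sign_neq0 _ sA).
  split; [intros p _; apply sheet_X|]. split; [intros p _; apply sheet_Y|].
  intros V OV VU. split; intros Im.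
  - now apply (X_surface U).
  - now apply (Y_surface U). }
intros p0 Up0 D r1 n1 rho1 sigma1 CS w0 Dw0. assert (CS' := CS).
destruct CS' as (OD & Sr1 & _ & Im1 & _).
split; intros Im Same.
- destruct (orient_sheet _ _ _ _ _ _ _ _ CS Same) as (n' & s' & Sn' & Un' & Rad & Sf).
  destruct (X_exhaust U z r n U_open z_sol GF D r1 n' s' OD Sr1 Sn' Im1 Un' Rad p0 w0 Up0 Dw0 Im Sf)
    as (A & DA & H).
  exists A. split; [left; exact DA|exact H].
- destruct (orient_sheet _ _ _ _ _ _ _ _ CS Same) as (n' & s' & Sn' & Un' & Rad & Sf).
  assert (OS := open_sw U U_open). assert (Us : U (sw (sw p0))) by now rewrite sw_sw.
  assert (E : forall w, U (sw w) -> sheet r n (rho_of z) (sw w)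
    = sheet (dual_r r n) (dual_n n) (sigma_of (dual_z z)) w).
  { intros w Uw. symmetry. apply sheet_dual. now apply Pz. }
  destruct (X_exhaust (fun p => U (sw p)) (dual_z z) (dual_r r n) (dual_n n) OS
    (ca_solution_dual U z U_open z_sol) (gauss_frame_dual U z r n U_open z_sol GF)
    D r1 n' s' OD Sr1 Sn' Im1 Un' Rad (sw p0) w0 Us Dw0) as (A & DA & H).
  + apply (immersion_at_ext_loc (fun q => sheet r n (rho_of z) (sw q)));
      [now apply (locally_in (fun q => U (sw q)))|now apply immersion_at_sw].
  + apply (same_surface_near_ext (fun q => U (sw q)) (fun q => sheet r n (rho_of z) (sw q))); auto.
    now apply same_surface_near_sw.
  + assert (Hk := half_e_neq0).
    (* [r_Y_dual] multiplies the first row by [half_e], so the matrix found for the dual data is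
       divided by it beforehand. *)
    exists (scale_row (/ half_e) A).
    assert (DA' : det2 (scale_row (/ half_e) A) = 1)
      by (rewrite det2_scale_row; [exact DA|now apply Rinv_neq_0_compat]).
    split; [left; exact DA'|].
    apply same_surface_near_sw in H. rewrite sw_sw in H.
    apply (same_surface_near_ext U) with (4 := H); auto.
    intros w Uw. rewrite r_Y_dual; [now rewrite scale_row_inv| |now apply Pz].
    rewrite DA'. lra.
Qed.
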